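(* Let $V:\mathbb{R}\to[0,\infty)$ be an optimal velocity function, let $h^\star<h<\hat h$ and $d\in\mathbb{R}$, and let $w^{c_1(h),d}$ be the wavefront solution with constant-speed, lying on the first branch $c_1$, of the delay differential equation $w'(t)=f(w_t)$ with parameter $h$. Let $S\subset(-\infty,0]\times[0,\infty)$ be the bounded region defined in the context. If $(-h,h^2V'(c_1(h)))\in S$, then $w^{c_1(h),d}$ is stable, whereas if $(-h,h^2V'(c_1(h)))\in\big((-\infty,0]\times[0,\infty)\big)\setminus\overline{S}$, then $w^{c_1(h),d}$ is unstable.
   Context: Optimal velocity function: $V:\mathbb{R}\to[0,\infty)$ such that (OVF 1) $V$ is non-negative and monotonically increasing (in the weak sense); (OVF 2) $V$ is bounded from above by some $V^{\max}>0$ and $\lim_{s\to\infty}V(s)=V^{\max}$; (OVF 3) there is $d_S\ge0$ such that $V(s)=0$ for all $s\le d_S$ and $V(s)>0$ for all $s>d_S$; (OVF 4) $V$ is $C^1$-smooth, twice continuously differentiable in $(d_S,\infty)$, and there is $b>0$ such that $V'$ is strictly increasing in $(d_S,b)$ and strictly decreasing in $(b,\infty)$. The equation: $C$ is the Banach space of continuous functions $\varphi=(\varphi_1,\varphi_2):[-1,0]\to\mathbb{R}^2$ with norm $\|\varphi\|_C=\sup_{-1\le s\le0}\|\varphi(s)\|_{\mathbb{R}^2}$ (Euclidean norm on $\mathbb{R}^2$). For a continuous $\mathbb{R}^2$-valued function $w$ defined on an interval containing $[t-1,t]$, the segment $w_t\in C$ is $w_t(s)=w(t+s)$, $-1\le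 s\le0$. For a parameter $h>0$, $f:C\to\mathbb{R}^2$ is $$f(\varphi)=\begin{pmatrix}\varphi_2(0)\\ h^2V(\varphi_1(-1)-\varphi_1(0))+h\,\varphi_2(0)\end{pmatrix}.$$ For each $\varphi\in C$ there is a unique solution $w^\varphi:[-1,\infty)\to\mathbb{R}^2$ of $w'(t)=f(w_t)$ with $w^\varphi_0=\varphi$ (continuous on $[-1,\infty)$, continuously differentiable and satisfying the equation for $t>0$). Wavefront solutions: for $c>0$ with $hV(c)=c$ and $d\in\mathbb{R}$, the function $w^{c,d}(t)=(-ct+d,-c)^T$, $t\in\mathbb{R}$, is a solution of $w'(t)=f(w_t)$, called a wavefront solution with constant-speed. First branch: there is a unique pair $(c^\star,h^\star)$ of positive reals with $h^\star V(c^\star)=c^\star$ and $h^\star V'(c^\star)=1$. Put $\hat h:=\lim_{c\searrow d_S}c/V(c)\in(h^\star,\infty]$. For each $h\in(h^\star,\hat h)$, $c_1(h)$ denotes the unique $c\in(d_S,c^\star)$ with $hV(c)=c$; it is known that $c_1:(h^\star,\hat h)\to(d_S,c^\star)$ is well defined and continuously differentiable. The region $S$: $S\subset(-\infty,0]\times[0,\infty)$ is the bounded (open) region in the $(\alpha,\beta)$-plane which is bounded by the two line segments $G_0=\{(\alpha,\beta)\in(-\infty,0]\times[0,\infty):\alpha=0,\ \beta\le\pi^2/2\}$ and $G_1=\{(\alpha,\beta)\in(-\infty,0]\times[0,\infty):\alpha\ge-2,\ \alpha+\beta=0\}$ and the parametrized curve $$C_1=\left\{\left(-\frac{\nu}{\tan(\nu/2)},\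 \frac{\nu^2}{\tan^2(\nu/2)\,(1+\cos\nu)}\right):0<\nu<\pi\right\},$$ whose endpoints (limits as $\nu\to0$ and $\nu\to\pi$) are $(-2,2)$ and $(0,\pi^2/2)$; that is, $S$ is the interior of the Jordan curve $G_0\cup G_1\cup C_1$. Stability: $w^{c,d}$ is stable if for every $\varepsilon>0$ there is $\delta>0$ such that $\|w_0^{c,d}-\varphi\|_C<\delta$, $\varphi\in C$, implies $\|w_t^{c,d}-w_t^\varphi\|_C<\varepsilon$ for all $t\ge0$; otherwise it is unstable. *)

(* Defs.v *)
From mathcomp Require Import all_boot all_order all_algebra.
From mathcomp Require Import all_classical all_reals all_analysis.

Set Implicit Arguments.
Unset Strict Implicit.
Unset Printing Implicit Defensive.

Import Order.TTheory GRing.Theory Num.Theory.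
Import numFieldNormedType.Exports.

Local Open Scope ring_scope.
Local Open Scope classical_set_scope.

Record optimal_velocity (R : realType) (V : R -> R) (Vmax dS : R) : Prop := {
  ovf_ge0 : forall s, 0 <= V s;
  ovf_homo : {homo V : x y / x <= y};
  ovf_max_gt0 : 0 < Vmax;
  ovf_le_max : forall s, V s <= Vmax;
  ovf_cvg : V s @[s --> +oo] --> Vmax;
  ovf_dS_ge0 : 0 <= dS;
  ovf_eq0 : forall s, s <= dS -> V s = 0;
  ovf_gt0 : forall s, dS < s -> 0 < V s;
  ovf_derivable : forall s : R, derivable V s 1;
  ovf_C1 : continuous (derive1 V);
  ovf_derivable2 : forall s, dS < s -> derivable (derive1 V) s 1;
  ovf_C2 : forall s, dS < s -> {for s, continuous (derive1 (derive1 V))};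
  ovf_inflection : exists b : R, [/\ 0 < b,
    {in `]dS, b[ &, {homo derive1 V : x y / x < y}} &
    {in `]b, +oo[ &, {homo derive1 V : x y / x < y >-> y < x}}] }.

Definition eucl_norm (R : realType) (v : R * R) : R :=
  Num.sqrt (v.1 ^+ 2 + v.2 ^+ 2).

(* An element of the phase space C([-1, 0], R^2) is represented by a total
   function; only its values on [-1, 0] are ever used. *)
Definition phase_space (R : realType) : set (R -> R * R) :=
  [set phi : R -> R * R | {within `[-1, 0], continuous phi}].

(* The set below is bounded when phi is in the phase space, so that sup is
   a genuine supremum. *)
Definition normC (R : realType) (phi : R -> R * R) : R :=
  sup [set eucl_norm (phi s) | s in `[-1, 0]].

Definition segment (R : realType) (w : R -> R * R) (t : R) : R -> R * R :=
  fun s => w (t + s).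

Definition rhs (R : realType) (V : R -> R) (h : R) (phi : R -> R * R) : R * R :=
  ((phi 0).2, h ^+ 2 * V ((phi (-1)).1 - (phi 0).1) + h * (phi 0).2).

(* w is the solution on [-1, +oo) with initial segment phi; the values of w
   below -1 are irrelevant. *)
Record solution (R : realType) (V : R -> R) (h : R) (phi w : R -> R * R) : Prop := {
  sol_continuous : {within `[-1, +oo[, continuous w};
  sol_init : {in `[-1, 0], w =1 phi};
  sol_derivable : forall t : R, 0 < t -> derivable w t 1;
  sol_C1 : forall t : R, 0 < t -> {for t, continuous (derive1 w)};
  sol_eq : forall t : R, 0 < t -> derive1 w t = rhs V h (segment w t) }.

Definition stable (R : realType) (V : R -> R) (h : R) (x : R -> R * R) : Prop :=
  forall eps : R, 0 < eps -> exists2 delta : R, 0 < delta &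
    forall phi, phase_space phi ->
      normC (segment x 0 - phi) < delta ->
    forall w, solution V h phi w ->
    forall t : R, 0 <= t -> normC (segment x t - segment w t) < eps.

Definition unstable (R : realType) (V : R -> R) (h : R) (x : R -> R * R) : Prop :=
  ~ stable V h x.

Definition wavefront (R : realType) (c d : R) : R -> R * R :=
  fun t => (- c * t + d, - c).

Definition critical_pair (R : realType) (V : R -> R) (cs hs : R) : Prop :=
  [/\ 0 < cs, 0 < hs, hs * V cs = cs & hs * derive1 V cs = 1].

Definition hhat (R : realType) (V : R -> R) (dS : R) : \bar R :=
  lim ((c / V c)%:E @[c --> dS^'+]).

Definition first_branch (R : realType) (V : R -> R) (dS cs h c : R) : Prop :=
  [/\ dS < c, c < cs & h * V c = c].

Definition quadrant (R : realType) : set (R * R) :=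
  [set p | p.1 <= 0 /\ 0 <= p.2].

Definition G0 (R : realType) : set (R * R) :=
  [set p | quadrant p /\ p.1 = 0 /\ p.2 <= pi ^+ 2 / 2].

Definition G1 (R : realType) : set (R * R) :=
  [set p | quadrant p /\ - 2 <= p.1 /\ p.1 + p.2 = 0].

Definition C1 (R : realType) : set (R * R) :=
  [set (- (nu / tan (nu / 2)),
        nu ^+ 2 / (tan (nu / 2) ^+ 2 * (1 + cos nu))) | nu in `]0, pi[].

(* Union of the bounded connected components of the complement of J.  The
   condition ~ J p is needed because connected_component A p is empty when p
   is not in A. *)
Definition jordan_interior (R : realType) (J : set (R * R)) : set (R * R) :=
  [set p | ~ J p /\ bounded_set (connected_component (~` J) p)].

(* The end points (-2, 2) and (0, pi ^+ 2 / 2) of C1 lie on G1 and G0, so the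
   union is a closed curve. *)
Definition regionS (R : realType) : set (R * R) :=
  jordan_interior (@G0 R `|` @G1 R `|` @C1 R).

(* Main.v *)
Require Import Defs.
From mathcomp Require Import all_boot all_order all_algebra.
From mathcomp Require Import all_classical all_reals all_analysis.
From mathcomp Require Import ring lra.

Set Implicit Arguments.
Unset Strict Implicit.
Unset Printing Implicit Defensive.

Import Order.TTheory GRing.Theory Num.Theory.
Import numFieldNormedType.Exports.

Local Open Scope ring_scope.
Local Open Scope classical_set_scope.

(** With c = c1(h), put x = w_1 - (- c t + d) and y = w_2 + c. The equation for w
    becomes

      x' = y,   y' = h y + b D + r(D),   D(t) = x(t - 1) - x(t),

    where b = h ^ 2 V'(c) and |r(s)| <= M s ^ 2 for small s. On the first branch
    h V'(c) > 1, so 0 < h < b ([first_branch_slope]). The characteristic function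
    of the linear part is z times z - h + b (1 - e ^ (- z)) / z, where the factor z
    comes from translating the wavefront. The second factor has an imaginary
    zero i a if h = critical_h a and b = critical_b a, and this critical curve,
    reflected, is C1. So S consists of the points (- h, b) with 0 < h < 2 between
    the line b = h and the critical curve ([region_below_curve],
    [under_curve_region], [exterior_above_curve]).

    Stability. As one characteristic exponent is zero and the equation is not
    linear, an energy estimate replaces spectral theory. For the velocity y let
    K y(t) be the integral of y over [t - 1, t]; in the linear equation,
    v = y' - h y + b K y vanishes after the delay time. With a suitable gain
    g > 0 and u = y + g y', the cross spectrum of u and v is bounded below by a
    multiple of that of u with itself; this is where (- h, b) in S is used
    ([indicator_coercive]). In the time domain, e times the integral of u ^ 2 is
    at most the integral of u v ([energy_compact], [energy_causal]). This
    bounds y in L^2 and uniformly by the initial deviation, in spite of the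
    remainder r, as long as D is small, and a continuity argument shows that D
    stays small ([y_bound]). The displacement x is then recovered from the quantity
    y - h x + b K x, whose derivative is only r(D) ([x_bound]).

    Instability. Above the critical curve the characteristic equation has a
    root with positive real part ([unstable_root]), found by following its real
    part along a curve on which the imaginary part of the equation vanishes.
    Hence the fundamental solution Y of the linear equation grows exponentially,
    and so there is a rate k > 0 that bounds its growth while 3 k / 5 does not
    ([critical_rate]). Starting solutions with zero displacement and a tiny
    velocity adapted to a record of Y against e ^ (3 k t / 5), the quadratic
    remainder cannot prevent the deviation from reaching a fixed size
    ([instability_core]). These solutions exist because V is Lipschitz
    ([delay_solution_exists]). *)

(** * Derivatives, continuity and antiderivatives on the real line *)

Section Calculus.
Context {R : realType}.
Implicit Types (f g F G : R -> R) (a b c t x k l : R).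
Notation mu := (@lebesgue_measure R).

(** [is_derive] is a type class; behind a constant it is an ordinary
    proposition, on which a lemma can have premises without instance search. *)
Definition der F x k : Prop := is_derive x (1 : R) F k.

Lemma is_deriveD_fun F G x k l : der F x k -> der G x l ->
  der (fun t => F t + G t) x (k + l).
Proof. exact: is_deriveD. Qed.

Lemma is_deriveM_fun F G x k l : der F x k -> der G x l ->
  der (fun t => F t * G t) x (k * G x + F x * l).
Proof.
move=> hF hG; have h := is_deriveM hF hG.
apply: is_derive_eq h _; rewrite /GRing.scale/=; ring.
Qed.

Lemma is_deriveN_fun F x k : der F x k ->
  der (fun t => - F t) x (- k).
Proof. exact: is_deriveN. Qed.

Lemma is_derive_comp_fun F G x k l : der F x k ->
  der G (F x) l -> der (fun t => G (F t)) x (k * l).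
Proof.
move=> hF hG; have := @is_derive1_comp R G F x l k hG hF.
by rewrite mulrC.
Qed.

Lemma is_derive_continuous F x k : der F x k -> {for x, continuous F}.
Proof.
by move=> [h _]; apply: differentiable_continuous; apply/derivable1_diffP.
Qed.

Lemma continuousD_fun f g : continuous f -> continuous g ->
  continuous (fun t => f t + g t).
Proof. by move=> hf hg t; apply: continuousD; [exact: hf|exact: hg]. Qed.

Lemma continuousM_fun f g : continuous f -> continuous g ->
  continuous (fun t => f t * g t).
Proof. by move=> hf hg t; apply: continuousM; [exact: hf|exact: hg]. Qed.

Lemma continuousN_fun f : continuous f -> continuous (fun t => - f t).
Proof. by move=> hf t; apply: continuousN; exact: hf. Qed.

Lemma continuous_comp_fun f g : continuous f -> continuous g ->
  continuous (fun t => g (f t)).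
Proof. by move=> hf hg t; apply: continuous_comp; [exact: hf|exact: hg]. Qed.

Lemma continuous_norm_fun f : continuous f -> continuous (fun t => `|f t|).
Proof.
by move=> hf t; apply: (continuous_comp (hf t)); exact: norm_continuous.
Qed.

Lemma continuousX_fun f n : continuous f -> continuous (fun t => f t ^+ n).
Proof.
by move=> hf; apply: (@continuous_comp_fun f (fun x => x ^+ n)) => //; exact: exprn_continuous.
Qed.

Let prim f x := if 0 <= x then \int[mu]_(t in `]0, x]) f t
                else - \int[mu]_(t in `]x, 0]) f t.

Let prim_derive f x : continuous f -> is_derive x 1 (prim f) (f x).
Proof.
move=> hf; pose a : R := - `|x| - 1; pose u : R := `|x| + 1.
have n0 := normr_ge0 x.
have xu : x < u by rewrite /u; have := ler_norm x; lra.
have ax : a < x by rewrite /a; have := ler_norm (- x); rewrite normrN; lra.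
have hi c d : mu.-integrable `[c, d] (EFin \o f).
  apply: continuous_compact_integrable; first exact: segment_compact.
  exact: continuous_subspaceT.
pose J (y : R) := \int[mu]_(t in `[a, y]) f t.
have [dJ vJ] : derivable J x 1 /\ J^`() x = f x.
  exact: (@continuous_FTC1_closed R f a x u xu (hi a u) ax (hf x)).
have dJ' : der (fun y => J y - J 0) x (f x).
  have : der J x (f x) by rewrite -vJ derive1E; exact: derivableP.
  move=> h; have := is_deriveD_fun h (is_derive_cst (- J 0) x 1).
  by rewrite addr0.
(* the base point a of J lies to the left of both 0 and x *)
apply: near_eq_is_derive dJ'.
near=> y.
have ay : a < y by near: y; exact: lt_nbhsr.
rewrite /prim /J; case: ifPn => y0.
- rewrite Rintegral_itvB//.
  rewrite bnd_simp; rewrite /a; lra.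
- rewrite -ltNge in y0; rewrite -opprB Rintegral_itvB// bnd_simp; lra.
Unshelve. all: by end_near.
Qed.

(** The Lebesgue integral from 0 is differentiable by the fundamental theorem
    of calculus. *)
Lemma ex_antiderivative f : continuous f ->
  exists F, forall x, der F x (f x).
Proof. by move=> hf; exists (prim f) => x; exact: prim_derive. Qed.

End Calculus.

(** * The oriented integral of a continuous function *)

Section Integral.
Context {R : realType}.
Implicit Types (f g F G : R -> R) (a b c t x k l : R).

Definition antiderivative f : R -> R :=
  xget (fun=> 0) [set F | forall x, der F x (f x)].

(** For continuous functions this is the Riemann integral. As a difference of
    values of one antiderivative it is additive for all positions of the
    bounds, and its other rules follow from the uniqueness of antiderivatives. *)
Definition intg f a b : R := antiderivative f b - antiderivative f a.

Lemma antiderivativeP f x : continuous f ->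
  der (antiderivative f) x (f x).
Proof.
move=> hf; rewrite /antiderivative; case: xgetP => [F _|/= h].
  exact.
by have [F hF] := ex_antiderivative hf; have := h F.
Qed.

Lemma is_derive_intg f a x : continuous f ->
  der (fun t => intg f a t) x (f x).
Proof.
move=> hf; have h1 := antiderivativeP x hf.
have := is_deriveD_fun h1 (is_derive_cst (- antiderivative f a) x 1).
by rewrite addr0.
Qed.

Lemma continuous_intg f a : continuous f -> continuous (fun t => intg f a t).
Proof. by move=> hf t; apply: is_derive_continuous (is_derive_intg a t hf). Qed.

Lemma MVT_le f F a b : a <= b ->
  (forall x, a < x < b -> der F x (f x)) ->
  {within `[a, b], continuous F} ->
  (forall x, a <= x <= b -> 0 <= f x) -> F a <= F b.
Proof.
move=> ab hF cF f0.
have hF' x : x \in `]a, b[%R -> der F x (f x).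
  by rewrite in_itv/= => h; exact: hF.
have [c] := MVT_segment ab hF' cF.
rewrite in_itv/= => /andP[ac cb] h.
rewrite -subr_ge0 h mulr_ge0 ?subr_ge0// f0//.
by rewrite ac cb.
Qed.

Lemma der_ge0_le F f a b : a <= b ->
  (forall x, der F x (f x)) ->
  (forall x, a <= x <= b -> 0 <= f x) -> F a <= F b.
Proof.
move=> ab hF; apply: MVT_le => //.
by apply: continuous_subspaceT => t; apply: is_derive_continuous (hF t).
Qed.

(** No derivative is asked for at the end points: the velocity of a solution need
    not be differentiable at the initial time. *)
Lemma intg_FTC_within f F a b : continuous f -> a <= b ->
  (forall x, a < x < b -> der F x (f x)) ->
  {within `[a, b], continuous F} -> intg f a b = F b - F a.
Proof.
move=> hf ab hF cF.
pose H t := F t - antiderivative f t.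
have cA : continuous (antiderivative f).
  by move=> t; apply: is_derive_continuous (antiderivativeP t hf).
have hH x : x \in `]a, b[%R -> der H x 0.
  rewrite in_itv/= => h.
  have := is_deriveD_fun (hF x h) (is_deriveN_fun (antiderivativeP x hf)).
  by rewrite subrr.
have cH : {within `[a, b], continuous H}.
  move=> x; apply: continuousB; first exact: cF.
  by apply: continuous_subspaceT.
have [c _ h] := MVT_segment ab hH cH.
by move: h; rewrite /H /intg mul0r; lra.
Qed.

Lemma intg_FTC f F a b : continuous f ->
  (forall x, der F x (f x)) -> intg f a b = F b - F a.
Proof.
move=> hf hF.
have cF : continuous F by move=> t; apply: is_derive_continuous (hF t).
have [ab|ba] := leP a b.
  by apply: intg_FTC_within => //; exact: continuous_subspaceT.
rewrite /intg -opprB -/(intg f b a) (@intg_FTC_within f F b a) ?ltW//; last first.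
  exact: continuous_subspaceT.
lra.
Qed.

Lemma intg_chasles f b a c : intg f a b + intg f b c = intg f a c.
Proof. by rewrite /intg; ring. Qed.

Lemma intgxx f a : intg f a a = 0.
Proof. by rewrite /intg subrr. Qed.

Lemma intgD f g a b : continuous f -> continuous g ->
  intg (fun t => f t + g t) a b = intg f a b + intg g a b.
Proof.
move=> hf hg.
rewrite (@intg_FTC _ (fun t => intg f a t + intg g a t)) ?intgxx ?addr0 ?subr0//.
  exact: continuousD_fun.
by move=> x; apply: is_deriveD_fun; exact: is_derive_intg.
Qed.

Lemma intgZ f k a b : continuous f ->
  intg (fun t => k * f t) a b = k * intg f a b.
Proof.
move=> hf.
rewrite (@intg_FTC _ (fun t => k * intg f a t)) ?intgxx ?mulr0 ?subr0//.
  by apply: continuousM_fun => // t; exact: cst_continuous.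
move=> x; have := is_deriveM_fun (is_derive_cst k x 1) (is_derive_intg a x hf).
by rewrite mul0r add0r.
Qed.

Lemma intgN f a b : continuous f ->
  intg (fun t => - f t) a b = - intg f a b.
Proof.
move=> hf; rewrite -mulN1r -intgZ//; congr intg.
by apply/funext => t; rewrite mulN1r.
Qed.

Lemma intgB f g a b : continuous f -> continuous g ->
  intg (fun t => f t - g t) a b = intg f a b - intg g a b.
Proof.
move=> hf hg; rewrite (intgD _ _ hf (continuousN_fun hg)) intgN//.
Qed.

Lemma intg_cst k a b : intg (fun=> k) a b = k * (b - a).
Proof.
rewrite (@intg_FTC _ (fun t => k * t)).
- by rewrite mulrBr.
- by move=> t; exact: cst_continuous.
- move=> x; have := is_deriveM_fun (is_derive_cst k x 1) (is_derive_id x 1).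
  by rewrite mul0r add0r mulr1.
Qed.

Lemma intg_ge0 f a b : continuous f -> a <= b ->
  (forall x, a <= x <= b -> 0 <= f x) -> 0 <= intg f a b.
Proof.
move=> hf ab f0; rewrite -(intgxx f a).
apply: (@der_ge0_le (fun t => intg f a t) f) => // x.
exact: is_derive_intg.
Qed.

Lemma le_intg f g a b : continuous f -> continuous g -> a <= b ->
  (forall x, a <= x <= b -> f x <= g x) -> intg f a b <= intg g a b.
Proof.
move=> hf hg ab fg; rewrite -subr_ge0 -intgB//; apply: intg_ge0 => //.
  by apply: continuousD_fun => //; exact: continuousN_fun.
by move=> x /fg; rewrite subr_ge0.
Qed.

Lemma eq_intg f g a b : continuous f -> continuous g -> a <= b ->
  (forall x, a <= x <= b -> f x = g x) -> intg f a b = intg g a b.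
Proof.
move=> hf hg ab fg; apply/eqP; rewrite eq_le !le_intg// => x /fg ->//.
Qed.

Lemma intg_eq0 f a b : continuous f -> a <= b ->
  (forall x, a <= x <= b -> f x = 0) -> intg f a b = 0.
Proof.
move=> hf ab h; rewrite (@eq_intg _ (fun=> 0)) ?intg_cst ?mul0r//.
by move=> t; exact: cst_continuous.
Qed.

Lemma le_intg_itv f a b c d : continuous f -> (forall x, 0 <= f x) ->
  c <= a -> a <= b -> b <= d -> intg f a b <= intg f c d.
Proof.
move=> hf f0 ca ab bd; rewrite -(intg_chasles f a c) -(intg_chasles f b a d).
have h1 : 0 <= intg f c a by apply: intg_ge0.
have h2 : 0 <= intg f b d by apply: intg_ge0.
lra.
Qed.

Lemma norm_intg_le f g a b : continuous f -> continuous g -> a <= b ->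
  (forall x, a <= x <= b -> `|f x| <= g x) -> `|intg f a b| <= intg g a b.
Proof.
move=> hf hg ab fg; rewrite ler_norml -intgN//; apply/andP; split.
  apply: le_intg => //; first exact: continuousN_fun.
  by move=> x /fg; rewrite ler_norml => /andP[].
by apply: le_intg => // x /fg; rewrite ler_norml => /andP[].
Qed.

Lemma continuous_shift f c : continuous f -> continuous (fun t => f (t + c)).
Proof.
move=> hf; apply: continuous_comp_fun => //; apply: continuousD_fun.
  by move=> t; exact: cvg_id.
by move=> t; exact: cst_continuous.
Qed.

Lemma is_derive_shift_fun F c x k : der F (x + c) k ->
  der (fun t => F (t + c)) x k.
Proof.
move=> hF; have := is_deriveD_fun (is_derive_id x 1) (is_derive_cst c x 1).
rewrite addr0 => h; have := is_derive_comp_fun h hF.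
by rewrite mul1r.
Qed.

Lemma intg_shift f c a b : continuous f ->
  intg (fun t => f (t + c)) a b = intg f (a + c) (b + c).
Proof.
move=> hf; rewrite (@intg_FTC _ (fun t => antiderivative f (t + c)))//.
  exact: continuous_shift.
by move=> x; apply: is_derive_shift_fun; exact: antiderivativeP.
Qed.

Lemma intg_parts F G f g a b : continuous f -> continuous g ->
  (forall x, der F x (f x)) -> (forall x, der G x (g x)) ->
  intg (fun t => F t * g t) a b =
  F b * G b - F a * G a - intg (fun t => f t * G t) a b.
Proof.
move=> hf hg hF hG.
have cF : continuous F by move=> t; apply: is_derive_continuous (hF t).
have cG : continuous G by move=> t; apply: is_derive_continuous (hG t).
have h1 := continuousM_fun cF hg; have h2 := continuousM_fun hf cG.
rewrite -[RHS]addr0 -(subrr (intg (fun t => F t * g t) a b)).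
rewrite -(@intg_FTC (fun t => f t * G t + F t * g t) (fun t => F t * G t)).
- rewrite intgD//; ring.
- exact: continuousD_fun.
- by move=> x; exact: is_deriveM_fun.
Qed.

End Integral.

Definition cts (R : realType) (f : R -> R) : Prop := continuous f.

Lemma cts_id (R : realType) : cts (fun t : R => t).
Proof. by move=> t; exact: cvg_id. Qed.

Lemma cts_cst (R : realType) (k : R) : cts (fun _ : R => k).
Proof. by move=> t; exact: cst_continuous. Qed.

Lemma cts_intg (R : realType) (f g : R -> R) a : cts f -> cts g ->
  cts (fun t => intg f a (g t)).
Proof.
move=> hf hg; apply: (continuous_comp_fun hg).
exact: (@continuous_intg R f a hf).
Qed.

(** [cont] proves continuity by recursion on the shape of the function. *)
Ltac cont_atom := first [assumption | exact: continuous_cos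
  | exact: continuous_sin | exact: continuous_expR].

Ltac cont_rec := lazymatch goal with |- @cts ?R ?F => lazymatch F with
  | (fun t => t) => apply: cts_id
  | (fun _ => ?k) => apply: cts_cst
  | (fun t => (@?f t + @?g t)%R) => apply: (@continuousD_fun R f g); cont_go
  | (fun t => (@?f t * @?g t)%R) => apply: (@continuousM_fun R f g); cont_go
  | (fun t => (- @?f t)%R) => apply: (@continuousN_fun R f); cont_go
  | (fun t => (@?f t ^+ ?n)%R) => apply: (@continuousX_fun R f n); cont_go
  | (fun t => `|@?f t|%R) => apply: (@continuous_norm_fun R f); cont_go
  | (fun t => intg ?f ?a (@?g t)) => apply: (@cts_intg R f g a); cont_go
  | (fun t => ?f t) => first [cont_atom | change (@cts R f)]
  | (fun t => ?f (@?g t)) =>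
      apply: (@continuous_comp_fun R g f); [cont_go | cont_go]
  | _ => first [cont_atom | idtac]
  end end
with cont_go := lazymatch goal with
  | |- @cts _ _ => cont_rec
  | |- continuous ?f => change (cts f); cont_rec
  end.
Ltac cont := cont_go.

(** * Computing derivatives *)

Section DerLemmas.
Context {R : realType}.
Implicit Types (f g F G : R -> R) (a b c t x k l : R).

Lemma der_id x : der (fun t : R => t) x 1.
Proof. exact: is_derive_id. Qed.

Lemma der_cst k x : der (fun _ : R => k) x 0.
Proof. exact: is_derive_cst. Qed.

Lemma derX F x k n : der F x k ->
  der (fun t => F t ^+ n) x (n%:R * F x ^+ n.-1 * k).
Proof.
move=> h; have h' := is_deriveX n h; apply: (is_derive_eq (f := fun t => F t ^+ n) _ erefl).
by move: h'; rewrite /GRing.scale/=; congr (is_derive _ _ _ _); apply/funext => t; rewrite fctE.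
Qed.

Lemma der_cos F x k : der F x k -> der (fun t => cos (F t)) x (k * - sin (F x)).
Proof. move=> h; apply: (is_derive_comp_fun h); exact: is_derive_cos. Qed.

Lemma der_sin F x k : der F x k -> der (fun t => sin (F t)) x (k * cos (F x)).
Proof. move=> h; apply: (is_derive_comp_fun h); exact: is_derive_sin. Qed.

Lemma der_exp F x k : der F x k -> der (fun t => expR (F t)) x (k * expR (F x)).
Proof. move=> h; apply: (is_derive_comp_fun h); exact: is_derive_expR. Qed.

Lemma derV F x k : F x != 0 -> der F x k ->
  der (fun t => (F t)^-1) x (- (k / F x ^+ 2)).
Proof.
move=> h0 h; have := @is_deriveV R F x k 1 h0 h.
by rewrite /GRing.scale/= mulNr mulrC.
Qed.

Lemma der_intg f F a x k : continuous f -> der F x k ->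
  der (fun t => intg f a (F t)) x (k * f (F x)).
Proof. by move=> hf h; apply: (is_derive_comp_fun h); exact: is_derive_intg. Qed.

Lemma der_eq F x k l : der F x k -> k = l -> der F x l.
Proof. by move=> h <-. Qed.

Lemma der_cts F f : (forall x, der F x (f x)) -> cts F.
Proof. by move=> h t; apply: is_derive_continuous (h t). Qed.

End DerLemmas.

(** [derv] computes a derivative by recursion on the shape of the function and
    leaves the equation between the result and the claimed value. *)
Ltac der_rec := lazymatch goal with |- @der ?R ?F _ _ => lazymatch F with
  | (fun t => t) => apply: der_id
  | (fun _ => ?k) => apply: der_cst
  | (fun t => (@?f t + @?g t)%R) => apply: (@is_deriveD_fun R f g); der_rec
  | (fun t => (@?f t * @?g t)%R) => apply: (@is_deriveM_fun R f g); der_rec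
  | (fun t => (- @?f t)%R) => apply: (@is_deriveN_fun R f); der_rec
  | (fun t => (@?f t ^+ ?n)%R) => apply: (@derX R f); der_rec
  | (fun t => cos (@?f t)) => apply: (@der_cos R f); der_rec
  | (fun t => sin (@?f t)) => apply: (@der_sin R f); der_rec
  | (fun t => expR (@?f t)) => apply: (@der_exp R f); der_rec
  | (fun t => intg ?f ?a (@?g t)) => apply: (@der_intg R f g a); [cont | der_rec]
  | (fun t => (@?f t)^-1) => apply: (@derV R f); [idtac | der_rec]
  | (fun t => ?f t) => first [eassumption | match goal with H : _ |- _ => apply: H end]
  | (fun t => ?f (@?g t)) =>
      apply: (@is_derive_comp_fun R g f); [der_rec | match goal with H : _ |- _ => apply: H end]
  | _ => first [exact: is_derive_cos | exact: is_derive_sin | exact: is_derive_expR | eassumption | match goal with H : _ |- _ => apply: H end]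
  end end.
Ltac derv := apply: der_eq; [der_rec | cbv beta; cbn [Nat.pred predn]].

(** * Trigonometric inequalities *)

Section Trig.
Context {R : realType}.
Implicit Types (a x nu : R).

Lemma der_gt0_lt (F f : R -> R) a b : a < b -> (forall x, der F x (f x)) ->
  (forall x, a < x < b -> 0 < f x) -> F a < F b.
Proof.
move=> ab hF f0.
have hF' x : x \in `]a, b[%R -> is_derive x 1 F (f x) by move=> _; exact: hF.
have cF : {within `[a, b], continuous F}.
  by apply: continuous_subspaceT; exact: der_cts hF.
have [c] := MVT ab hF' cF.
rewrite in_itv/= => /f0 fc h.
by rewrite -subr_gt0 h mulr_gt0// subr_gt0.
Qed.

Lemma der_itv_within (F f : R -> R) a b :
  (forall x, a <= x <= b -> der F x (f x)) -> {within `[a, b], continuous F}.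
Proof.
move=> hF; apply: continuous_in_subspaceT => x; rewrite inE/= in_itv/= => h.
exact: is_derive_continuous (hF x h).
Qed.

Lemma der_ge0_le_itv (F f : R -> R) a b : a <= b ->
  (forall x, a <= x <= b -> der F x (f x)) ->
  (forall x, a <= x <= b -> 0 <= f x) -> F a <= F b.
Proof.
move=> ab hF f0; apply: (@MVT_le _ f) => //.
- by move=> x /andP[h1 h2]; apply: hF; rewrite !ltW.
- exact: der_itv_within hF.
Qed.

Lemma der_MVT (F f : R -> R) a b : a < b ->
  (forall x, a <= x <= b -> der F x (f x)) ->
  exists c, [/\ a < c, c < b & F b - F a = f c * (b - a)].
Proof.
move=> ab hF.
have hF' x : x \in `]a, b[%R -> is_derive x 1 F (f x).
  by rewrite in_itv/= => /andP[h1 h2]; apply: hF; rewrite !ltW.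
have [c] := MVT ab hF' (der_itv_within hF).
by rewrite in_itv/= => /andP[h1 h2] h3; exists c.
Qed.

Lemma sin_le_id x : 0 <= x -> sin x <= x.
Proof.
move=> x0.
have := @der_ge0_le R (fun t => t - sin t) (fun t => 1 - cos t) 0 x x0.
rewrite sin0 subrr subr_ge0; apply.
- by move=> t; derv; ring.
- by move=> t _; rewrite subr_ge0 cos_le1.
Qed.

Lemma cos_ge_quad x : 1 - x ^+ 2 / 2 <= cos x.
Proof.
wlog x0 : x / 0 <= x => [hw|].
  case: (leP 0 x) => [/hw//|x0]; rewrite -cosN -sqrrN; apply: hw; lra.
have := @der_ge0_le R (fun t => cos t - 1 + t ^+ 2 / 2) (fun t => t - sin t) 0 x x0.
rewrite cos0 => h.
have : 1 - 1 + 0 ^+ 2 / 2 <= cos x - 1 + x ^+ 2 / 2.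
  apply: h; first by move=> t; derv; rewrite ?expr1; field.
  by move=> t /andP[t0 _]; rewrite subr_ge0 sin_le_id.
rewrite expr0n/=; lra.
Qed.

Lemma sin_ge_cubic x : 0 <= x -> x - x ^+ 3 / 6 <= sin x.
Proof.
move=> x0.
have := @der_ge0_le R (fun t => sin t - t + t ^+ 3 / 6)
  (fun t => cos t - (1 - t ^+ 2 / 2)) 0 x x0.
rewrite sin0 => h.
have : 0 - 0 + 0 ^+ 3 / 6 <= sin x - x + x ^+ 3 / 6.
  apply: h; first by move=> t; derv; field.
  by move=> t _; rewrite subr_ge0 cos_ge_quad.
rewrite expr0n/=; lra.
Qed.

Lemma sin_sub_mulcos_gt0 x : 0 < x <= pi -> 0 < sin x - x * cos x.
Proof.
move=> /andP[x0 xpi].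
have := @der_gt0_lt (fun t => sin t - t * cos t) (fun t => t * sin t) 0 x x0.
rewrite sin0 mul0r subrr; apply.
- by move=> t; derv; ring.
- move=> t /andP[t0 tx]; rewrite mulr_gt0// sin_gt0_pi//.
  by rewrite t0 (lt_le_trans tx).
Qed.

Lemma two_onemcos_sub_mulsin_gt0 x : 0 < x <= pi ->
  0 < 2 * (1 - cos x) - x * sin x.
Proof.
move=> /andP[x0 xpi].
have := @der_gt0_lt (fun t => 2 * (1 - cos t) - t * sin t)
  (fun t => sin t - t * cos t) 0 x x0.
rewrite cos0 mul0r subrr mulr0 subrr; apply.
- by move=> t; derv; ring.
- move=> t /andP[t0 tx]; rewrite sin_sub_mulcos_gt0// t0/=.
  by rewrite ltW// (lt_le_trans tx).
Qed.

Lemma sin_sub_mulcos_gt x : 0 < x <= pi ->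
  x ^+ 2 * sin x < 3 * (sin x - x * cos x).
Proof.
move=> /andP[x0 xpi]; rewrite -subr_gt0.
have := @der_gt0_lt (fun t => 3 * (sin t - t * cos t) - t ^+ 2 * sin t)
  (fun t => t * (sin t - t * cos t)) 0 x x0.
rewrite sin0 mul0r subrr mulr0 mulr0 subrr; apply.
- by move=> t; derv; ring.
- move=> t /andP[t0 tx]; rewrite mulr_gt0// sin_sub_mulcos_gt0// t0/=.
  by rewrite ltW// (lt_le_trans tx).
Qed.

Lemma sin_jordan x : 0 <= x <= pi / 2 -> 2 * x / pi <= sin x.
Proof.
have pi0 : 0 < pi :> R := pi_gt0 R.
move=> /andP[]; rewrite le_eqVlt => /predU1P[<-|x0] xpi.
  by rewrite sin0 mulr0 mul0r.
(* sin t / t is decreasing on ]0, pi/2] *)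
have := @der_ge0_le R (fun t => t * sin x - x * sin t)
  (fun t => sin x - x * cos t) x (pi / 2) xpi.
rewrite sin_pihalf => h.
have : x * sin x - x * sin x <= pi / 2 * sin x - x * 1.
  apply: h; first by move=> t; derv; ring.
  move=> t /andP[xt tpi].
  have h1 : 0 < sin x - x * cos x by apply: sin_sub_mulcos_gt0; rewrite x0/=; lra.
  have : cos t <= cos x.
    move: xt; rewrite le_eqVlt => /predU1P[->//|xt].
    by rewrite ltW// ltr_cos ?in_itv/= ?(ltW x0)/=; lra.
  move=> /(ler_wpM2l (ltW x0)); lra.
rewrite subrr mulr1 subr_ge0 => h2.
rewrite ler_pdivrMr//; lra.
Qed.

(** This is Jordan's inequality for the half angle. *)
Lemma onemcos_ge a : 0 <= a <= pi -> 2 * a ^+ 2 / pi ^+ 2 <= 1 - cos a.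
Proof.
move=> /andP[a0 api]; have pi0 : 0 < pi :> R := pi_gt0 R.
have h1 : 2 * (a / 2) / pi <= sin (a / 2) by apply: sin_jordan; lra.
have -> : 1 - cos a = 2 * sin (a / 2) ^+ 2.
  rewrite {1}(_ : a = a / 2 + a / 2); last by field.
  rewrite cosD; have := cos2Dsin2 (a / 2); rewrite !expr2; lra.
have h0 : 0 <= 2 * (a / 2) / pi by rewrite divr_ge0 ?(ltW pi0)//; lra.
have : (2 * (a / 2) / pi) ^+ 2 <= sin (a / 2) ^+ 2.
  by rewrite ler_pXn2r// nnegrE (le_trans h0).
rewrite (_ : (2 * (a / 2) / pi) ^+ 2 = a ^+ 2 / pi ^+ 2); first lra.
have pin0 : pi != 0 :> R by rewrite gt_eqF.
by move: (pi) pin0 => p p0; field.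
Qed.
Lemma onemcos_gt0 x : 0 < x <= pi -> 0 < 1 - cos x.
Proof.
move=> /andP[x0 xpi]; apply: lt_le_trans (onemcos_ge _); last by rewrite (ltW x0).
by rewrite divr_gt0 ?mulr_gt0 ?exprn_gt0// pi_gt0.
Qed.

Lemma id_sub_sin_gt0 x : 0 < x <= pi -> 0 < x - sin x.
Proof.
move=> /andP[x0 xpi].
have := @der_gt0_lt (fun t => t - sin t) (fun t => 1 - cos t) 0 x x0.
rewrite sin0 subrr; apply; first by move=> t; derv; ring.
by move=> t /andP[t0 tx]; apply: onemcos_gt0; lra.
Qed.
End Trig.

(** * The critical curve *)

Section CriticalCurve.
Context {R : realType}.
Implicit Types a h t : R.

(** The parameters (h, b) at which the characteristic function
    z ^ 2 - h z + b (1 - e ^ (- z)) vanishes at the imaginary number i a. *)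
Definition critical_h a := a * sin a / (1 - cos a).
Definition critical_b a := a ^+ 2 / (1 - cos a).

Lemma der_critical_h a : 0 < a <= pi -> der critical_h a (- ((a - sin a) / (1 - cos a))).
Proof.
move=> /onemcos_gt0/lt0r_neq0 cn; rewrite /critical_h; derv => //.
have c2 : sin a ^+ 2 = 1 - cos a ^+ 2 by exact: sin2cos2.
by field: c2.
Qed.

Lemma der_critical_b a : 0 < a <= pi ->
  der critical_b a (a * (2 * (1 - cos a) - a * sin a) / (1 - cos a) ^+ 2).
Proof.
by move=> /onemcos_gt0/lt0r_neq0 cn; rewrite /critical_b; derv => //; field.
Qed.

Lemma critical_h_decreasing x y : 0 < x -> x < y -> y <= pi ->
  critical_h y < critical_h x.
Proof.
move=> x0 xy ypi.
have dH t : x <= t <= y -> der critical_h t (- ((t - sin t) / (1 - cos t))).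
  by move=> /andP[xt ty]; apply: der_critical_h; lra.
have [c [xc cy e]] := der_MVT xy dH.
have c0 : 0 < c <= pi by lra.
rewrite -subr_lt0 e pmulr_llt0 ?subr_gt0// oppr_lt0.
by rewrite divr_gt0 ?onemcos_gt0 ?id_sub_sin_gt0.
Qed.

Lemma critical_b_increasing x y : 0 < x -> x < y -> y <= pi ->
  critical_b x < critical_b y.
Proof.
move=> x0 xy ypi.
have dB t : x <= t <= y -> der critical_b t (t * (2 * (1 - cos t) - t * sin t) / (1 - cos t) ^+ 2).
  by move=> /andP[xt ty]; apply: der_critical_b; lra.
have [c [xc cy e]] := der_MVT xy dB.
have c0 : 0 < c <= pi by lra.
rewrite -subr_gt0 e mulr_gt0 ?subr_gt0// divr_gt0//; last first.
  by rewrite exprn_gt0// onemcos_gt0.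
by rewrite mulr_gt0 ?two_onemcos_sub_mulsin_gt0//; lra.
Qed.

Lemma critical_b_le a : 0 < a <= pi -> critical_b a <= pi ^+ 2 / 2.
Proof.
move=> ha; have /andP[a0] := ha; rewrite le_eqVlt => /predU1P[->|api].
  by rewrite /critical_b cospi opprK.
apply/ltW; have := critical_b_increasing a0 api (lexx _).
by rewrite {2}/critical_b cospi opprK.
Qed.

Lemma critical_h_gt0 a : 0 < a < pi -> 0 < critical_h a.
Proof.
move=> /andP[a0 api]; rewrite divr_gt0 ?onemcos_gt0 ?a0 ?ltW//.
by rewrite mulr_gt0// sin_gt0_pi// a0.
Qed.

Lemma critical_h_lt2 a : 0 < a < pi -> critical_h a < 2.
Proof.
move=> /andP[a0 api]; rewrite ltr_pdivrMr ?onemcos_gt0 ?a0 ?ltW// -subr_gt0.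
by apply: two_onemcos_sub_mulsin_gt0; rewrite a0 ltW.
Qed.

(** Near a = 0 the curve starts at (2, 2), where it meets the line h = b. *)
Lemma critical_near0 e : 0 < e ->
  exists2 a, 0 < a < pi & 2 - e < critical_h a /\ critical_b a < 2 + e.
Proof.
move=> e0; pose a := Num.min 1 e.
have a0 : 0 < a by rewrite lt_min ltr01.
have a1 : a <= 1 by rewrite ge_min lexx.
have ae : a <= e by rewrite ge_min lexx orbT.
clearbody a.
have api : 0 < a < pi by have := pi_ge2 R; lra.
have cn0 : 0 < 1 - cos a by apply: onemcos_gt0; lra.
have c1 := cos_ge_quad a.
have s1 := sin_ge_cubic (ltW a0).
have a2 : a ^+ 2 <= a by rewrite expr2 ler_piMr// ltW.
have a20 : 0 < a ^+ 2 by rewrite exprn_gt0.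
exists a => //; split.
  rewrite /critical_h ltr_pdivlMr//.
  have h1 : a * (a - a ^+ 3 / 6) <= a * sin a by rewrite ler_pM2l.
  have h3 : 0 < a ^+ 2 * (e - a ^+ 2 / 3).
    by rewrite mulr_gt0//; lra.
  have [e2|e2] := ltP e 2; last first.
    have : 0 <= (e - 2) * (1 - cos a) by rewrite mulr_ge0//; lra.
    have : 0 < a * sin a by rewrite mulr_gt0// sin_gt0_pi.
    lra.
  have h2 : (2 - e) * (1 - cos a) <= (2 - e) * (a ^+ 2 / 2) by rewrite ler_pM2l; lra.
  lra.
rewrite /critical_b ltr_pdivrMr//.
have s2 := sin_ge_cubic (ltW (divr_gt0 a0 (ltr0n R 2))).
have c2 : 1 - cos a = 2 * sin (a / 2) ^+ 2.
  have -> : cos a = cos (a / 2 + a / 2) by congr cos; field.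
  by rewrite cosD -!expr2 -[cos _ ^+ 2](subrK 1) -opprB -sin2cos2; ring.
have s3 : 0 <= a / 2 - (a / 2) ^+ 3 / 6.
  rewrite (_ : _ - _ = a / 2 * (1 - a ^+ 2 / 24)); last by field.
  by rewrite mulr_ge0//; lra.
have h1 : (a / 2 - (a / 2) ^+ 3 / 6) ^+ 2 <= sin (a / 2) ^+ 2.
  by rewrite ler_pXn2r// nnegrE// (le_trans s3).
have h2 : (a / 2 - (a / 2) ^+ 3 / 6) ^+ 2 = a ^+ 2 / 4 * (1 - a ^+ 2 / 24) ^+ 2 by field.
have h3 : 1 - a ^+ 2 / 12 <= (1 - a ^+ 2 / 24) ^+ 2.
  have -> : (1 - a ^+ 2 / 24) ^+ 2 = 1 - a ^+ 2 / 12 + (a ^+ 2 / 24) ^+ 2 by field.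
  by rewrite lerDl sqr_ge0.
have h4 : a ^+ 2 / 4 * (1 - a ^+ 2 / 12) <= a ^+ 2 / 4 * (1 - a ^+ 2 / 24) ^+ 2.
  by rewrite ler_pM2l//; lra.
have h5 : a ^+ 2 / 2 * (1 - a ^+ 2 / 12) <= 1 - cos a by rewrite c2; lra.
have h6 : (2 + e) * (a ^+ 2 / 2 * (1 - a ^+ 2 / 12)) <= (2 + e) * (1 - cos a).
  by rewrite ler_pM2l//; lra.
apply: lt_le_trans h6.
have : 0 < a ^+ 2 * (e / 2 - a ^+ 2 / 12 - e * a ^+ 2 / 24).
  rewrite mulr_gt0//; have : e * a ^+ 2 <= e * 1 by rewrite ler_pM2l//; lra.
  lra.
lra.
Qed.

Lemma critical_h_surj h : 0 < h < 2 -> exists2 a, 0 < a < pi & critical_h a = h.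
Proof.
move=> /andP[h0 h2].
have [x xpi [hx _]] := @critical_near0 (2 - h) ltac:(lra).
have /andP[x0 xp] := xpi.
have cw : {within `[x, pi], continuous critical_h}.
  apply: (@der_itv_within R critical_h (fun t => - ((t - sin t) / (1 - cos t)))).
  by move=> t /andP[xt tpi]; apply: der_critical_h; lra.
have hpi : critical_h pi = 0 by rewrite /critical_h sinpi mulr0 mul0r.
have [|a] := @IVT R critical_h x pi h (ltW xp) cw.
  by rewrite hpi ge_min le_max (ltW h0) orbT/=; apply/orP; left; lra.
rewrite in_itv/= => /andP[xa api] e; exists a => //.
apply/andP; split; first lra.
rewrite lt_neqAle api andbT; apply/eqP => ea.
by move: e; rewrite ea hpi => e; move: h0; rewrite -e ltxx.
Qed.

Lemma critical_h_lt_inv x y : 0 < x < pi -> 0 < y < pi -> critical_h x < critical_h y -> y < x.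
Proof.
move=> /andP[x0 xpi] /andP[y0 ypi] e; have [//|lt|e2] := ltgtP y x.
  by have := lt_trans e (critical_h_decreasing x0 lt (ltW ypi)); rewrite ltxx.
by move: e; rewrite e2 ltxx.
Qed.

(** The half-angle formulas turn the given parametrization into the critical
    curve, reflected in the vertical axis since the abscissa is - h. *)
Lemma C1E (p : R * R) : C1 p <-> exists2 a, 0 < a < pi & p = (- critical_h a, critical_b a).
Proof.
have half a : 0 < a < pi ->
    - (a / tan (a / 2)) = - critical_h a /\ a ^+ 2 / (tan (a / 2) ^+ 2 * (1 + cos a)) = critical_b a.
  move=> /andP[a0 api].
  have s0 : sin (a / 2) != 0 by rewrite gt_eqF// sin_gt0_pi//; lra.
  have c0 : cos (a / 2) != 0 by rewrite gt_eqF// cos_gt0_pihalf//; lra.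
  have sa : sin a = 2 * sin (a / 2) * cos (a / 2).
    by rewrite -[in LHS](divfK (_ : 2 != 0 :> R) a)// mulr_natr mulr2n sinD; ring.
  have cs : cos (a / 2) ^+ 2 = 1 - sin (a / 2) ^+ 2 by exact: cos2sin2.
  have ca : cos a = 1 - 2 * sin (a / 2) ^+ 2.
    rewrite -[in LHS](divfK (_ : 2 != 0 :> R) a)// mulr_natr mulr2n cosD -!expr2 cs; ring.
  rewrite /critical_h /critical_b sa ca /tan.
  rewrite (_ : 1 + (1 - 2 * sin (a / 2) ^+ 2) = 2 * cos (a / 2) ^+ 2); last by rewrite cs; ring.
  move: (sin _) (cos _) s0 c0 => s c s0 c0.
  have s1 : 1 - (1 - 2 * s ^+ 2) != 0.
    by rewrite opprB addrC subrK mulf_neq0// expf_neq0.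
  by split; field; rewrite ?s0 ?c0 ?s1.
split.
  move=> [a]; rewrite /= in_itv/= => ha <-; exists a => //.
  by have [-> ->] := half a ha.
move=> [a ha ->]; exists a; first by rewrite /= in_itv.
by have [-> ->] := half a ha.
Qed.
End CriticalCurve.

(** * The frequency-domain inequality below the critical curve *)

Section StabilityIndicator.
Context {R : realType}.
Variable a : R.
Hypothesis a0pi : 0 < a < pi.

Let s := sin a / a.
Let phi := (1 - cos a) / a ^+ 2.
(** On the critical curve the frequency-domain function vanishes at nu = a
    whatever the gain; this gain makes its derivative vanish there too, as a
    nonnegative function requires. *)
Definition multiplier_gain : R :=
  (sin a - a * cos a) / (a * (2 * (1 - cos a) - a * sin a)).
Let g := multiplier_gain.
(* up to a positive factor, L nu / nu is the function on the critical curve *)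
Let L nu := sin nu - nu * s + g * (nu ^+ 3 * phi - nu + nu * cos nu).
Let L1 nu := cos nu - s + g * (3 * nu ^+ 2 * phi - 1 + cos nu - nu * sin nu).
Let L2 nu := - sin nu + g * (6 * nu * phi - 2 * sin nu - nu * cos nu).

Let a0 : 0 < a. Proof. by case/andP: a0pi. Qed.
Let api : a < pi. Proof. by case/andP: a0pi. Qed.
Let aneq0 : a != 0. Proof. by rewrite gt_eqF. Qed.
Let N0 : 0 < sin a - a * cos a.
Proof. by apply: sin_sub_mulcos_gt0; rewrite a0 ltW. Qed.
Let M0 : 0 < 2 * (1 - cos a) - a * sin a.
Proof. by apply: two_onemcos_sub_mulsin_gt0; rewrite a0 ltW. Qed.
Let Mneq0 : 2 * (1 - cos a) - a * sin a != 0. Proof. by rewrite gt_eqF. Qed.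

Lemma multiplier_gain_gt0 : 0 < g.
Proof. by rewrite divr_gt0// mulr_gt0. Qed.
Let g0 := multiplier_gain_gt0.

Let phi_ge : 2 / pi ^+ 2 <= phi.
Proof.
rewrite /phi ler_pdivlMr ?exprn_gt0// mulrAC.
by apply: onemcos_ge; rewrite !ltW.
Qed.

Let phi0 : 0 < phi.
Proof. by apply: lt_le_trans phi_ge; rewrite divr_gt0// exprn_gt0// pi_gt0. Qed.

Let derL nu : der L nu (L1 nu).
Proof. by rewrite /L /L1; derv; ring. Qed.
Let derL1 nu : der L1 nu (L2 nu).
Proof. by rewrite /L1 /L2; derv; ring. Qed.

Let L_0 : L 0 = 0. Proof. by rewrite /L sin0; ring. Qed.
Let L_a : L a = 0. Proof. by rewrite /L /s /phi; field. Qed.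
Let L1_a : L1 a = 0.
Proof. by rewrite /L1 /s /phi /g /multiplier_gain; field; rewrite Mneq0 aneq0. Qed.

(* L2 t / sin t is increasing, so that L2 changes sign at most once on ]0, pi[ *)
Let L2_sign (x y : R) : 0 < x -> x <= y -> y < pi -> 0 <= L2 x -> 0 <= L2 y.
Proof.
move=> x0 xy ypi h.
have y0 : 0 < y by exact: lt_le_trans xy.
have sx : 0 < sin x by rewrite sin_gt0_pi// x0 (le_lt_trans xy).
have sy : 0 < sin y by rewrite sin_gt0_pi// y0.
pose W t := (6 * t * phi - t * cos t) * (sin t)^-1.
have hW : W x <= W y.
  pose w t := (6 * phi * (sin t - t * cos t) + (t - sin t * cos t)) / sin t ^+ 2.
  apply: (@der_ge0_le_itv _ W w x y xy) => t /andP[xt ty].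
    have st : 0 < sin t by rewrite sin_gt0_pi// (lt_le_trans x0 xt) (le_lt_trans ty).
    have stn0 : sin t != 0 by rewrite gt_eqF.
    rewrite /W /w; derv => //.
    have c2 : cos t ^+ 2 = 1 - sin t ^+ 2 by rewrite -(cos2Dsin2 t); ring.
    field: c2 => //.
  have t0 : 0 < t by exact: lt_le_trans xt.
  rewrite /w divr_ge0 ?sqr_ge0// addr_ge0//.
    have : 0 < sin t - t * cos t.
      by apply: sin_sub_mulcos_gt0; rewrite t0 (le_trans ty (ltW ypi)).
    by move=> /ltW hN; apply: mulr_ge0 => //; apply: mulr_ge0 => //; exact: ltW.
  rewrite subr_ge0 (le_trans _ (sin_le_id (ltW t0)))//.
  have st : 0 <= sin t by rewrite sin_ge0_pi// (ltW t0) (le_trans ty (ltW ypi)).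
  by rewrite ler_piMr// cos_le1.
have e t : 0 < sin t -> L2 t = sin t * (- 1 - 2 * g + g * W t).
  by move=> st; rewrite /L2 /W; field; rewrite gt_eqF.
move: h; rewrite !e// !pmulr_rge0// => h.
apply: le_trans h _; rewrite lerD2l ler_wpM2l// ltW//.
Qed.

Let dL x y : x < y -> exists c, [/\ x < c, c < y & L y - L x = L1 c * (y - x)].
Proof. by move=> xy; apply: der_MVT => // t _; exact: derL. Qed.
Let dL1 x y : x < y -> exists c, [/\ x < c, c < y & L1 y - L1 x = L2 c * (y - x)].
Proof. by move=> xy; apply: der_MVT => // t _; exact: derL1. Qed.

(* by Rolle's theorem, L 0 = L a = L1 a = 0 gives a zero of L2 on ]0, a[, beyond
   which L is convex *)
Let L1_ge0 (y : R) : a <= y -> y <= pi -> 0 <= L1 y.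
Proof.
rewrite le_eqVlt => /predU1P[<-|ay] ypi; first by rewrite L1_a.
have [c1 [c10 c1a]] := dL a0; rewrite L_a L_0 subrr subr0 => /esym/eqP.
rewrite mulf_eq0 (gt_eqF a0) orbF => /eqP L1c1.
have [c2 [c12 c2a]] := dL1 c1a; rewrite L1_a L1c1 subrr => /esym/eqP.
rewrite mulf_eq0 subr_eq0 (gt_eqF c1a) orbF => /eqP L2c2.
have c20 : 0 < c2 by exact: lt_trans c12.
have [c [ac cy]] := dL1 ay; rewrite L1_a subr0 => ->.
rewrite mulr_ge0 ?subr_ge0 ?(ltW ay)//.
apply: (L2_sign c20) (lt_le_trans cy ypi) _; last by rewrite L2c2.
by rewrite ltW// (lt_trans c2a).
Qed.

Let L_ge0_lepi (nu : R) : 0 <= nu <= pi -> 0 <= L nu.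
Proof.
move=> /andP[nu0 nupi].
have [anu|nua] := leP a nu.
  rewrite -L_a; apply: (der_ge0_le anu derL) => x /andP[ax xnu].
  by apply: L1_ge0 => //; exact: le_trans nupi.
(* a negative value of L on ]0, a[ would make L1 negative, then positive, then 0,
   and L2 positive, then negative *)
rewrite leNgt; apply/negP => Ln.
have nu1 : 0 < nu.
  by move: nu0; rewrite le_eqVlt => /predU1P[e|//]; move: Ln; rewrite -e L_0 ltxx.
have [c1 [c10 c1n e1]] := dL nu1.
have [c2 [c2n c2a e2]] := dL nua.
have L1c1 : L1 c1 < 0.
  by move: e1 Ln; rewrite L_0 !subr0 => ->; rewrite pmulr_llt0.
have L1c2 : 0 < L1 c2.
  by move: e2 Ln; rewrite L_a sub0r -oppr_gt0 => ->; rewrite pmulr_lgt0// subr_gt0.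
have c12 : c1 < c2 by exact: lt_trans c2n.
have [e [ec1 ec2 e3]] := dL1 c12.
have [f [fc fa e4]] := dL1 c2a.
have : 0 <= L2 f.
  apply: (L2_sign (x := e)).
  - exact: lt_trans ec1.
  - by rewrite ltW// (lt_trans ec2).
  - exact: lt_trans api.
  - rewrite -(@pmulr_lge0 _ (c2 - c1)) ?subr_gt0// -e3; lra.
rewrite -(@pmulr_lge0 _ (a - c2)) ?subr_gt0// -e4 L1_a; lra.
Qed.

Let L1_gepi nu : pi <= nu -> 0 <= L1 nu.
Proof.
move=> pinu; apply: le_trans (L1_ge0 (ltW api) (lexx _)) _; rewrite -subr_ge0.
have pi2 := pi_ge2 R; have pi0 : 0 < pi :> R := pi_gt0 R.
rewrite /L1 cospi sinpi.
rewrite (_ : _ - _ = (1 + cos nu) + g * (3 * (nu ^+ 2 - pi ^+ 2) * phi - nu * sin nu + (1 + cos nu))); last by ring.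
have hc : 0 <= 1 + cos nu by have := cos_geN1 nu; lra.
rewrite addr_ge0// mulr_ge0 ?(ltW g0)// addr_ge0// subr_ge0.
have hsq : 0 <= nu ^+ 2 - pi ^+ 2.
  by rewrite subr_ge0 ler_pXn2r// ?nnegrE ltW// (lt_le_trans pi0).
have hphi : 3 * (nu ^+ 2 - pi ^+ 2) * (2 / pi ^+ 2) <= 3 * (nu ^+ 2 - pi ^+ 2) * phi.
  by apply: ler_wpM2l => //; rewrite mulr_ge0.
have [nu2|nu2] := leP nu (2 * pi).
  have : sin nu <= 0.
    rewrite -(subrK pi nu) sinDpi oppr_le0 sin_ge0_pi//; lra.
  move=> /(mulr_ge0_le0 (ltW (lt_le_trans pi0 pinu))) h.
  apply: le_trans h _; apply: le_trans hphi; rewrite mulr_ge0//.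
    by rewrite mulr_ge0.
  by rewrite divr_ge0// exprn_ge0// ltW.
apply: le_trans (_ : nu <= _).
  by rewrite ler_piMr ?sin_le1// ltW// (lt_le_trans pi0).
apply: le_trans hphi.
rewrite mulrA ler_pdivlMr ?exprn_gt0//.
have -> : nu = pi * (nu / pi) by rewrite mulrC divfK// gt_eqF.
set r := nu / pi.
have r2 : 2 <= r by rewrite /r ler_pdivlMr// ltW.
rewrite exprMn.
have e : 3 * (pi ^+ 2 * r ^+ 2 - pi ^+ 2) * 2 - pi * r * pi ^+ 2 = 
  pi ^+ 2 * (6 * r ^+ 2 - 6 - pi * r) by ring.
rewrite -subr_ge0 e mulr_ge0 ?sqr_ge0//.
have pi4 : pi <= 4 :> R by have := @pihalf_lt2 R; lra.
have : pi * r <= 4 * r by apply: ler_wpM2r => //; lra.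
have : 0 <= (r - 2) * r by rewrite mulr_ge0//; lra.
rewrite !expr2; lra.
Qed.

Let L_ge0 nu : 0 <= nu -> 0 <= L nu.
Proof.
move=> nu0; have [h|h] := leP nu pi; first by rewrite L_ge0_lepi// nu0.
have pi0 : 0 < pi :> R := pi_gt0 R.
apply: le_trans (L_ge0_lepi (_ : 0 <= pi <= pi)) _.
  by rewrite lexx ltW.
by apply: (der_ge0_le (ltW h) derL) => x /andP[px _]; exact: L1_gepi.
Qed.

Lemma indicator_ge0_critical nu : 0 < nu ->
  0 <= critical_b a * (sin nu / nu) - critical_h a +
       g * (nu ^+ 2 - critical_b a * (1 - cos nu)).
Proof.
move=> nu0; have ca : 0 < 1 - cos a by apply: onemcos_gt0; rewrite a0 ltW.
rewrite (_ : _ + _ = critical_b a / nu * L nu).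
  by rewrite mulr_ge0 ?L_ge0 ?(ltW nu0)// divr_ge0 ?(ltW nu0)// divr_ge0 ?sqr_ge0// ltW.
by rewrite /critical_b /critical_h /L /s /phi; field; rewrite !gt_eqF.
Qed.

Lemma multiplier_gain_gt : critical_h a < 3 * g * (2 - critical_h a).
Proof.
have ca : 0 < 1 - cos a by apply: onemcos_gt0; rewrite a0 ltW.
rewrite -subr_gt0.
rewrite (_ : _ - _ = (3 * (sin a - a * cos a) - a ^+ 2 * sin a) / (a * (1 - cos a))).
  by rewrite divr_gt0 ?mulr_gt0// subr_gt0 sin_sub_mulcos_gt// a0 ltW.
by rewrite /critical_h /g /multiplier_gain; field; rewrite Mneq0 aneq0 gt_eqF.
Qed.
End StabilityIndicator.

(** The right-hand side is the real part of the conjugate of 1 + i g nu times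
    i nu - h + b (1 - e ^ (- i nu)) / (i nu). It is affine in b; it is at least
    a multiple of nu ^ 2 at b = h and nonnegative on the critical curve, hence
    at least a multiple of nu ^ 2 in between. Near nu = 0 it is close to b - h. *)
Lemma indicator_coercive (R : realType) (a b h : R) : 0 < a < pi ->
  h = critical_h a -> h < b -> b < critical_b a ->
  exists2 e, 0 < e & e <= b - h /\ forall nu : R, 0 < nu ->
    e * (1 + multiplier_gain a ^+ 2 * nu ^+ 2) <=
    b * (sin nu / nu) - h + multiplier_gain a * (nu ^+ 2 - b * (1 - cos nu)).
Proof.
move=> a0pi hE hb; set bC := critical_b a => bbC.
have := critical_h_gt0 a0pi; have := critical_h_lt2 a0pi; rewrite -hE => h2 h0.
have := multiplier_gain_gt a0pi; rewrite -hE.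
have := multiplier_gain_gt0 a0pi; set g := multiplier_gain a => g0 hm.
have crit (nu : R) (nu0 : 0 < nu) := indicator_ge0_critical a0pi nu0.
rewrite -/bC -hE -/g in crit.
have sinc (nu : R) : 0 < nu -> 1 - nu ^+ 2 / 6 <= sin nu / nu.
  move=> nu0; rewrite ler_pdivlMr//.
  have := sin_ge_cubic (ltW nu0); rewrite (_ : nu ^+ 3 = nu ^+ 2 * nu) ?exprSr//; lra.
have b0 : 0 < b by exact: lt_trans hb.
have hbC : h < bC by exact: lt_trans bbC.
pose m := g * (1 - h / 2) - h / 6.
have m0 : 0 < m by rewrite /m; lra.
(* b = th * h + (1 - th) * bC *)
pose th := (bC - b) / (bC - h).
have dn : bC - h != 0 by rewrite gt_eqF// subr_gt0.
have th0 : 0 < th by rewrite /th divr_gt0// subr_gt0.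
have th1 : th < 1 by rewrite /th ltr_pdivrMr ?subr_gt0// mul1r; lra.
pose F (x nu : R) := x * (sin nu / nu) - h + g * (nu ^+ 2 - x * (1 - cos nu)).
have Fh (nu : R) : 0 < nu -> m * nu ^+ 2 <= F h nu.
  move=> nu0; have h1 := ler_wpM2l (ltW h0) (sinc nu nu0).
  have h3 : h * (1 - cos nu) <= h * (nu ^+ 2 / 2).
    by rewrite ler_wpM2l ?(ltW h0)//; have := cos_ge_quad nu; lra.
  have := ler_wpM2l (ltW g0) h3.
  rewrite /F /m; lra.
have Flo (nu : R) : 0 < nu -> th * m * nu ^+ 2 <= F b nu.
  move=> nu0.
  have -> : F b nu = th * F h nu + (1 - th) * F bC nu.
    have bE : b = th * h + (1 - th) * bC by rewrite /th; field.
    by rewrite {1}bE /F; ring.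
  rewrite -mulrA -[leLHS]addr0 lerD//; first by rewrite ler_wpM2l ?Fh// ltW.
  by rewrite mulr_ge0 ?crit//; lra.
pose c := b / 6 + g * b / 2.
have c0 : 0 < c by rewrite /c addr_gt0// divr_gt0// mulr_gt0.
have Fz (nu : R) : 0 < nu -> b - h - c * nu ^+ 2 <= F b nu.
  move=> nu0; have h1 := ler_wpM2l (ltW b0) (sinc nu nu0).
  have h3 : b * (1 - cos nu) <= b * (nu ^+ 2 / 2).
    by rewrite ler_wpM2l ?(ltW b0)//; have := cos_ge_quad nu; lra.
  have := ler_wpM2l (ltW g0) h3.
  have := mulr_ge0 (ltW g0) (sqr_ge0 nu).
  rewrite /F /c; lra.
pose tm := th * m; have tm0 : 0 < tm by rewrite /tm mulr_gt0.
(* the weight p balances the bound near 0 and the quadratic one *)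
pose p := tm / (2 * (tm + c)).
have tc0 : 0 < tm + c by rewrite addr_gt0.
have p0 : 0 < p by rewrite /p divr_gt0// mulr_gt0.
have p1 : p < 1 by rewrite /p ltr_pdivrMr ?mulr_gt0//; lra.
have pE : p * (tm + c) = tm / 2 by rewrite /p; field; rewrite gt_eqF.
exists (Num.min (p * (b - h)) (tm / (2 * g ^+ 2))).
  by rewrite lt_min mulr_gt0 ?subr_gt0//= divr_gt0// mulr_gt0// exprn_gt0.
set e := Num.min _ _.
have e1 : e <= p * (b - h) by rewrite ge_min lexx.
have e2 : e * g ^+ 2 <= tm / 2.
  apply: le_trans (_ : tm / (2 * g ^+ 2) * g ^+ 2 <= _).
    by rewrite ler_wpM2r ?sqr_ge0// ge_min lexx orbT.
  by rewrite (_ : _ * _ = tm / 2)//; field; rewrite gt_eqF.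
split.
  by apply: le_trans e1 _; apply: ler_piMl; [rewrite subr_ge0 ltW|exact: ltW].
move=> nu nu0; rewrite -/(F b nu).
have q1 : p * (b - h - c * nu ^+ 2) <= p * F b nu by rewrite ler_wpM2l ?Fz// ltW.
have q2 : (1 - p) * (tm * nu ^+ 2) <= (1 - p) * F b nu.
  by rewrite ler_wpM2l ?Flo//; lra.
have q3 : e * g ^+ 2 * nu ^+ 2 <= tm / 2 * nu ^+ 2 by rewrite ler_wpM2r ?sqr_ge0.
have q4 : p * (tm + c) * nu ^+ 2 = tm / 2 * nu ^+ 2 by rewrite pE.
lra.
Qed.

(** * From frequencies to integrals: a Parseval inequality *)

Section FourierPositivity.
Context {R : realType}.
Implicit Types (f g : R -> R) (a b c t x nu : R).

(** Uniform continuity, in the form in which it integrates against an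
    approximate identity with small second moment. *)
Lemma uniform_quadratic_modulus g a b e : continuous g -> a <= b -> 0 < e ->
  exists2 C, 0 < C & forall s t, a <= s <= b -> a <= t <= b ->
    `|g s - g t| <= e + C * (s - t) ^+ 2.
Proof.
move=> cg ab e0.
have [M0 _ hM] : exists2 c, c \in `[a, b]%R & forall t, t \in `[a, b]%R -> `|g t| <= `|g c|.
  by apply: EVT_max => //; apply: continuous_subspaceT; cont.
have cpt : compact `[a, b]%classic by exact: segment_compact.
have : \forall d \near (0:R)^'+, `[a, b]%classic `<=`
    (fun x => forall s, `|s - x| < d -> `|g s - g x| <= e).
  move: cpt => /compact_near_coveringP; apply => x _.
  have e20 : 0 < e / 2 by rewrite divr_gt0.
  have /cvgrPdist_lt/(_ _ e20) := cg x.
  move=> [r /= r0 hr].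
  have r20 : 0 < r / 2 by rewrite divr_gt0.
  near=> y d => s /= sy.
  have yx : `|x - y| < r / 2.
    by near: y; exists (r / 2).
  have dr : d < r / 2 by near: d; exact: nbhs_right_lt.
  have h1 : `|g x - g y| < e / 2 by apply: hr => /=; lra.
  have h2 : `|g x - g s| < e / 2.
    apply: hr => /=.
    have := ler_distD y x s; rewrite [`|y - s|]distrC.
    by move=> h; apply: le_lt_trans h _; rewrite [ltRHS]splitr ltrD// (lt_trans sy).
  have := ler_distD (g x) (g s) (g y); rewrite [`|g s - g x|]distrC; lra.
move=> [d /= d0 hd].
have d20 : 0 < d / 2 by rewrite divr_gt0.
have {}hd x s : a <= x <= b -> `|s - x| < d / 2 -> `|g s - g x| <= e.
  move=> xab; apply: hd => //=.
    by rewrite /ball_/= sub0r normrN gtr0_norm//; lra.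
pose C := (2 * `|g M0| + 1) / (d / 2) ^+ 2.
have Cn : 0 < C.
  by rewrite /C divr_gt0 ?exprn_gt0//; have := normr_ge0 (g M0); lra.
exists C => // s t sab tab.
have [st|st] := ltP `|s - t| (d / 2).
  apply: le_trans (hd _ _ tab st) _; rewrite lerDl mulr_ge0 ?sqr_ge0//.
  exact: ltW.
have h1 : `|g s - g t| <= 2 * `|g M0|.
  apply: le_trans (ler_normB _ _) _.
  have := hM s; have := hM t; rewrite !in_itv/= sab tab => /(_ isT) + /(_ isT); lra.
apply: le_trans h1 _.
have : C * (d / 2) ^+ 2 <= C * (s - t) ^+ 2.
  rewrite ler_wpM2l ?(ltW Cn)// -[leRHS]real_normK ?num_real//.
  by rewrite ler_pXn2r// nnegrE ltW// (lt_le_trans d20).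
rewrite /C divfK ?gt_eqF ?exprn_gt0//; lra.
Unshelve. all: by end_near.
Qed.

Variables (B : R).
Hypothesis B0 : 0 < B.
(* kap ^ n is a trigonometric polynomial with nonnegative coefficients; on
   [- B, B] its normalization is an approximate identity *)
Let om := pi / B.
Let kap (s : R) := (1 + cos (om * s)) / 2.

Let om0 : 0 < om. Proof. by rewrite divr_gt0// pi_gt0. Qed.
Let kap_cts1 : cts kap.
Proof. by rewrite /kap; cont. Qed.
Let kap_cts n : cts (fun s => kap s ^+ n).
Proof. by cont. Qed.
Let kap_ge0 s : 0 <= kap s.
Proof. by rewrite /kap; have := cos_geN1 (om * s); lra. Qed.

Let Z n := intg (fun s => kap s ^+ n) (- B) B.

Let kapE s : kap s = cos (om * s / 2) ^+ 2.
Proof.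
rewrite /kap (_ : cos (om * s) = cos (om * s / 2 + om * s / 2)); last by congr cos; field.
rewrite cosD; have := cos2Dsin2 (om * s / 2); rewrite !expr2; lra.
Qed.

(* Wallis' recursion *)
Let Z_rec n : (2 * n.+1)%:R * Z n.+1 = (2 * n.+1 - 1)%:R * Z n.
Proof.
pose P s := sin (om * s / 2) * cos (om * s / 2) ^+ (2 * n + 1).
pose p s := om / 2 * ((2 * n.+1)%:R * kap s ^+ n.+1 + (- (2 * n.+1 - 1)%:R) * kap s ^+ n).
have Pp s : der P s (p s).
  rewrite /P /p; derv.
  rewrite !kapE -!exprM [(_ + _)%N]addn1/=.
  have s2 := sin2cos2 (om * s / 2).
  rewrite (_ : (2 * n.+1 - 1 = (2 * n).+1)%N); last by rewrite mulnS addSn subn1.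
  rewrite (_ : (2 * n.+1 = (2 * n).+2)%N); last by rewrite mulnS.
  move: s2; set c := cos _; set sn := sin _ => s2.
  rewrite [(2 * n).+2%:R]mulrS 3!exprS.
  rewrite (_ : om / 2 * (_ + _) = om / 2 * (c ^+ 2 * c ^+ (2 * n) - (2 * n).+1%:R * c ^+ (2 * n) * (1 - c ^+ 2))); last by ring.
  by rewrite -s2 expr2; ring.
have e := @intg_FTC R p P (- B) B _ Pp.
have hB : cos (om * B / 2) = 0.
  by rewrite (_ : om * B / 2 = pi / 2) ?cos_pihalf// /om divfK// gt_eqF.
have : intg p (- B) B = 0.
  rewrite e; last by rewrite /p; cont.
  rewrite /P mulrN mulNr cosN hB [(_ + 1)%N]addn1 expr0n/=.
  by rewrite !mulr0 subrr.
rewrite /p intgZ; last by cont.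
rewrite intgD; [|by cont..].
rewrite !intgZ; [|exact: kap_cts..].
move=> /eqP; rewrite mulf_eq0 gt_eqF/=; last by rewrite divr_gt0.
by rewrite addr_eq0 mulNr opprK => /eqP.
Qed.

Let Z_gt0 n : 0 < Z n.
Proof.
elim: n => [|n ih].
  rewrite /Z (_ : (fun _ => _) = (fun=> 1)) ?intg_cst; last by apply/funext => s; rewrite expr0.
  by have := B0; lra.
have : 0 < (2 * n.+1)%:R * Z n.+1.
  by rewrite Z_rec mulr_gt0// ltr0n mulnS addSn subn1.
by rewrite pmulr_rgt0// ltr0n.
Qed.

Let Z_diff n : (2 * n.+1)%:R * (Z n - Z n.+1) = Z n.
Proof.
rewrite mulrBr Z_rec -mulrBl natrB ?muln_gt0//; ring.
Qed.

(* Jordan's inequality *)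
Let kap_jordan s : - B <= s <= B -> s ^+ 2 <= B ^+ 2 * (1 - kap s).
Proof.
wlog s0 : s / 0 <= s => [hw|/andP[_ sB]].
  case: (leP 0 s) => [/hw//|s0] /andP[h1 h2].
  have kapN : kap (- s) = kap s by rewrite /kap mulrN cosN.
  have := hw (- s); rewrite sqrrN kapN; apply; lra.
rewrite kapE -sin2cos2 -exprMn ler_pXn2r ?nnegrE//.
- have pi0 : 0 < pi :> R := pi_gt0 R.
  have := @sin_jordan R (om * s / 2).
  have -> : 2 * (om * s / 2) / pi = s / B.
    by rewrite /om; move: (pi) pi0 => q q0; field; rewrite !gt_eqF.
  move=> hj; have : B * (s / B) <= B * sin (om * s / 2).
    rewrite ler_wpM2l ?(ltW B0)//; apply: hj; apply/andP; split.
      by apply: divr_ge0 => //; apply: mulr_ge0 => //; exact: ltW.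
    by rewrite ler_pM2r ?invr_gt0// /om mulrAC ler_pdivrMr// ler_wpM2l// ltW.
  by rewrite mulrC divfK// gt_eqF.
- rewrite mulr_ge0 ?(ltW B0)//.
  have pi0 : 0 < pi :> R := pi_gt0 R.
  apply: sin_ge0_pi; apply/andP; split.
    by apply: divr_ge0 => //; apply: mulr_ge0 => //; exact: ltW.
  apply: le_trans (_ : pi / 2 <= _); last by lra.
  rewrite ler_pM2r ?invr_gt0// /om mulrAC ler_pdivrMr// ler_wpM2l// ltW//.
Qed.

Variables f g : R -> R.
Hypotheses (cf : continuous f) (cg : continuous g).
Hypothesis g_supp : forall t, t <= 0 \/ B <= t -> g t = 0.
Let A u nu := intg (fun t => u t * cos (nu * t)) 0 B.
Let S u nu := intg (fun t => u t * sin (nu * t)) 0 B.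
Hypothesis ccp : forall nu, 0 <= A f nu * A g nu + S f nu * S g nu.

(* J n nu t is the convolution of g with cos (nu s) * kap s ^ n; the recursion
   shows it as a combination of frequencies *)
Let J := fix J n nu t : R := match n with
  | 0%N => A g nu * cos (nu * t) + S g nu * sin (nu * t)
  | m.+1 => J m nu t / 2 + J m (nu + om) t / 4 + J m (nu - om) t / 4
  end.

Let cJ n nu : cts (J n nu).
Proof.
elim: n nu => [|n ih] nu /=; first by cont.
have h1 := ih nu; have h2 := ih (nu + om); have h3 := ih (nu - om).
by cont.
Qed.

Let JE n nu t : J n nu t =
  intg (fun s => g s * (cos (nu * (t - s)) * kap (t - s) ^+ n)) 0 B.
Proof.
elim: n nu => [|n ih] nu /=.
  rewrite /A /S -!(mulrC (cos (nu * t))) -!(mulrC (sin (nu * t))).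
  rewrite -!intgZ; [|by cont..].
  rewrite -intgD; [|by cont..].
  congr intg; apply/funext => s.
  rewrite mulrBr cosB expr0; ring.
rewrite !ih -!(mulrC _^-1) -!intgZ; [|by cont..].
rewrite -!intgD; [|by cont..].
congr intg; apply/funext => s.
set K := kap (t - s) ^+ n; rewrite exprS -/K /kap mulrDl mulrBl cosD cosB; by field.
Qed.

Let J_pos n nu : 0 <= intg (fun t => f t * J n nu t) 0 B.
Proof.
elim: n nu => [|n ih] nu.
  rewrite (_ : (fun t => _) = (fun t => A g nu * (f t * cos (nu * t)) + S g nu * (f t * sin (nu * t)))); last first.
    by apply/funext => t /=; ring.
  rewrite intgD; [|by cont..]; rewrite !intgZ; [|by cont..].
  by rewrite mulrC [X in _ + X]mulrC; exact: ccp.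
have h1 : cts (J n nu) by exact: cJ.
have h2 : cts (J n (nu + om)) by exact: cJ.
have h3 : cts (J n (nu - om)) by exact: cJ.
rewrite (_ : (fun t => _) = (fun t => 2^-1 * (f t * J n nu t) + 4^-1 * (f t * J n (nu + om) t) + 4^-1 * (f t * J n (nu - om) t))); last first.
  by apply/funext => t /=; field.
rewrite intgD; [|by cont..]; rewrite intgD; [|by cont..].
rewrite !intgZ; [|by cont..].
by rewrite !addr_ge0// mulr_ge0.
Qed.

Let J_approx e : 0 < e -> exists2 C, 0 < C & forall n t, 0 <= t <= B ->
  `|J n 0 t - g t * Z n| <= (e + C / (2 * n.+1)%:R) * Z n.
Proof.
move=> e0; have B3 : - B <= 2 * B by have := B0; lra.
have [C C0 hC] := uniform_quadratic_modulus cg B3 e0.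
exists (C * B ^+ 2); first by rewrite mulr_gt0// exprn_gt0.
move=> n t /andP[t0 tB].
have -> : J n 0 t = intg (fun s => g (s + t) * kap s ^+ n) (- B) B.
  have cgt : cts (fun s => g (s + t)) by cont.
  pose q s := g s * (cos (0 * (t - s)) * kap (t - s) ^+ n).
  have cq : continuous q by rewrite /q; cont.
  rewrite JE -/q.
  have -> : intg q 0 B = intg q (t - B) (t + B).
    rewrite -(intg_chasles q 0 (t - B)) -(intg_chasles q B 0 (t + B)).
    rewrite (@intg_eq0 R q (t - B) 0)// ?(@intg_eq0 R q B (t + B))//.
    - ring.
    - lra.
    - by move=> x /andP[h _]; rewrite /q g_supp ?mul0r//; right.
    - lra.
    - by move=> x /andP[_ h]; rewrite /q g_supp ?mul0r//; left.
  rewrite -[t - B]addrC -[t + B]addrC -intg_shift//; congr intg.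
  apply/funext => s; rewrite /q mul0r cos0 mul1r (_ : t - (s + t) = - s); last by ring.
  by rewrite /kap mulrN cosN.
rewrite /Z -intgZ; last by cont.
rewrite -intgB; [|by cont..].
have cgt : cts (fun s => g (s + t)) by cont.
rewrite (_ : (fun x => _) = (fun s => (g (s + t) - g t) * kap s ^+ n)); last first.
  by apply/funext => s; ring.
apply: le_trans (_ : intg (fun s => e * kap s ^+ n + C * B ^+ 2 * (kap s ^+ n - kap s ^+ n.+1)) (- B) B <= _).
  apply: norm_intg_le; [by cont|by cont|by have := B0; lra|].
  move=> s sB; rewrite normrM [`|kap s ^+ n|]ger0_norm ?exprn_ge0//.
  apply: le_trans (_ : (e + C * (B ^+ 2 * (1 - kap s))) * kap s ^+ n <= _); last first.
    by rewrite [kap s ^+ n.+1]exprS le_eqVlt; apply/orP; left; apply/eqP; ring.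
  apply: ler_wpM2r; first by rewrite exprn_ge0.
  apply: le_trans (hC (s + t) t _ _) _; [lra|lra|].
  rewrite addrK lerD2l ler_wpM2l ?(ltW C0)//; exact: kap_jordan.
rewrite intgD; [|by cont..]; rewrite !intgZ; [|by cont..].
rewrite intgB; [|by cont..].
rewrite -/(Z n) -/(Z n.+1).
have := Z_diff n; set N := (_%:R) => hN.
have N0 : 0 < N by rewrite /N ltr0n.
rewrite (_ : Z n - Z n.+1 = Z n / N); last by rewrite -{2}hN mulrC mulKf// gt_eqF.
by rewrite le_eqVlt; apply/orP; left; apply/eqP; field; rewrite gt_eqF.
Qed.

(** If the real part of the transform of f times the conjugate transform of g
    is nonnegative at every frequency, so is the integral of f g. Fourier
    inversion is replaced by the kernels kap ^ n: the integral of f against the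
    convolution of g with kap ^ n is a nonnegative combination of such real
    parts, and after normalization these convolutions tend to g uniformly. *)
Lemma fourier_positivity : 0 <= intg (fun t => f t * g t) 0 B.
Proof.
rewrite leNgt; apply/negP => neg.
set I := intg _ _ _ in neg.
pose F := intg (fun t => `|f t|) 0 B.
have F0 : 0 <= F by apply: intg_ge0; [cont|exact: ltW|].
pose e := - I / (3 * (F + 1)).
have F1 : 0 < F + 1 by lra.
have e0 : 0 < e by rewrite /e divr_gt0 ?mulr_gt0// oppr_gt0.
have [C C0 hC] := J_approx e0.
have [n hn] : exists n, C / (2 * n.+1)%:R <= e.
  exists (Num.bound (C / e)).
  have := archi_boundP (ltW (divr_gt0 C0 e0)); set k := Num.bound _ => hk.
  have hk2 : C / e <= (2 * k.+1)%:R.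
    by apply: le_trans (ltW hk) _; rewrite ler_nat mulnS; apply: leq_trans (leq_addl _ _); rewrite leq_pmull.
  by rewrite ler_pdivrMr ?ltr0n// mulrC -ler_pdivrMr.
have cJn : cts (J n 0) by exact: cJ.
have h1 := J_pos n 0.
have : intg (fun t => f t * J n 0 t) 0 B <= Z n * I + F * ((e + e) * Z n).
  have -> : Z n * I + F * ((e + e) * Z n) = intg (fun t => Z n * (f t * g t) + ((e + e) * Z n) * `|f t|) 0 B.
    rewrite intgD; [|by cont..]; rewrite !intgZ; [|by cont..].
    by rewrite -/F -/I; ring.
  apply: le_intg; [by cont|by cont|exact: ltW|].
  move=> t tB.
  have h2 : `|f t * (J n 0 t - g t * Z n)| <= `|f t| * ((e + e) * Z n).
    rewrite normrM ler_wpM2l//; apply: le_trans (hC n t tB) _.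
    by rewrite ler_wpM2r ?(ltW (Z_gt0 n))// lerD2l.
  have := ler_norm (f t * (J n 0 t - g t * Z n)); lra.
move=> /(le_trans h1); rewrite leNgt => /negP; apply.
rewrite (_ : _ + _ = Z n * (I + F * (e + e))); last by ring.
rewrite pmulr_rlt0//.
have : F * (e + e) <= (F + 1) * (e + e) by rewrite ler_wpM2r//; lra.
have : (F + 1) * (e + e) = - I * (2 / 3) by rewrite /e; field; rewrite gt_eqF.
lra.
Qed.

End FourierPositivity.

(** * The sliding integral over the delay interval *)

Section Window.
Context {R : realType}.
Implicit Types (y : R -> R) (t : R).

Definition window y t : R := intg y (t - 1) t.

Lemma windowE y : window y = (fun t => intg y 0 t - intg y 0 (t - 1)).
Proof. by apply/funext => t; rewrite /window /intg; ring. Qed.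

Lemma der_window y t : cts y -> der (window y) t (y t - y (t - 1)).
Proof. by move=> cy; rewrite windowE; derv; ring. Qed.

Lemma cts_window y : cts y -> cts (window y).
Proof. by move=> cy; rewrite windowE; cont. Qed.

Lemma window_eq0 y t : cts y -> (forall s, t - 1 <= s <= t -> y s = 0) ->
  window y t = 0.
Proof. by move=> cy h; apply: intg_eq0 => //; lra. Qed.

End Window.

(** * The energy inequality *)

Section EnergyInequality.
Context {R : realType}.
Variables (h b g e : R).
Hypotheses (g0 : 0 < g) (e0 : 0 < e) (ebh : e <= b - h).
Hypothesis coercive : forall nu : R, 0 < nu ->
    e * (1 + g ^+ 2 * nu ^+ 2) <=
    b * (sin nu / nu) - h + g * (nu ^+ 2 - b * (1 - cos nu)).

Section CompactSupport.
Variables (y z : R -> R) (P : R).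
Hypotheses (P0 : 0 < P) (cz : cts z) (dy : forall t, der y t (z t)).
Hypothesis supp : forall t : R, t <= 0 \/ P <= t -> y t = 0 /\ z t = 0.

Let cy : cts y. Proof. exact: der_cts dy. Qed.
Let B := P + 1.
Let K := window y.
Let cK : cts K. Proof. exact: cts_window. Qed.
Let dK (t : R) : der K t (y t - y (t - 1)).
Proof. exact: der_window. Qed.
Let B0 : 0 < B. Proof. by have := P0; rewrite /B; lra. Qed.
Let y_supp (t : R) : t <= 0 \/ P <= t -> y t = 0.
Proof. by move=> /supp[]. Qed.
Let K_supp (t : R) : t <= 0 \/ B <= t -> K t = 0.
Proof.
move=> h1; apply: window_eq0 => // s sE; apply: y_supp.
by case: h1 => h1; [left|right]; move: h1; rewrite /B; lra.
Qed.

Let y_0 : y 0 = 0. Proof. by apply: y_supp; left. Qed.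
Let y_B : y B = 0. Proof. by apply: y_supp; right; rewrite /B; lra. Qed.

Let shift_y q : cts q -> intg (fun t => y (t - 1) * q t) 0 B =
  intg (fun t => y t * q (t + 1)) 0 B.
Proof.
move=> cq; pose w t := y t * q (t + 1).
have cw : cts w by rewrite /w; cont.
have -> : (fun t => y (t - 1) * q t) = (fun t => w (t + -1)).
  by apply/funext => t; rewrite /w subrK.
rewrite intg_shift// -/w -(intg_chasles w 0 (0 + -1)) -(intg_chasles w (B + -1) 0 B).
have -> : intg w (0 + -1) 0 = 0.
  by apply: intg_eq0; [|lra|move=> x /andP[_ x0]; rewrite /w y_supp ?mul0r//; left].
have -> : intg w (B + -1) B = 0.
  apply: intg_eq0; [by []|lra|move=> x /andP[x0 _]; rewrite /w y_supp ?mul0r//; right].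
  by move: x0; rewrite /B; lra.
ring.
Qed.

Let C nu := intg (fun t => y t * cos (nu * t)) 0 B.
Let S nu := intg (fun t => y t * sin (nu * t)) 0 B.

Let z_cos nu : intg (fun t => z t * cos (nu * t)) 0 B = nu * S nu.
Proof.
have := @intg_parts _ y (fun t => cos (nu * t)) z (fun t => - nu * sin (nu * t)) 0 B.
rewrite y_0 y_B.
rewrite !mul0r subrr sub0r => hp; rewrite -[LHS]opprK -hp//; [|by cont|by move=> x; derv; ring].
rewrite /S -mulN1r -!intgZ; [|by cont..].
by congr intg; apply/funext => t; ring.
Qed.

Let z_sin nu : intg (fun t => z t * sin (nu * t)) 0 B = - nu * C nu.
Proof.
have := @intg_parts _ y (fun t => sin (nu * t)) z (fun t => nu * cos (nu * t)) 0 B.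
rewrite y_0 y_B.
rewrite !mul0r subrr sub0r => hp; rewrite -[LHS]opprK -hp//; [|by cont|by move=> x; derv; ring].
rewrite /C -mulN1r -!intgZ; [|by cont..].
by congr intg; apply/funext => t; ring.
Qed.

Let K_parts q Q : cts q -> (forall t, der Q t (q t)) ->
  intg (fun t => K t * q t) 0 B =
  intg (fun t => y t * Q (t + 1)) 0 B - intg (fun t => y t * Q t) 0 B.
Proof.
move=> cq dQ; have cQ : cts Q by exact: der_cts dQ.
rewrite (@intg_parts _ K Q (fun t => y t - y (t - 1)) q)//; last by cont.
rewrite !K_supp; [|by left|by right].
rewrite !mul0r subrr sub0r -shift_y//.
rewrite (_ : (fun t => _) = (fun t => y t * Q t - y (t - 1) * Q t)); last first.
  by apply/funext => t; ring.
by rewrite intgB ?opprB; [|by cont..].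
Qed.

Let K_cos nu : 0 < nu -> intg (fun t => K t * cos (nu * t)) 0 B =
  sin nu / nu * C nu - (1 - cos nu) / nu * S nu.
Proof.
move=> nu0; rewrite (@K_parts _ (fun t => sin (nu * t) / nu)); [|by cont|]; last first.
  by move=> t; derv; field; rewrite gt_eqF.
rewrite /C /S -intgB; [|by cont..].
rewrite -!intgZ; [|by cont..]; rewrite -intgB; [|by cont..].
by congr intg; apply/funext => t; rewrite mulrDr mulr1 sinD; field; rewrite gt_eqF.
Qed.

Let K_sin nu : 0 < nu -> intg (fun t => K t * sin (nu * t)) 0 B =
  (1 - cos nu) / nu * C nu + sin nu / nu * S nu.
Proof.
move=> nu0; rewrite (@K_parts _ (fun t => - (cos (nu * t) / nu))); [|by cont|]; last first.
  by move=> t; derv; field; rewrite gt_eqF.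
rewrite /C /S -intgB; [|by cont..].
rewrite -!intgZ; [|by cont..]; rewrite -intgD; [|by cont..].
by congr intg; apply/funext => t; rewrite mulrDr mulr1 cosD; field; rewrite gt_eqF.
Qed.

Let K_mean : intg K 0 B = intg y 0 B.
Proof.
have := @K_parts (fun=> 1) (fun t => t); rewrite (_ : (fun t => K t * 1) = K); last first.
  by apply/funext => t; rewrite mulr1.
move=> ->; [|by cont|by move=> t; exact: der_id].
rewrite -intgB; [|by cont..].
by congr intg; apply/funext => t; ring.
Qed.

Let u t := y t + g * z t.
Let w t := z t - h * y t + b * K t - e * u t.

Let cross_ge0 nu :
  0 <= intg (fun t => u t * cos (nu * t)) 0 B * intg (fun t => w t * cos (nu * t)) 0 B
     + intg (fun t => u t * sin (nu * t)) 0 B * intg (fun t => w t * sin (nu * t)) 0 B.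
Proof.
wlog nu0 : nu / 0 <= nu => [hw|].
  have [/hw//|nu0] := leP 0 nu.
  have := hw (- nu); rewrite oppr_ge0 (ltW nu0) => /(_ isT).
  have cE q : (fun t => q t * cos (- nu * t)) = (fun t => q t * cos (nu * t)).
    by apply/funext => t; rewrite mulNr cosN.
  have sE q : cts q -> intg (fun t => q t * sin (- nu * t)) 0 B = - intg (fun t => q t * sin (nu * t)) 0 B.
    move=> cq; rewrite -intgN; last by cont.
    by congr intg; apply/funext => t; rewrite mulNr sinN mulrN.
  by rewrite !cE !sE ?mulrNN//; rewrite /w /u; cont.
have lin q : cts q -> 
   intg (fun t => u t * q t) 0 B = intg (fun t => y t * q t) 0 B + g * intg (fun t => z t * q t) 0 B
   /\ intg (fun t => w t * q t) 0 B = intg (fun t => z t * q t) 0 B - h * intg (fun t => y t * q t) 0 B + b * intg (fun t => K t * q t) 0 B - e * (intg (fun t => y t * q t) 0 B + g * intg (fun t => z t * q t) 0 B).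
  move=> cq; rewrite -!intgZ; [|by cont..]; rewrite -!intgD; [|by cont..].
  rewrite -!intgZ; [|by cont..]; rewrite -!intgB; [|by cont..].
  rewrite -!intgD; [|by cont..]; rewrite -!intgB; [|by cont..].
  by split; congr intg; apply/funext => t; rewrite /w /u; ring.
have [-> ->] := lin (fun t => cos (nu * t)) ltac:(by cont).
have [-> ->] := lin (fun t => sin (nu * t)) ltac:(by cont).
rewrite !z_cos !z_sin -/(C nu) -/(S nu).
move: nu0; rewrite le_eqVlt => /predU1P[nu0|nu0].
  have S0 : S nu = 0.
    by rewrite /S -nu0 intg_eq0 ?(ltW B0)//; [cont|move=> x _; rewrite mul0r sin0 mulr0].
  have KE : intg (fun t => K t * cos (nu * t)) 0 B = C nu.
    rewrite /C -nu0.
    have oneE q : (fun t => q t * cos (0 * t)) = q.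
      by apply/funext => t; rewrite mul0r cos0 mulr1.
    by rewrite !oneE K_mean.
  rewrite KE S0 -nu0.
  rewrite (_ : _ + _ = C nu ^+ 2 * (b - h - e)); last by rewrite -nu0; ring.
  by rewrite mulr_ge0 ?sqr_ge0// subr_ge0.
rewrite K_cos// K_sin//.
have := coercive nu0; rewrite -subr_ge0.
move=> /(mulr_ge0 (addr_ge0 (sqr_ge0 (C nu)) (sqr_ge0 (S nu)))).
congr (0 <= _); field; rewrite gt_eqF//.
Qed.

(** [fourier_positivity] for u = y + g y' and w = y' - h y + b K - e u: at the
    frequency nu, the transform of u is 1 + i g nu times that of y, and the
    cross term is the squared modulus of the latter times the gap in the
    hypothesis [coercive], which becomes b - h - e at nu = 0. *)
Lemma energy_compact :
  e * intg (fun t => u t ^+ 2) 0 B <=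
  intg (fun t => u t * (z t - h * y t + b * K t)) 0 B.
Proof.
have := @fourier_positivity R B B0 u w.
have cu : cts u by rewrite /u; cont.
have cw : cts w by rewrite /w; cont.
move=> /(_ cu cw) hf.
rewrite -subr_ge0 -intgZ; last by cont.
rewrite -intgB; [|by cont..].
apply: le_trans (hf _ cross_ge0) _.
  move=> t tB.
  have tP : t <= 0 \/ P <= t by case: tB => h1; [left|right]; move: h1; rewrite /B; lra.
  have [yt zt] := supp tP.
  by rewrite /w /u yt zt K_supp// !mulr0 !(addr0, subr0) mulr0 subr0.
rewrite le_eqVlt; apply/orP; left; apply/eqP; congr intg; apply/funext => t.
rewrite /w; ring.
Qed.
End CompactSupport.

Lemma norm_mul_le (x A k B : R) : `|x| <= A -> `|k| <= B -> `|x * k| <= A * B.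
Proof. by move=> h1 h2; rewrite normrM; apply: ler_pM. Qed.

Definition clamp01 (x : R) : R := (`|x| - `|x - 1| + 1) / 2.

Lemma cts_clamp01 : cts clamp01.
Proof. by rewrite /clamp01; cont. Qed.

Lemma clamp01_le0 x : x <= 0 -> clamp01 x = 0.
Proof. by move=> x0; rewrite /clamp01 !ler0_norm; lra. Qed.

Lemma clamp01_ge1 x : 1 <= x -> clamp01 x = 1.
Proof. by move=> x0; rewrite /clamp01 !ger0_norm; lra. Qed.

Lemma clamp01_id x : 0 <= x <= 1 -> clamp01 x = x.
Proof.
by move=> /andP[x0 x1]; rewrite /clamp01 ger0_norm// ler0_norm; lra.
Qed.

Lemma clamp01_itv x : 0 <= clamp01 x <= 1.
Proof.
have [x0|x0] := leP x 0; first by rewrite clamp01_le0// lexx ler01.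
have [x1|x1] := leP x 1; first by rewrite clamp01_id// ltW.
by rewrite clamp01_ge1 ?ler01 ?lexx// ltW.
Qed.

(** A C^1 step from 1 at x <= 0 down to 0 at x >= 1, and its derivative. *)
Definition smoothstep' (x : R) : R := - 6 * (clamp01 x * (1 - clamp01 x)).
Definition smoothstep (x : R) : R := 1 + intg smoothstep' 0 x.

Lemma cts_smoothstep' : cts smoothstep'.
Proof. have cc := cts_clamp01; rewrite /smoothstep'; cont. Qed.

Lemma der_smoothstep x : der smoothstep x (smoothstep' x).
Proof. by have cs := cts_smoothstep'; rewrite /smoothstep; derv; ring. Qed.

Lemma smoothstep'_out x : x <= 0 \/ 1 <= x -> smoothstep' x = 0.
Proof.
by move=> [h1|h1]; rewrite /smoothstep' ?(clamp01_le0 h1) ?(clamp01_ge1 h1); ring.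
Qed.

Lemma smoothstep_le0 x : x <= 0 -> smoothstep x = 1.
Proof.
move=> x0; rewrite /smoothstep.
have e1 : intg smoothstep' x 0 = 0.
  apply: intg_eq0 => //; first exact: cts_smoothstep'.
  by move=> t /andP[_ t0]; rewrite smoothstep'_out//; left.
have := intgxx smoothstep' 0.
by rewrite -(intg_chasles _ x 0 0) e1 addr0 => ->; rewrite addr0.
Qed.

Lemma smoothstep_ge1 x : 1 <= x -> smoothstep x = 0.
Proof.
move=> x1; rewrite /smoothstep -(intg_chasles _ 1) (@intg_eq0 _ _ 1 x)//; last 2 first.
- exact: cts_smoothstep'.
- by move=> t /andP[t1 _]; rewrite smoothstep'_out//; right.
rewrite (@eq_intg _ _ (fun t => - 6 * (t * (1 - t))))//; last 3 first.
- exact: cts_smoothstep'.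
- by cont.
- by move=> t t01; rewrite /smoothstep' clamp01_id.
rewrite (@intg_FTC _ _ (fun t => 2 * t ^+ 3 - 3 * t ^+ 2)); last 2 first.
- by cont.
- by move=> t; derv; ring.
ring.
Qed.

Lemma smoothstep'_bound x : `|smoothstep' x| <= 6.
Proof.
have /andP[c0 c1] := clamp01_itv x.
rewrite /smoothstep' normrM normrN [`|6|]ger0_norm// -[leRHS]mulr1 ler_wpM2l//.
rewrite ger0_norm; last by rewrite mulr_ge0// subr_ge0.
by apply: mulr_ile1 => //; [rewrite subr_ge0|lra].
Qed.

Lemma smoothstep_bound x : `|smoothstep x| <= 7.
Proof.
have [x0|x0] := leP x 0; first by rewrite smoothstep_le0// normr1; lra.
have [x1|x1] := leP 1 x; first by rewrite smoothstep_ge1// normr0.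
rewrite /smoothstep; apply: le_trans (ler_normD _ _) _; rewrite normr1.
have := @norm_intg_le R smoothstep' (fun=> 6) 0 x cts_smoothstep' (@cts_cst R 6) (ltW x0).
move=> /(_ (fun t _ => smoothstep'_bound t)); rewrite intg_cst; lra.
Qed.

Section Causal.
Variables (y z : R -> R) (T : R).
Hypotheses (T0 : 0 < T) (cz : cts z) (dy : forall t, der y t (z t)).
Hypothesis past : forall t : R, t <= 0 -> y t = 0 /\ z t = 0.

Let cy : cts y. Proof. exact: der_cts dy. Qed.
Let u t := y t + g * z t.
Let cu : cts u. Proof. by rewrite /u; cont. Qed.
Let u_past t : t <= 0 -> u t = 0.
Proof. by move=> /past[yt zt]; rewrite /u yt zt mulr0 addr0. Qed.
Let v t := z t - h * y t + b * window y t.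
Let cK : cts (window y). Proof. exact: cts_window. Qed.

Let U_ex : exists2 U, 0 < U & forall t, t <= T + 1 -> `|u t| <= U.
Proof.
have T1 : 0 <= T + 1 by have := T0; lra.
have cun : {within `[0, T + 1], continuous (fun t => `|u t|)}.
  by apply: continuous_subspaceT; cont.
have [c _ hc] := EVT_max T1 cun.
exists (`|u c| + 1); first by rewrite ltr_wpDl.
move=> t tT; have [t0|t0] := leP t 0.
  by rewrite u_past// normr0 addr_ge0.
have := hc t; rewrite in_itv/= (ltW t0) tT => /(_ isT); lra.
Qed.

Section Cutoff.
Variables (U s L : R).
Hypotheses (U0 : 0 < U) (hU : forall t, t <= T + 1 -> `|u t| <= U).
Hypotheses (s01 : 0 < s <= 1) (LT : T + 2 <= L).

(* u is cut off on [T, T + s]; y1 is the function vanishing in the past with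
   y1 + g y1' = u1, which decays exponentially after T + s and is finally cut
   off on [L, L + 1] *)
Let chi t := clamp01 (1 - (t - T) / s).
Let u1 t := u t * chi t.
Let y1 t := expR (- (t / g)) * (g^-1 * intg (fun x => expR (x / g) * u1 x) 0 t).
Let z1 t := (u1 t - y1 t) / g.
Let y2 t := y1 t * smoothstep (t - L).
Let z2 t := z1 t * smoothstep (t - L) + y1 t * smoothstep' (t - L).
Let s0 : 0 < s. Proof. by case/andP: s01. Qed.
Let s1 : s <= 1. Proof. by case/andP: s01. Qed.

Let cchi : cts chi.
Proof. have cc := cts_clamp01; rewrite /chi; cont. Qed.
Let chi_le t : t <= T -> chi t = 1.
Proof.
move=> tT; rewrite /chi clamp01_ge1// lerDl oppr_ge0 mulr_le0_ge0//; first lra.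
by rewrite invr_ge0 ltW.
Qed.
Let chi_ge t : T + s <= t -> chi t = 0.
Proof.
move=> tT; rewrite /chi clamp01_le0// subr_le0 ler_pdivlMr// mul1r; lra.
Qed.
Let chi01 t : `|chi t| <= 1.
Proof. by have /andP[c0 c1] := clamp01_itv (1 - (t - T) / s); rewrite ger0_norm. Qed.

Let cu1 : cts u1. Proof. by rewrite /u1; cont. Qed.
Let cE : cts (fun x => expR (x / g) * u1 x). Proof. by cont. Qed.
Let dy1 t : der y1 t (z1 t).
Proof.
rewrite /y1 /z1; derv; set E := intg _ _ _.
have ee : expR (t / g) * expR (- (t / g)) = 1 by rewrite -expRD subrr expR0.
rewrite (_ : _ + _ = (u1 t * (expR (t / g) * expR (- (t / g))) - expR (- (t / g)) * (g^-1 * E)) / g).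
  by rewrite ee mulr1.
by field; rewrite gt_eqF.
Qed.
Let cy1 : cts y1. Proof. exact: der_cts dy1. Qed.
Let cz1 : cts z1. Proof. by rewrite /z1; cont. Qed.
Let css : cts smoothstep. Proof. exact: der_cts der_smoothstep. Qed.
Let css' := cts_smoothstep'.
Let cz2 : cts z2. Proof. by rewrite /z2; cont. Qed.
Let dy2 t : der y2 t (z2 t).
Proof.
rewrite /y2 /z2; apply: der_eq.
  apply: is_deriveM_fun; first exact: dy1.
  apply: is_derive_shift_fun; exact: der_smoothstep.
by [].
Qed.
Let cy2 : cts y2. Proof. exact: der_cts dy2. Qed.

Let u1_bound t : `|u1 t| <= U.
Proof.
have [tT|tT] := leP t (T + 1).
  by rewrite normrM -[leRHS]mulr1 ler_pM// hU.
by rewrite /u1 chi_ge ?mulr0 ?normr0 ?(ltW U0)//; have := s1; lra.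
Qed.

Let y1_past t : t <= 0 -> y1 t = 0.
Proof.
move=> t0; rewrite /y1 (_ : intg _ 0 t = 0) ?mulr0//.
have := intgxx (fun x => expR (x / g) * u1 x) 0.
rewrite -(intg_chasles _ t 0 0) (@intg_eq0 _ _ t 0) ?addr0// => x /andP[_ x0].
by rewrite /u1 u_past// mul0r mulr0.
Qed.

Let y1_bound t : `|y1 t| <= U.
Proof.
have [t0|t0] := leP t 0; first by rewrite y1_past// normr0 ltW.
rewrite /y1 !normrM gtr0_norm ?expR_gt0// gtr0_norm ?invr_gt0//.
have : `|intg (fun x => expR (x / g) * u1 x) 0 t| <= intg (fun x => U * expR (x / g)) 0 t.
  apply: norm_intg_le; [by cont|by cont|exact: ltW|].
  move=> x _; rewrite normrM gtr0_norm ?expR_gt0// mulrC ler_wpM2r//.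
rewrite intgZ; last by cont.
rewrite (@intg_FTC _ (fun x => expR (x / g)) (fun x => g * expR (x / g))); last 2 first.
- by cont.
- by move=> x; derv; field; rewrite gt_eqF.
rewrite mul0r expR0 mulr1 => hi.
have h1 : 0 <= g^-1 by rewrite invr_ge0 ltW.
have h2 : 0 <= expR (- (t / g)) by rewrite ltW// expR_gt0.
apply: le_trans (ler_wpM2l h2 (ler_wpM2l h1 hi)) _.
have ee : expR (t / g) * expR (- (t / g)) = 1 by rewrite -expRD subrr expR0.
rewrite [leLHS](_ : _ = U * (expR (t / g) * expR (- (t / g))) - U * expR (- (t / g))).
  by rewrite ee mulr1 lerBlDr lerDl mulr_ge0// ltW.
by field; rewrite gt_eqF.
Qed.

Let y1E t : t <= T -> y1 t = y t.
Proof.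
have [t0|t0] := leP t 0; first by move=> _; rewrite y1_past// (past t0).1.
move=> tT; rewrite /y1.
have -> : intg (fun x => expR (x / g) * u1 x) 0 t = intg (fun x => expR (x / g) * u x) 0 t.
  apply: eq_intg; [by cont|by cont|exact: ltW|] => x /andP[_ xt].
  by rewrite /u1 chi_le ?mulr1//; exact: le_trans tT.
rewrite (@intg_FTC _ _ (fun x => g * (expR (x / g) * y x))); last 2 first.
- by cont.
- by move=> x; derv; rewrite /u; field; rewrite gt_eqF.
rewrite (past (lexx 0)).1 !mulr0 subr0 mulKf ?gt_eqF// mulrA -expRD addNr expR0 mul1r//.
Qed.

Let y1_tail t : T + 1 <= t -> y1 t = expR (- ((t - (T + 1)) / g)) * y1 (T + 1).
Proof.
move=> tT; rewrite /y1 -(intg_chasles _ (T + 1)).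
rewrite (@intg_eq0 _ _ (T + 1) t)// ?addr0; last first.
  by move=> x /andP[x0 _]; rewrite /u1 chi_ge ?mulr0//; have := s1; lra.
rewrite [RHS]mulrA -expRD; congr (expR _ * _); field; rewrite gt_eqF//.
Qed.

Let y2_past t : t <= 0 -> y2 t = 0 /\ z2 t = 0.
Proof.
move=> t0; rewrite /y2 /z2 /z1 /u1 !y1_past// u_past//.
by rewrite !mul0r subrr !mul0r addr0.
Qed.

Let y2_future t : L + 1 <= t -> y2 t = 0 /\ z2 t = 0.
Proof.
move=> tL; have tL1 : 1 <= t - L by lra.
by rewrite /y2 /z2 smoothstep_ge1// smoothstep'_out ?mulr0 ?addr0//; right.
Qed.

Let u2 t := y2 t + g * z2 t.
Let v2 t := z2 t - h * y2 t + b * window y2 t.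
Let cu2 : cts u2. Proof. by rewrite /u2; cont. Qed.
Let cK2 : cts (window y2). Proof. exact: cts_window. Qed.
Let cv2 : cts v2. Proof. by rewrite /v2; cont. Qed.

Let u2E t : u2 t = u1 t * smoothstep (t - L) + g * y1 t * smoothstep' (t - L).
Proof. by rewrite /u2 /y2 /z2 /z1; field; rewrite gt_eqF. Qed.

Definition cutoff_bound : R :=
  7 * (2 * U / g) + 6 * U + `|h| * (7 * U) + `|b| * (7 * U).

Let y2_bound t : `|y2 t| <= 7 * U.
Proof. rewrite [7 * U]mulrC; exact: norm_mul_le (y1_bound t) (smoothstep_bound _). Qed.

Let v2_bound t : `|v2 t| <= cutoff_bound.
Proof.
rewrite /v2 /cutoff_bound.
apply: le_trans (ler_normD _ _) _; apply: lerD; last first.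
  apply: (norm_mul_le (lexx _)).
  have := @norm_intg_le R y2 (fun=> 7 * U) (t - 1) t cy2 (@cts_cst R _).
  rewrite intg_cst (_ : t - (t - 1) = 1) ?mulr1; last by ring.
  by apply; [lra|move=> x _; exact: y2_bound].
apply: le_trans (ler_normB _ _) _; apply: lerD; last first.
  exact: norm_mul_le (lexx _) (y2_bound t).
rewrite /z2; apply: le_trans (ler_normD _ _) _; apply: lerD; last first.
  rewrite [6 * U]mulrC; exact: norm_mul_le (y1_bound t) (smoothstep'_bound _).
rewrite [7 * _]mulrC; apply: (norm_mul_le _ (smoothstep_bound _)).
apply: (@norm_mul_le _ (2 * U) _ g^-1); last by rewrite gtr0_norm ?invr_gt0.
apply: le_trans (ler_normB _ _) _.
have := u1_bound t; have := y1_bound t; lra.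
Qed.

Let v2E t : t <= T -> v2 t = v t.
Proof.
move=> tT.
have yE x : x <= T -> y2 x = y x.
  by move=> xT; rewrite /y2 y1E// smoothstep_le0 ?mulr1//; have := LT; lra.
rewrite /v2 /v yE//; congr (_ - _ + b * _).
  rewrite /z2 /z1 smoothstep_le0; last by have := LT; lra.
  rewrite smoothstep'_out; last by left; have := LT; lra.
  rewrite mulr0 addr0 mulr1 y1E// /u1 chi_le// mulr1 /u.
  by field; rewrite gt_eqF.
rewrite /window; apply: eq_intg => //; first lra.
by move=> x /andP[_ xt]; apply: yE; exact: le_trans tT.
Qed.

Let u2_eq t : t <= T -> u2 t = u t.
Proof.
move=> tT; rewrite u2E smoothstep_le0; last by have := LT; lra.
rewrite smoothstep'_out; last by left; have := LT; lra.
by rewrite mulr0 addr0 mulr1 /u1 chi_le// mulr1.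
Qed.

Let u2_mid t : T <= t <= T + s -> `|u2 t| <= U.
Proof.
move=> /andP[t1 t2]; rewrite u2E smoothstep_le0; last by have := LT; have := s1; lra.
rewrite smoothstep'_out; last by left; have := LT; have := s1; lra.
by rewrite mulr0 addr0 mulr1.
Qed.

Let u2_zero t : T + s <= t <= L -> u2 t = 0.
Proof.
move=> /andP[t1 t2]; rewrite u2E /u1 chi_ge// smoothstep'_out; last by left; lra.
by rewrite mulr0 mul0r mulr0 addr0.
Qed.

Let tail := 6 * g * U * expR (- ((L - (T + 1)) / g)).
Let u2_tail t : L <= t -> `|u2 t| <= tail.
Proof.
move=> Lt; rewrite u2E /u1 chi_ge; last by have := LT; have := s1; lra.
have hy : `|y1 t| <= expR (- ((L - (T + 1)) / g)) * U.
  rewrite y1_tail; last by have := LT; lra.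
  apply: (norm_mul_le _ (y1_bound _)); rewrite gtr0_norm ?expR_gt0//.
  by rewrite ler_expR lerN2 ler_pM2r ?invr_gt0//; lra.
rewrite mulr0 mul0r add0r.
rewrite (_ : tail = g * (expR (- ((L - (T + 1)) / g)) * U) * 6); last by rewrite /tail; ring.
apply: (norm_mul_le _ (smoothstep'_bound _)); apply: (norm_mul_le _ hy).
by rewrite gtr0_norm.
Qed.

(** [energy_compact] for the truncation y2: the second error term comes from
    [T, T + s], the last one from [L, L + 1]. *)
Lemma energy_cutoff : e * intg (fun t => u t ^+ 2) 0 T <=
  intg (fun t => u t * v t) 0 T + s * (U * cutoff_bound) + 2 * (tail * cutoff_bound).
Proof.
have L1 : 0 < L + 1 by have := T0; have := LT; lra.
have := @energy_compact y2 z2 (L + 1) L1 cz2 dy2.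
have supp t : t <= 0 \/ L + 1 <= t -> y2 t = 0 /\ z2 t = 0.
  by move=> [/y2_past|/y2_future].
move=> /(_ supp); rewrite -/(u2 _) -/(v2 _) => hE.
have cuu : cts (fun t => u2 t * v2 t) by cont.
apply: le_trans (_ : e * intg (fun t => u2 t ^+ 2) 0 (L + 1 + 1) <= _).
  rewrite ler_pM2l//.
  apply: le_trans (_ : intg (fun t => u2 t ^+ 2) 0 T <= _).
    rewrite le_eqVlt; apply/orP; left; apply/eqP.
    by apply: eq_intg; [cont|cont|exact: ltW|move=> x /andP[_ xT]; rewrite u2_eq].
  apply: le_intg_itv; [by cont|by move=> x; rewrite sqr_ge0|by []|exact: ltW|].
  by have := T0; have := LT; lra.
apply: le_trans hE _.
rewrite -(intg_chasles _ T) -(intg_chasles _ (T + s) T) -(intg_chasles _ L (T + s)).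
have -> : intg (fun t => u2 t * v2 t) 0 T = intg (fun t => u t * v t) 0 T.
  apply: eq_intg => //; [by rewrite /v; cont|exact: ltW|].
  by move=> x /andP[_ xT]; rewrite u2_eq// v2E.
rewrite -[leRHS]addrA lerD2l.
apply: lerD.
  have := @norm_intg_le R _ (fun=> U * cutoff_bound) T (T + s) cuu (@cts_cst R _).
  rewrite intg_cst (_ : T + s - T = s); last by ring.
  move=> hn; apply: le_trans (ler_norm _) _; rewrite [leRHS]mulrC; apply: hn.
    by have := s0; lra.
  by move=> x xT; exact: norm_mul_le (u2_mid xT) (v2_bound x).
rewrite (@intg_eq0 _ _ (T + s) L) ?add0r//; last 2 first.
- by have := LT; have := s1; lra.
- by move=> x xT; rewrite -/(u2 x) (u2_zero xT) mul0r.
have := @norm_intg_le R _ (fun=> tail * cutoff_bound) L (L + 1 + 1) cuu (@cts_cst R _).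
rewrite intg_cst (_ : L + 1 + 1 - L = 2); last by ring.
move=> hn; apply: le_trans (ler_norm _) _; rewrite [leRHS]mulrC; apply: hn; first lra.
by move=> x /andP[xT _]; exact: norm_mul_le (u2_tail xT) (v2_bound x).
Qed.
End Cutoff.

(** The inequality of [energy_compact] up to a time T, without any condition
    after T: let s tend to 0 and L to infinity in [energy_cutoff]. *)
Lemma energy_causal :
  e * intg (fun t => u t ^+ 2) 0 T <= intg (fun t => u t * v t) 0 T.
Proof.
have [U U0 hU] := U_ex.
apply/ler_addgt0Pr => eta eta0.
pose W := cutoff_bound U.
have W0 : 0 < W + 1.
  rewrite ltr_wpDl// /W /cutoff_bound !addr_ge0//.
  - by rewrite mulr_ge0// divr_ge0 ?(ltW g0)// mulr_ge0// ltW.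
  - by rewrite mulr_ge0// ltW.
  - by rewrite mulr_ge0// mulr_ge0// ltW.
  - by rewrite mulr_ge0// mulr_ge0// ltW.
pose s := Num.min 1 (eta / 2 / (U * (W + 1))).
have s01 : 0 < s <= 1.
  by rewrite /s ge_min lexx andbT lt_min ltr01/= !divr_gt0// mulr_gt0.
pose x := 12 * g * U * (W + 1) / (eta / 2).
have x0 : 0 < x by rewrite /x !divr_gt0// !mulr_gt0.
pose L := T + 2 + g * x.
have LT : T + 2 <= L by rewrite /L lerDl mulr_ge0// ltW.
have := @energy_cutoff U s L U0 hU s01 LT; rewrite -/W => hE.
apply: le_trans hE _; rewrite -addrA lerD2l.
have p1 : s * (U * W) <= eta / 2.
  apply: le_trans (_ : eta / 2 / (U * (W + 1)) * (U * (W + 1)) <= _); last first.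
    by rewrite divfK// gt_eqF// mulr_gt0.
  case/andP: s01 => s0 _; apply: le_trans (_ : s * (U * (W + 1)) <= _).
    by rewrite ler_pM2l// ler_pM2l//; lra.
  by rewrite ler_pM2r ?mulr_gt0// /s ge_min lexx orbT.
have p2 : expR (- ((L - (T + 1)) / g)) <= x^-1.
  rewrite expRN lef_pV2 ?posrE ?expR_gt0//.
  apply: le_trans (expR_ge1Dx _).
  apply: le_trans (_ : (g * x) / g <= _); first by rewrite mulrAC divff ?mul1r// gt_eqF.
  apply: le_trans (_ : (L - (T + 1)) / g <= _); last by rewrite lerDr.
  by rewrite ler_pM2r ?invr_gt0// /L; lra.
have p3 : 2 * (6 * g * U * expR (- ((L - (T + 1)) / g)) * W) <= eta / 2.
  apply: le_trans (_ : 12 * g * U * (W + 1) * x^-1 <= _); last first.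
    rewrite (_ : _ * _ = eta / 2)// /x; field.
    by rewrite !gt_eqF.
  rewrite (_ : 2 * _ = 12 * g * U * W * expR (- ((L - (T + 1)) / g))); last by ring.
  rewrite -!mulrA ler_pM2l// ler_pM2l// ler_pM2l//.
  apply: le_trans (_ : (W + 1) * expR (- ((L - (T + 1)) / g)) <= _).
    by rewrite ler_wpM2r ?(ltW (expR_gt0 _))//; lra.
  by rewrite ler_pM2l.
lra.
Qed.
End Causal.
End EnergyInequality.

(** * Continuity arguments *)

Section Bootstrap.
Context {R : realType}.

Lemma first_crossing (f : R -> R) (a b : R) : cts f -> a <= b -> f a < 0 ->
  0 <= f b -> exists c, [/\ a < c, c <= b, f c = 0 & forall t, a <= t < c -> f t < 0].
Proof.
move=> cf ab fa fb.
pose A := [set t : R | a <= t <= b /\ 0 <= f t].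
have cA : compact A.
  apply: (@subclosed_compact _ _ `[a, b]%classic) => //.
  - have -> : A = `[a, b]%classic `&` (f @^-1` [set t | 0 <= t]).
      by apply/seteqP; split => t /=; rewrite in_itv/=.
    apply: closedI; first exact: itv_closed.
    by apply: closed_comp => [t _|]; [exact: cf|exact: closed_ge].
  - exact: segment_compact.
  - by move=> t [h _] /=; rewrite in_itv.
have A0 : A !=set0 by exists b; rewrite /A/= ab lexx.
have [c] := compact_EVT_min A0 cA (@continuous_subspaceT _ _ _ (fun t : R => t) (@cts_id R)).
rewrite inE => -[/andP[ac cb] fc] cmin.
have lt0 t : a <= t < c -> f t < 0.
  move=> /andP[at_ tc]; rewrite ltNge; apply/negP => ft.
  have := cmin t; rewrite inE => /(_ _); rewrite leNgt tc => /(_ _)/negP; apply => //.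
  by split => //; rewrite at_ ltW// (lt_le_trans tc).
have ac' : a < c.
  by rewrite lt_neqAle ac andbT; apply/eqP => e; move: fc; rewrite -e leNgt fa.
exists c; split => //.
apply/eqP; rewrite eq_le fc andbT leNgt; apply/negP => fc0.
have /cvgrPdist_lt/(_ _ fc0) := cf c; rewrite -filter_from_ballE => -[d /= d0 hd].
have [t [act tc dt]] : exists t, [/\ a <= t, t < c & c - t < d].
  exists (Num.max a (c - d / 2)); split.
  - by rewrite le_max lexx.
  - by rewrite gt_max ac'/=; lra.
  - have : c - d / 2 <= Num.max a (c - d / 2) by rewrite le_max lexx orbT.
    lra.
have := hd t; rewrite /ball/= gtr0_norm ?subr_gt0// => /(_ dt).
have := lt0 t; rewrite act tc => /(_ isT) ft.
by have := ler_norm (f c - f t); lra.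
Qed.

(** A bound that improves itself is never reached. *)
Lemma bootstrap (m : R -> R) (rho L : R) : cts m -> m 0 <= rho ->
  (forall T, 0 <= T <= L -> (forall t, 0 <= t <= T -> m t <= rho) -> m T < rho) ->
  forall T, 0 <= T <= L -> m T <= rho.
Proof.
move=> cm m0 step T /andP[T0 TL]; rewrite leNgt; apply/negP => mT.
have m0' : m 0 < rho.
  apply: step => [|t]; first by rewrite lexx (le_trans T0).
  by rewrite -eq_le => /eqP <-.
have cf : cts (fun t => m t - rho) by cont.
have [||c [c0 cT fc lt0]] := @first_crossing _ 0 T cf T0; [lra|lra|].
have : m c < rho.
  apply: step; first by rewrite (ltW c0) (le_trans cT).
  move=> t /andP[t0]; rewrite le_eqVlt => /predU1P[->|tc]; first lra.
  by have := lt0 t; rewrite t0 tc => /(_ isT); lra.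
lra.
Qed.

End Bootstrap.

(** * Nonlinear stability from the frequency-domain inequality *)

Section PositivePart.
Context {R : realType}.

Definition pospart (t : R) : R := (t + `|t|) / 2.

Lemma cts_pospart : cts pospart.
Proof. by rewrite /pospart; cont. Qed.

Lemma pospart_ge0 t : 0 <= t -> pospart t = t.
Proof. by move=> t0; rewrite /pospart ger0_norm//; lra. Qed.

Lemma pospart_le0 t : t <= 0 -> pospart t = 0.
Proof. by move=> t0; rewrite /pospart ler0_norm//; lra. Qed.

End PositivePart.

Section NonlinearStability.
Context {R : realType}.
Variables (h b g e : R).
Hypotheses (h0 : 0 < h) (hb : h < b) (g0 : 0 < g) (e0 : 0 < e) (ebh : e <= b - h).
Hypothesis coercive : forall nu : R, 0 < nu ->
    e * (1 + g ^+ 2 * nu ^+ 2) <=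
    b * (sin nu / nu) - h + g * (nu ^+ 2 - b * (1 - cos nu)).
Variables (r : R -> R) (M rho : R).
Hypotheses (cr : cts r) (M0 : 0 <= M) (rho0 : 0 < rho) (Mrho : M * rho <= e / 4).
Hypothesis hr : forall s, `|s| <= rho -> `|r s| <= M * s ^+ 2.

Let c0 := h + 2 * b + 4 * M.
Let cY := 5 + 2 * c0.
Let c1 := cY + 2.
Let c2 := (6 + 5 * c0) + h * cY + b * cY.
Let c3 := c2 + (b + e / 4) * c1.
(* the integral of u ^ 2 is at most c4 * d ^ 2 *)
Let c4 := c3 ^+ 2 * expR 4 / e ^+ 2.
(* |y| <= c5 * d *)
Let c5 := Num.sqrt (c4 / g).
(* |x (t - 1) - x t| <= c6 * d *)
Let c6 := 2 + c5.
Let c7 := M * (2 * c4 + c1 ^+ 2 * expR 4).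
Let c8 := (1 + h + b + c7 + c5 + b * (2 + c5)) / (b - h).

Let b0 : 0 < b. Proof. exact: lt_trans hb. Qed.
Let c00 : 0 <= c0. Proof. by rewrite /c0; have := M0; have := h0; have := b0; lra. Qed.
Let cY0 : 0 <= cY. Proof. by rewrite /cY; have := c00; lra. Qed.
Let c10 : 0 <= c1. Proof. by rewrite /c1; have := cY0; lra. Qed.
Let c20 : 0 <= c2.
Proof.
rewrite /c2; have := c00; have := mulr_ge0 (ltW h0) cY0.
by have := mulr_ge0 (ltW b0) cY0; lra.
Qed.
Let c30 : 0 <= c3.
Proof.
rewrite /c3; have := c20; have : 0 <= (b + e / 4) * c1; last by lra.
by rewrite mulr_ge0//; have := b0; have := e0; lra.
Qed.

Variables (x y : R -> R) (d : R).
Hypotheses (d0 : 0 < d) (d1 : d <= 1) (drho : 2 * d <= rho) (d6 : c6 * d < rho).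
Hypotheses (cx : cts x) (cy : cts y).
Hypothesis x_init : forall t, - 1 <= t <= 0 -> `|x t| <= d.
Hypothesis y_init : `|y 0| <= d.
Let D t := x (t - 1) - x t.
Let f t := h * y t + b * D t + r (D t).
Hypothesis dx : forall t, 0 < t -> der x t (y t).
Hypothesis dy : forall t, 0 < t -> der y t (f t).

Let cD : cts D. Proof. by rewrite /D; cont. Qed.
Let cf : cts f. Proof. by rewrite /f; cont. Qed.
Let cpos := @cts_pospart R.
Let ccl := @cts_clamp01 R.

(* The energy inequality is for a C^1 velocity vanishing in the past, so y is
   delayed by one unit of time; on [0, 1], Y is the cubic that joins (0, 0) to
   the values of y and y' at time 0. *)
Let y0 := y 0.
Let z0 := f 0.
Let p t := 6 * y0 * (t - t ^+ 2) + z0 * (3 * t ^+ 2 - 2 * t).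
Let Z t := p (clamp01 t) - z0 + f (pospart (t - 1)).
Let Y t := intg Z 0 t.
Let W := window Y.

Let cp : cts p. Proof. by rewrite /p; cont. Qed.
Let cZ : cts Z. Proof. by rewrite /Z; cont. Qed.
Let dY t : der Y t (Z t). Proof. exact: is_derive_intg. Qed.
Let cY' : cts Y. Proof. exact: der_cts dY. Qed.
Let cW : cts W. Proof. exact: cts_window. Qed.

Let D0_le : `|D 0| <= 2 * d.
Proof.
rewrite /D sub0r; apply: le_trans (ler_normB _ _) _.
have h1 := @x_init (- 1); have h2 := @x_init 0; rewrite lexx in h2; rewrite lexx in h1.
have := h1 ltac:(lra); have := h2 ltac:(lra); lra.
Qed.

Let z0_le : `|z0| <= c0 * d.
Proof.
rewrite /z0 /f; apply: le_trans (ler_normD _ _) _.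
have hr0 : `|r (D 0)| <= 4 * M * d.
  apply: le_trans (hr (le_trans D0_le drho)) _.
  rewrite -[D 0 ^+ 2]real_normK ?num_real//.
  apply: le_trans (_ : M * (2 * d) ^+ 2 <= _).
    by rewrite ler_wpM2l// ler_pXn2r ?nnegrE// mulr_ge0// ltW.
  have dd : d ^+ 2 <= d by rewrite expr2 ler_piMl// ltW.
  rewrite (_ : (2 * d) ^+ 2 = 4 * d ^+ 2); last by ring.
  by have := ler_wpM2l M0 dd; lra.
apply: le_trans (lerD (ler_normD _ _) hr0) _.
have h1 : `|h * y 0| <= h * d by apply: norm_mul_le y_init; rewrite gtr0_norm.
have h2 : `|b * D 0| <= b * (2 * d) by apply: norm_mul_le D0_le; rewrite gtr0_norm.
by rewrite /c0; lra.
Qed.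

Let Z_past t : t <= 0 -> Z t = 0.
Proof.
move=> t0; rewrite /Z clamp01_le0// pospart_le0; last by lra.
by rewrite /p -/z0; ring.
Qed.
Let Y_past t : t <= 0 -> Y t = 0.
Proof.
move=> t0; have := intgxx Z 0; rewrite -(intg_chasles Z t 0 0).
have -> : intg Z t 0 = 0 by apply: intg_eq0 => // s /andP[_ s0]; rewrite Z_past.
by rewrite addr0.
Qed.

Let ZE1 t : 0 <= t <= 1 -> Z t = p t.
Proof.
move=> t01; rewrite /Z clamp01_id// pospart_le0; last by lra.
by rewrite -/z0 subrK.
Qed.

Let YE1 t : 0 <= t <= 1 -> Y t = y0 * (3 * t ^+ 2 - 2 * t ^+ 3) + z0 * (t ^+ 3 - t ^+ 2).
Proof.
move=> /andP[t0 t1]; rewrite /Y.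
have -> : intg Z 0 t = intg p 0 t.
  by apply: eq_intg => // s /andP[s0 st]; rewrite ZE1// s0 (le_trans st).
rewrite (@intg_FTC _ p (fun t => y0 * (3 * t ^+ 2 - 2 * t ^+ 3) + z0 * (t ^+ 3 - t ^+ 2)))//.
  by ring.
by move=> s; derv; rewrite /p; ring.
Qed.

Let ZE t : 1 <= t -> Z t = f (t - 1).
Proof.
move=> t1; rewrite /Z clamp01_ge1// pospart_ge0 ?subr_ge0//.
by rewrite /p; ring.
Qed.

Let YE t : 1 <= t -> Y t = y (t - 1).
Proof.
move=> t1; rewrite /Y -(intg_chasles Z 1).
have := @YE1 1; rewrite ler01 lexx /Y => ->//.
have -> : intg Z 1 t = intg (fun s => f (s - 1)) 1 t.
  by apply: eq_intg => //; [cont|move=> s /andP[s1 _]; rewrite ZE].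
rewrite (@intg_shift _ f (-1))// (@intg_FTC_within _ f y)//.
- by rewrite subrr /y0; ring.
- by lra.
- by move=> s /andP[]; rewrite subrr => s0 _; exact: dy.
- exact: continuous_subspaceT.
Qed.

Let poly_le (s : R) : 0 <= s <= 1 ->
  [/\ `|s - s ^+ 2| <= 1, `|3 * s ^+ 2 - 2 * s| <= 5,
      `|3 * s ^+ 2 - 2 * s ^+ 3| <= 5 & `|s ^+ 3 - s ^+ 2| <= 2].
Proof.
move=> /andP[s0 s1].
have q2 : 0 <= s ^+ 2 <= 1 by rewrite exprn_ge0// exprn_ile1.
have q3 : 0 <= s ^+ 3 <= 1 by rewrite exprn_ge0// exprn_ile1.
by split; rewrite ler_norml; move: q2 q3 => /andP[? ?] /andP[? ?]; lra.
Qed.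

Let Z_le1 t : t <= 1 -> `|Z t| <= (6 + 5 * c0) * d.
Proof.
have [t0|t0] := leP t 0.
  move=> _; rewrite Z_past// normr0 mulr_ge0 ?(ltW d0)//; have := c00; lra.
move=> t1; rewrite ZE1 ?(ltW t0)// /p.
have [q1 q2 _ _] := @poly_le t ltac:(by rewrite (ltW t0)).
apply: le_trans (ler_normD _ _) _.
have a1 := norm_mul_le z0_le q2.
have a2 : `|6 * y0| <= 6 * d by apply: norm_mul_le y_init; rewrite ger0_norm.
have := norm_mul_le a2 q1; lra.
Qed.

Let Y_le1 t : t <= 1 -> `|Y t| <= cY * d.
Proof.
have [t0|t0] := leP t 0.
  by move=> _; rewrite Y_past// normr0 mulr_ge0// ltW.
move=> t1; rewrite YE1 ?(ltW t0)//.
have [_ _ q1 q2] := @poly_le t ltac:(by rewrite (ltW t0)).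
apply: le_trans (ler_normD _ _) _.
have := norm_mul_le y_init q1; have := norm_mul_le z0_le q2; rewrite /cY; lra.
Qed.

(* D (t - 1) = - W t would hold if Y were the derivative of x on the whole line;
   the defect q vanishes for t >= 2 *)
Let q t := D (t - 1) + W t.
Let cq : cts q. Proof. by rewrite /q; cont. Qed.

Let x_intg s t : 0 <= s -> s <= t -> x t - x s = intg Y (s + 1) (t + 1).
Proof.
move=> s0 st; rewrite -(@intg_FTC_within _ y x s t)//; last 2 first.
- by move=> z /andP[sz _]; apply: dx; exact: le_lt_trans sz.
- exact: continuous_subspaceT.
rewrite -(intg_shift 1)//; apply: eq_intg => //; first by cont.
by move=> z /andP[sz _]; rewrite YE ?addrK//; lra.
Qed.

Let q_ge2 t : 2 <= t -> q t = 0.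
Proof.
move=> t2; rewrite /q /D /W /window.
have := @x_intg (t - 1 - 1) (t - 1) ltac:(lra) ltac:(lra).
by rewrite !subrK => <-; ring.
Qed.

Let q_le2 t : 1 <= t <= 2 -> `|q t| <= c1 * d.
Proof.
move=> /andP[t1 t2]; rewrite /q /D /W /window -(intg_chasles Y 1).
have := @x_intg 0 (t - 1) (lexx _) ltac:(lra); rewrite add0r subrK => <-.
rewrite (_ : _ + _ = x (t - 1 - 1) - x 0 + intg Y (t - 1) 1); last by ring.
have a1 := @x_init (t - 1 - 1) ltac:(lra).
have a2 := @x_init 0 ltac:(lra).
have a3 : `|intg Y (t - 1) 1| <= cY * d.
  apply: le_trans (_ : intg (fun=> cY * d) (t - 1) 1 <= _).
    apply: norm_intg_le => //; [exact: cts_cst|by lra|].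
    by move=> s /andP[_ s1]; exact: Y_le1.
  rewrite intg_cst ler_piMr ?mulr_ge0 ?(ltW d0)//; lra.
apply: le_trans (ler_normD _ _) _.
by have := ler_normB (x (t - 1 - 1)) (x 0); rewrite /c1; lra.
Qed.

(* a square integrable weight for the terms that come from t <= 2 *)
Let chi (t : R) := expR (2 - t).
Let cchi : cts chi. Proof. by rewrite /chi; cont. Qed.
Let chi0 t : 0 <= chi t. Proof. by rewrite /chi ltW// expR_gt0. Qed.
Let chi1 t : t <= 2 -> 1 <= chi t.
Proof. by move=> t2; rewrite /chi -[leLHS]expR0 ler_expR subr_ge0. Qed.

Let q_le t : 1 <= t -> `|q t| <= c1 * d * chi t.
Proof.
move=> t1; have [t2|t2] := leP t 2.
  apply: le_trans (@q_le2 t _) _; first by rewrite t1.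
  by rewrite ler_peMr ?chi1// mulr_ge0// ltW.
by rewrite q_ge2 ?normr0 ?mulr_ge0// ltW.
Qed.

Let chi_sq T : 0 <= T -> intg (fun t => chi t ^+ 2) 0 T <= expR 4 / 2.
Proof.
move=> T0; have -> : (fun t => chi t ^+ 2) = (fun t => expR (4 - 2 * t)).
  by apply/funext => t; rewrite /chi expr2 -expRD; congr expR; ring.
rewrite (@intg_FTC _ _ (fun t => - (expR (4 - 2 * t) / 2))); last 2 first.
- by cont.
- by move=> t; derv; field.
rewrite mulr0 subr0; have := expR_gt0 (4 - 2 * T); lra.
Qed.

Let u t := Y t + g * Z t.
Let v t := Z t - h * Y t + b * W t.
Let cu : cts u. Proof. by rewrite /u; cont. Qed.
Let cv : cts v. Proof. by rewrite /v; cont. Qed.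

Section UpTo.
Variable T : R.
Hypotheses (T0 : 0 <= T) (DT : forall t, 0 <= t <= T -> `|D t| <= rho).

Let W_le1 t : t <= 1 -> `|W t| <= cY * d.
Proof.
move=> t1; apply: le_trans (_ : intg (fun=> cY * d) (t - 1) t <= _).
  apply: norm_intg_le => //; [exact: cts_cst|by lra|].
  by move=> s /andP[_ st]; apply: Y_le1; exact: le_trans t1.
by rewrite intg_cst opprB addrCA subrr addr0 mulr1.
Qed.

(* where |D| <= rho, the remainder r (D t) is at most a quarter of e |D t| *)
Let v_le t : t <= T + 1 -> `|v t| <= e / 4 * `|W t| + c3 * d * chi t.
Proof.
move=> tT.
have c30d : 0 <= c3 * d by rewrite mulr_ge0// ltW.
have [t1|t1] := leP t 1.
  have : `|v t| <= c2 * d.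
    rewrite /v; apply: le_trans (ler_normD _ _) _.
    have a1 := @Z_le1 t t1; have a2 := @Y_le1 t t1; have a3 := @W_le1 t t1.
    have a4 : `|h * Y t| <= h * (cY * d) by apply: norm_mul_le a2; rewrite gtr0_norm.
    have a5 : `|b * W t| <= b * (cY * d) by apply: norm_mul_le a3; rewrite gtr0_norm.
    by have := ler_normB (Z t) (h * Y t); rewrite /c2; lra.
  move=> hv; apply: le_trans hv _.
  apply: le_trans (_ : c3 * d <= _).
    rewrite ler_wpM2r ?(ltW d0)// /c3 lerDl mulr_ge0//; have := b0; have := e0; lra.
  have : 0 <= e / 4 * `|W t| by rewrite mulr_ge0//; have := e0; lra.
  have : c3 * d <= c3 * d * chi t.
    by rewrite ler_peMr// chi1//; lra.
  lra.
have t1' := ltW t1.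
have vE : v t = b * q t + r (D (t - 1)).
  by rewrite /v ZE// YE// /q /f; ring.
have hq := q_le t1'.
have hD : `|D (t - 1)| <= rho by apply: DT; lra.
have hDq : `|D (t - 1)| <= `|W t| + `|q t|.
  rewrite (_ : D (t - 1) = q t - W t); last by rewrite /q addrK.
  by apply: le_trans (ler_normB _ _) _; rewrite addrC.
have hrD : `|r (D (t - 1))| <= e / 4 * (`|W t| + `|q t|).
  apply: le_trans (hr hD) _; rewrite -[_ ^+ 2]real_normK ?num_real// expr2 mulrA.
  apply: ler_pM => //; first exact: mulr_ge0.
  by apply: le_trans Mrho; rewrite ler_wpM2l.
rewrite vE; apply: le_trans (ler_normD _ _) _.
have hbq : `|b * q t| <= b * `|q t| by rewrite normrM gtr0_norm.
have e4 : 0 <= b + e / 4 by have := b0; have := e0; lra.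
have := ler_wpM2l e4 hq.
have : 0 <= c2 * d * chi t by rewrite !mulr_ge0// ltW.
rewrite /c3; lra.
Qed.

Let T1 := T + 1.
Let T10 : 0 < T1. Proof. by have := T0; rewrite /T1; lra. Qed.
Let E := intg (fun t => u t ^+ 2) 0 T1.

Let Y_energy : g * Y T1 ^+ 2 + intg (fun t => Y t ^+ 2) 0 T1 <= E.
Proof.
have e1 : 2 * intg (fun t => u t * Y t) 0 T1 = 2 * intg (fun t => Y t ^+ 2) 0 T1 + g * Y T1 ^+ 2.
  rewrite -!intgZ; [|by cont..].
  have <- : intg (fun t => 2 * g * (Y t * Z t)) 0 T1 = g * Y T1 ^+ 2.
    rewrite (@intg_FTC _ _ (fun t => g * Y t ^+ 2)); [|by cont|by move=> t; derv; ring].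
    by rewrite (@Y_past 0)//; ring.
  rewrite -intgD; [|by cont..].
  by congr intg; apply/funext => t; rewrite /u; ring.
have e2 : 2 * intg (fun t => u t * Y t) 0 T1 <= E + intg (fun t => Y t ^+ 2) 0 T1.
  rewrite /E -intgZ; last by cont.
  rewrite -intgD; [|by cont..].
  apply: le_intg; [by cont|by cont|exact: ltW|] => t _.
  have := sqr_ge0 (u t - Y t); rewrite sqrrB; lra.
lra.
Qed.

Let W_energy : intg (fun t => W t ^+ 2) 0 T1 <= intg (fun t => Y t ^+ 2) 0 T1.
Proof.
pose Q t := intg (fun s => Y s ^+ 2) 0 t.
have cQ : cts Q by rewrite /Q; cont.
have cYY : cts (fun s => Y s ^+ 2) by cont.
have WQ t : W t ^+ 2 <= Q t - Q (t - 1).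
  (* Cauchy-Schwarz on a unit interval *)
  have : 0 <= intg (fun s => (Y s - W t) ^+ 2) (t - 1) t.
    by apply: intg_ge0; [cont|lra|move=> s _; exact: sqr_ge0].
  have -> : (fun s => (Y s - W t) ^+ 2) = (fun s => Y s ^+ 2 + (- 2 * W t) * Y s + W t ^+ 2).
    by apply/funext => s; ring.
  rewrite intgD; [|by cont..]; rewrite intgD; [|by cont..].
  rewrite intgZ// intg_cst -/(window Y t) -/(W t).
  have -> : intg (fun t => Y t ^+ 2) (t - 1) t = Q t - Q (t - 1).
    by rewrite /Q -(intg_chasles _ (t - 1) 0 t); ring.
  rewrite expr2; lra.
have Q_past t : t <= 0 -> Q t = 0.
  move=> t0; have := intgxx (fun s => Y s ^+ 2) 0; rewrite -(intg_chasles _ t 0 0).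
  have -> : intg (fun s => Y s ^+ 2) t 0 = 0.
    by apply: intg_eq0 => // s /andP[_ s0]; rewrite Y_past// expr0n.
  by rewrite addr0.
have Q_mono s t : s <= t -> Q s <= Q t.
  move=> st; rewrite -subr_ge0.
  have -> : Q t - Q s = intg (fun t => Y t ^+ 2) s t.
    by rewrite /Q -(intg_chasles _ s 0 t); ring.
  by apply: intg_ge0 => // z _; exact: sqr_ge0.
apply: le_trans (_ : intg (fun t => Q t - Q (t - 1)) 0 T1 <= _).
  by apply: le_intg; [cont|cont|exact: ltW|].
rewrite intgB; [|by cont..].
rewrite (@intg_shift _ Q (-1))//.
rewrite -(intg_chasles Q 0 (0 - 1)) -(intg_chasles Q (T1 - 1) 0 T1).
have -> : intg Q (0 - 1) 0 = 0.
  apply: intg_eq0 => // s /andP[_ s0]; exact: Q_past.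
rewrite add0r addrAC subrr add0r.
apply: le_trans (_ : intg (fun=> Q T1) (T1 - 1) T1 <= _).
  apply: le_intg => //; [exact: cts_cst|lra|].
  by move=> s /andP[_ sT]; exact: Q_mono.
by rewrite intg_cst opprB addrCA subrr addr0 mulr1.
Qed.

(** The energy inequality bounds e times the integral of u ^ 2 by the integral of
    u v, and [v_le] makes v small against u. *)
Lemma u_energy : E <= c4 * d ^+ 2.
Proof.
have hE : e * E <= intg (fun t => u t * v t) 0 T1.
  apply: (@energy_causal R h b g e) => //.
  by move=> t t0; rewrite Y_past// Z_past.
have uv : intg (fun t => u t * v t) 0 T1 <=
   (e / 8 + e / 4) * E + e / 8 * intg (fun t => W t ^+ 2) 0 T1 + (c3 * d) ^+ 2 / e * intg (fun t => chi t ^+ 2) 0 T1.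
  rewrite /E -!intgZ; [|by cont..]; rewrite -!intgD; [|by cont..].
  apply: le_intg; [by cont|by cont|exact: ltW|].
  move=> t /andP[_ tT].
  apply: le_trans (ler_norm _) _; rewrite normrM.
  apply: le_trans (ler_wpM2l (normr_ge0 _) (v_le tT)) _.
  rewrite -[u t ^+ 2]real_normK ?num_real// -[W t ^+ 2]real_normK ?num_real//.
  set U := `|u t|; set w := `|W t|; set k := c3 * d; set X := chi t.
  have hw : 0 <= e / 8 * (U - w) ^+ 2 by rewrite mulr_ge0 ?sqr_ge0//; have := e0; lra.
  have hk : 0 <= (e * U / 2 - k * X) ^+ 2 / e by rewrite divr_ge0 ?sqr_ge0// ltW.
  rewrite (_ : _ / e = e / 4 * U ^+ 2 - U * (k * X) + k ^+ 2 / e * X ^+ 2) in hk; last first.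
    by field; rewrite gt_eqF.
  rewrite sqrrB in hw; lra.
have {}hW : intg (fun t => W t ^+ 2) 0 T1 <= E.
  apply: le_trans W_energy _; have := Y_energy.
  have : 0 <= g * Y T1 ^+ 2 by rewrite mulr_ge0 ?sqr_ge0// ltW.
  lra.
have e8 : 0 <= e / 8 by have := e0; lra.
have k0 : 0 <= (c3 * d) ^+ 2 / e by rewrite divr_ge0 ?sqr_ge0// ltW.
have h1 := ler_wpM2l e8 hW.
have h2 := ler_wpM2l k0 (chi_sq (ltW T10)).
have h3 : e / 2 * E <= (c3 * d) ^+ 2 / e * (expR 4 / 2) by lra.
rewrite /c4 (_ : _ * d ^+ 2 = (c3 * d) ^+ 2 / e * (expR 4 / 2) / (e / 2)).
  by rewrite ler_pdivlMr ?divr_gt0// mulrC.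
by field; rewrite gt_eqF.
Qed.

Let c40 : 0 <= c4.
Proof. by rewrite /c4 divr_ge0 ?sqr_ge0// mulr_ge0 ?sqr_ge0// ltW// expR_gt0. Qed.

Lemma y_bound_upto : `|y T| <= c5 * d.
Proof.
have -> : y T = Y T1 by rewrite YE /T1 ?addrK//; have := T0; lra.
have := Y_energy; have := u_energy.
have YY : 0 <= intg (fun t => Y t ^+ 2) 0 T1.
  by apply: intg_ge0; [cont|exact: ltW|move=> s _; exact: sqr_ge0].
move=> hE hY; have hg : g * Y T1 ^+ 2 <= c4 * d ^+ 2 by lra.
have h2 : Y T1 ^+ 2 <= (c5 * d) ^+ 2.
  have c4g : 0 <= c4 / g by apply: divr_ge0; [exact: c40|exact: ltW].
  rewrite exprMn /c5 sqr_sqrtr//.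
  by rewrite mulrAC ler_pdivlMr// mulrC.
have c5d : 0 <= c5 * d by rewrite mulr_ge0 ?sqrtr_ge0// ltW.
by rewrite -(ger0_norm c5d) -ler_sqr ?nnegrE// !real_normK ?num_real.
Qed.

Let WE2 : intg (fun t => W t ^+ 2) 0 T1 <= c4 * d ^+ 2.
Proof.
apply: le_trans W_energy _; have := Y_energy; have := u_energy.
have : 0 <= g * Y T1 ^+ 2 by rewrite mulr_ge0 ?sqr_ge0// ltW.
lra.
Qed.

Lemma remainder_bound_upto : `|intg (fun t => r (D t)) 0 T| <= c7 * d.
Proof.
have h1 : `|intg (fun t => r (D t)) 0 T| <= intg (fun t => M * D t ^+ 2) 0 T.
  apply: norm_intg_le; [by cont|by cont|by []|move=> t tT].
  by apply: hr; exact: DT.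
apply: le_trans h1 _.
have -> : intg (fun t => M * D t ^+ 2) 0 T = intg (fun t => M * D (t - 1) ^+ 2) 1 T1.
  rewrite (@intg_shift _ (fun t => M * D t ^+ 2) (-1)) /T1; last by cont.
  by rewrite subrr addrK.
pose F t := M * (2 * W t ^+ 2 + 2 * (c1 * d) ^+ 2 * chi t ^+ 2).
have cF : cts F by rewrite /F; cont.
apply: le_trans (_ : intg F 1 T1 <= _).
  apply: le_intg; [by cont|by []|by have := T0; rewrite /T1; lra|].
  move=> t /andP[t1 _]; rewrite /F ler_wpM2l//.
  rewrite (_ : D (t - 1) = q t - W t); last by rewrite /q addrK.
  have hq := q_le t1.
  have hq2 : q t ^+ 2 <= (c1 * d * chi t) ^+ 2.
    rewrite -[q t ^+ 2]real_normK ?num_real// ler_pXn2r ?nnegrE//.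
    by rewrite !mulr_ge0// ltW.
  rewrite [(c1 * d * _) ^+ 2]exprMn in hq2.
  have := sqr_ge0 (q t + W t); rewrite sqrrB sqrrD; lra.
apply: le_trans (_ : intg F 0 T1 <= _).
  apply: le_intg_itv => //; [|by have := T0; rewrite /T1; lra].
  move=> t; rewrite /F mulr_ge0// addr_ge0// mulr_ge0 ?sqr_ge0// mulr_ge0 ?sqr_ge0//.
rewrite /F intgZ; last by cont.
rewrite intgD; [|by cont..]; rewrite !intgZ; [|by cont..].
have h2 := chi_sq (ltW T10); have h3 := WE2.
have k0 : 0 <= 2 * (c1 * d) ^+ 2 by rewrite mulr_ge0// sqr_ge0.
have h4 := ler_wpM2l k0 h2.
have h5 : 2 * intg (fun t => W t ^+ 2) 0 T1 + 2 * (c1 * d) ^+ 2 * intg (fun t => chi t ^+ 2) 0 T1 <= (2 * c4 + c1 ^+ 2 * expR 4) * d ^+ 2.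
  rewrite exprMn in h4 *; lra.
apply: le_trans (ler_wpM2l M0 h5) _.
rewrite /c7 mulrA ler_wpM2l//; last by rewrite expr2 ler_piMl// ltW.
have ex0 : 0 <= expR 4 :> R by exact: ltW (expR_gt0 _).
apply: mulr_ge0 => //; apply: addr_ge0.
  by apply: mulr_ge0 => //; exact: c40.
by apply: mulr_ge0 => //; exact: sqr_ge0.
Qed.

End UpTo.

Let x_incr T s : 0 <= T -> (forall t, 0 <= t <= T -> `|D t| <= rho) ->
  T - 1 <= s <= T -> `|x T - x s| <= (2 + c5) * d.
Proof.
move=> T0 DT /andP[sT1 sT].
have hy t : 0 <= t <= T -> `|y t| <= c5 * d.
  move=> /andP[t0 tT]; apply: y_bound_upto => // t' /andP[t'0 t't].
  by apply: DT; rewrite t'0 (le_trans t't).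
have c5d : 0 <= c5 * d by rewrite mulr_ge0 ?sqrtr_ge0// ltW.
have hx t : 0 <= t -> t <= T -> T - 1 <= t -> `|x T - x t| <= c5 * d.
  move=> t0 tT Tt; rewrite -(@intg_FTC_within _ y x t T)//; last 2 first.
  - by move=> z /andP[sz _]; apply: dx; exact: le_lt_trans sz.
  - exact: continuous_subspaceT.
  apply: le_trans (_ : intg (fun=> c5 * d) t T <= _).
    apply: norm_intg_le => //; first exact: cts_cst.
    by move=> z /andP[tz zT]; apply: hy; rewrite zT (le_trans t0).
  by rewrite intg_cst ler_piMr//; lra.
have [s0|s0] := leP 0 s.
  by have := hx s s0 sT sT1; have := d0; lra.
have h1 := hx 0 (lexx _) T0 ltac:(lra).
have h2 := @x_init s ltac:(lra); have h3 := @x_init 0 ltac:(lra).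
have := ler_distD (x 0) (x T) (x s); have := ler_normB (x 0) (x s); lra.
Qed.

Let D_le T : 0 <= T -> `|D T| <= rho.
Proof.
move=> T0; apply: (@bootstrap R (fun t => `|D t|) rho T); last by rewrite T0 lexx.
- by cont.
- exact: le_trans D0_le drho.
- move=> {T0}T' /andP[T0 _] DT; apply: le_lt_trans d6.
  by rewrite /D distrC; apply: x_incr => //; lra.
Qed.

(** By [bootstrap], the a priori bound |D| <= rho is never lost. *)
Lemma y_bound T : 0 <= T -> `|y T| <= c5 * d.
Proof.
by move=> T0; apply: y_bound_upto => // t /andP[t0 _]; exact: D_le.
Qed.

(** S is a first integral of the linear equation: its increments are integrals of
    the remainder, which is quadratic in D and hence controlled by the energy. *)
Lemma x_bound T : 0 <= T -> `|x T| <= c8 * d.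
Proof.
move=> T0; have DT t : 0 <= t <= T -> `|D t| <= rho by move=> /andP[t0 _]; exact: D_le.
pose S t := y t - h * x t + b * window x t.
have cwx : cts (window x) by exact: cts_window.
have cS : cts S by rewrite /S; cont.
have crD : cts (fun t => r (D t)) by cont.
have SE : S T - S 0 = intg (fun t => r (D t)) 0 T.
  rewrite (@intg_FTC_within _ _ S)//; last exact: continuous_subspaceT.
  move=> t /andP[t0 _]; apply: der_eq.
    apply: is_deriveD_fun; last first.
      apply: is_deriveM_fun; [exact: der_cst|exact: der_window].
    apply: is_deriveD_fun; first exact: dy.
    apply: is_deriveN_fun; apply: is_deriveM_fun; [exact: der_cst|exact: dx].
  by rewrite /f /D; ring.
have hS := remainder_bound_upto T0 DT; rewrite -SE in hS.
have hx0 : `|x 0| <= d by apply: x_init; lra.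
have hw0 : `|window x 0| <= d.
  apply: le_trans (_ : intg (fun=> d) (0 - 1) 0 <= _).
    apply: norm_intg_le; [by []|exact: cts_cst|lra|].
    by move=> s hs; apply: x_init; lra.
  rewrite intg_cst; lra.
have hS0 : `|S 0| <= (1 + h + b) * d.
  rewrite /S; apply: le_trans (ler_normD _ _) _.
  have a1 : `|b * window x 0| <= b * d by apply: norm_mul_le hw0; rewrite gtr0_norm.
  have a2 : `|h * x 0| <= h * d by apply: norm_mul_le hx0; rewrite gtr0_norm.
  by have := ler_normB (y 0) (h * x 0); have := y_init; lra.
have hy := y_bound T0.
(* x is recovered from S because window x is close to x *)
have hwx : `|window x T - x T| <= (2 + c5) * d.
  have -> : window x T - x T = intg (fun s => x s - x T) (T - 1) T.
    rewrite intgB; [|by cont..].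
    by rewrite intg_cst opprB addrCA subrr addr0 mulr1.
  apply: le_trans (_ : intg (fun=> (2 + c5) * d) (T - 1) T <= _).
    apply: norm_intg_le; [by cont|exact: cts_cst|lra|].
    by move=> s hs; rewrite distrC; exact: x_incr.
  by rewrite intg_cst opprB addrCA subrr addr0 mulr1.
have bh : 0 < b - h by rewrite subr_gt0.
rewrite /c8 mulrAC ler_pdivlMr//.
have -> : `|x T| * (b - h) = `|S T - y T - b * (window x T - x T)|.
  rewrite -[X in _ * X](gtr0_norm bh) -normrM /S; congr `|_|; ring.
have a3 : `|b * (window x T - x T)| <= b * ((2 + c5) * d).
  by apply: norm_mul_le hwx; rewrite gtr0_norm.
have a4 : `|S T| <= c7 * d + (1 + h + b) * d.
  rewrite -[S T](subrK (S 0)); apply: le_trans (ler_normD _ _) _; lra.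
apply: le_trans (ler_normB _ _) _.
have := ler_normB (S T) (y T); lra.
Qed.
End NonlinearStability.

Section StabilityCore.
Context {R : realType}.

(** [x_bound] and [y_bound] with all constants hidden: the zero solution of the
    perturbed linear equation is stable. *)
Lemma stability_core (h b g e : R) : 0 < h -> h < b -> 0 < g -> 0 < e -> e <= b - h ->
  (forall nu : R, 0 < nu ->
    e * (1 + g ^+ 2 * nu ^+ 2) <=
    b * (sin nu / nu) - h + g * (nu ^+ 2 - b * (1 - cos nu))) ->
  forall (r : R -> R) (M rho : R), cts r -> 0 <= M -> 0 < rho ->
  (forall s, `|s| <= rho -> `|r s| <= M * s ^+ 2) ->
  exists2 K : R, 0 < K & exists2 d0 : R, 0 < d0 &
  forall (x y : R -> R) (d : R), 0 < d -> d <= d0 -> cts x -> cts y ->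
  (forall t, - 1 <= t <= 0 -> `|x t| <= d) -> `|y 0| <= d ->
  (forall t, 0 < t -> der x t (y t) /\
     der y t (h * y t + b * (x (t - 1) - x t) + r (x (t - 1) - x t))) ->
  forall t, 0 <= t -> `|x t| <= K * d /\ `|y t| <= K * d.
Proof.
move=> h0 hb g0 e0 ebh coercive r M rho cr M0 rho0 hr.
(* on a smaller interval the remainder is small against the coercivity constant *)
pose rho1 := Num.min rho (e / (4 * (M + 1))).
have M1 : 0 < 4 * (M + 1) by lra.
have rho10 : 0 < rho1 by rewrite lt_min rho0 divr_gt0.
have Mrho : M * rho1 <= e / 4.
  have : rho1 <= e / (4 * (M + 1)) by rewrite ge_min lexx orbT.
  by rewrite ler_pdivlMr//; lra.
have hr1 s : `|s| <= rho1 -> `|r s| <= M * s ^+ 2.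
  by move=> sr; apply: hr; apply: le_trans sr _; rewrite ge_min lexx.
clearbody rho1.
have bound (z : (R -> R) -> (R -> R) -> R -> R) :
    (exists c c' : R, forall (x y : R -> R) (d : R), 0 < d -> d <= 1 -> 2 * d <= rho1 ->
      c * d < rho1 -> cts x -> cts y ->
      (forall t, -1 <= t <= 0 -> `|x t| <= d) -> `|y 0| <= d ->
      (forall t, 0 < t -> der x t (y t)) ->
      (forall t, 0 < t -> der y t (h * y t + b * (x (t - 1) - x t) + r (x (t - 1) - x t))) ->
      forall t, 0 <= t -> `|z x y t| <= c' * d) ->
    exists2 K : R, 0 < K & exists2 d0 : R, 0 < d0 &
    forall (x y : R -> R) (d : R), 0 < d -> d <= d0 -> cts x -> cts y ->
    (forall t, - 1 <= t <= 0 -> `|x t| <= d) -> `|y 0| <= d ->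
    (forall t, 0 < t -> der x t (y t) /\
       der y t (h * y t + b * (x (t - 1) - x t) + r (x (t - 1) - x t))) ->
    forall t, 0 <= t -> `|z x y t| <= K * d.
  move=> [c [c' hz]]; exists (`|c'| + 1); first by rewrite ltr_wpDl.
  exists (Num.min (Num.min 1 (rho1 / 2)) (rho1 / (`|c| + 1))).
    by rewrite !lt_min ltr01 !divr_gt0// ltr_wpDl.
  move=> x y d d0; rewrite !le_min => /andP[/andP[d1 d2] d3] cx cy hx hy hd t t0.
  have c1 : 0 < `|c| + 1 by rewrite ltr_wpDl.
  rewrite ler_pdivlMr// in d3; rewrite ler_pdivlMr// in d2.
  have cd : c * d <= `|c| * d by rewrite ler_pM2r// ler_norm.
  apply: le_trans (hz x y d d0 d1 _ _ cx cy hx hy _ _ t t0) _.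
  - by rewrite mulrC.
  - lra.
  - by move=> w w0; exact: (hd w w0).1.
  - by move=> w w0; exact: (hd w w0).2.
  - by rewrite ler_pM2r//; have := ler_norm c'; lra.
have [|K1 K10 [d1 d10 xb]] := bound (fun x y => x).
  do 2 eexists; exact: (@x_bound R h b g e h0 hb g0 e0 ebh coercive r M rho1 cr M0 Mrho hr1).
have [|K2 K20 [d2 d20 yb]] := bound (fun x y => y).
  do 2 eexists; exact: (@y_bound R h b g e h0 hb g0 e0 ebh coercive r M rho1 cr M0 Mrho hr1).
exists (K1 + K2); first exact: addr_gt0.
exists (Num.min d1 d2); first by rewrite lt_min d10.
move=> x y d d0; rewrite le_min => /andP[dd1 dd2] cx cy hx hy hd t t0.
have := xb x y d d0 dd1 cx cy hx hy hd t t0; have := yb x y d d0 dd2 cx cy hx hy hd t t0.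
by rewrite mulrDl; have := mulr_gt0 K10 d0; have := mulr_gt0 K20 d0; split; lra.
Qed.
End StabilityCore.

(** * Existence of solutions *)

Section Existence.
Context {R : realType}.

Lemma geometric_limit (a : nat -> R) (A : R) :
  (forall n, `|a n.+1 - a n| <= A / 2 ^+ n) ->
  exists l, forall n, `|l - a n| <= 2 * A / 2 ^+ n.
Proof.
move=> ha.
pose L n := a n - 2 * A / 2 ^+ n; pose U n := a n + 2 * A / 2 ^+ n.
have p2 n : 0 < 2 ^+ n :> R by rewrite exprn_gt0.
have halve n : 2 * A / 2 ^+ n.+1 = A / 2 ^+ n.
  by rewrite exprS; field; rewrite gt_eqF.
have twice n : 2 * A / 2 ^+ n = A / 2 ^+ n + A / 2 ^+ n.
  by field; rewrite gt_eqF.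
have Lincr : {homo L : m n / (m <= n)%N >-> m <= n}.
  apply: homo_leq => //; first by move=> ? ? ?; exact: le_trans.
  move=> n; rewrite /L halve twice; have := ha n; rewrite ler_norml => /andP[]; lra.
have Udecr : {homo U : m n / (m <= n)%N >-> n <= m}.
  apply: homo_leq => //; first by move=> ? ? ? h1 h2; exact: le_trans h2 h1.
  move=> n; rewrite /U halve twice; have := ha n; rewrite ler_norml => /andP[]; lra.
have A0 n : 0 <= 2 * A / 2 ^+ n.
  have : 0 <= A by have := ha 0%N; rewrite expr0 divr1; exact: le_trans.
  by move=> A0; rewrite divr_ge0 ?mulr_ge0// ltW.
have LU m n : L m <= U n.
  have [mn|nm] := leqP m n.
    by apply: le_trans (Lincr _ _ mn) _; rewrite /L /U; have := A0 n; lra.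
  by apply: le_trans (Udecr _ _ (ltnW nm)); rewrite /L /U; have := A0 m; lra.
have Lub : has_ubound (range L) by exists (U 0%N) => _ [n _ <-].
have Ls : has_sup (range L) by split => //; exists (L 0%N); exists 0%N.
exists (sup (range L)) => n; rewrite ler_norml; apply/andP; split.
  have : L n <= sup (range L) by apply: (ub_le_sup Lub); exists n.
  rewrite /L; lra.
have : sup (range L) <= U n.
  by apply: ge_sup => [|_ [m _ <-]//]; exists (L 0%N); exists 0%N.
rewrite /U; lra.
Qed.

Variables (h l dl : R) (G : R -> R).
Hypotheses (h0 : 0 <= h) (l0 : 0 <= l) (G0 : G 0 = 0).
Hypothesis lipG : forall s t, `|G s - G t| <= l * `|s - t|.

(** In the norm weighted by e ^ (- growth_rate t), the Picard operator contracts
    by the factor 1/2. *)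
Definition growth_rate := 2 * h + 4 * l + 1.
Let lam := growth_rate.
Let lam1 : 1 <= lam. Proof. by rewrite /lam /growth_rate; have := h0; have := l0; lra. Qed.
Let lam0 : 0 < lam. Proof. exact: lt_le_trans lam1. Qed.
Let w t := expR (lam * pospart t).
Let cpos := @cts_pospart R.
Let cw : cts w. Proof. by rewrite /w; cont. Qed.
Let w0 t : 0 < w t. Proof. exact: expR_gt0. Qed.
Let pos0 (t : R) : 0 <= pospart t.
Proof. by rewrite /pospart; have := ler_norm (- t); rewrite normrN; lra. Qed.
Let pos_mono (s t : R) : s <= t -> pospart s <= pospart t.
Proof.
move=> st; have [s0|s0] := leP s 0; first by rewrite (pospart_le0 s0) pos0.
by rewrite !pospart_ge0//; lra.
Qed.
Let w_mono s t : s <= t -> w s <= w t.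
Proof. by move=> st; rewrite /w ler_expR ler_pM2l//; exact: pos_mono. Qed.

Let cG : cts G.
Proof.
move=> t; apply/cvgrPdist_lt => eps eps0.
have l1 : 0 < l + 1 by have := l0; lra.
near=> s; apply: le_lt_trans (lipG _ _) _.
apply: le_lt_trans (_ : (l + 1) * `|t - s| < _); first by rewrite ler_wpM2r//; lra.
rewrite mulrC -ltr_pdivlMr//.
near: s; exists (eps / (l + 1)) => //=; exact: divr_gt0.
Unshelve. all: by end_near.
Qed.

(* pospart t = 0 for t <= 0 makes the initial segment x = 0, y = dl automatic *)
Let X (y : R -> R) (t : R) : R := intg y 0 (pospart t).
Let Psi (y : R -> R) (t : R) : R := dl + intg (fun s => h * y s + G (X y (s - 1) - X y s)) 0 (pospart t).

Let cX y : cts y -> cts (X y). Proof. by move=> cy; rewrite /X; cont. Qed.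
Let cF y : cts y -> cts (fun s => h * y s + G (X y (s - 1) - X y s)).
Proof. by move=> cy; have cXy := cX cy; cont. Qed.
Let cPsi y : cts y -> cts (Psi y).
Proof. by move=> cy; have cFy := cF cy; have cXy := cX cy; rewrite /Psi; cont. Qed.

Let int_w t : intg (fun s => expR (lam * s)) 0 (pospart t) <= w t / lam.
Proof.
rewrite (@intg_FTC _ _ (fun s => expR (lam * s) / lam)); last 2 first.
- by cont.
- by move=> s; derv; field; rewrite gt_eqF.
by rewrite -/(w t) lerBlDr lerDl divr_ge0// ?ltW// expR_gt0.
Qed.

Let intg_le_w f K t : cts f -> 0 <= K -> (forall s, 0 <= s -> `|f s| <= K * w s) ->
  `|intg f 0 (pospart t)| <= K / lam * w t.
Proof.
move=> cf K0 hf; apply: le_trans (_ : intg (fun s => K * expR (lam * s)) 0 (pospart t) <= _).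
  apply: norm_intg_le; [by []|by cont|exact: pos0|].
  by move=> s /andP[s0 _]; have := hf s s0; rewrite /w pospart_ge0.
rewrite intgZ; last by cont.
by rewrite -mulrA [_ * w t]mulrC ler_wpM2l.
Qed.

Let Psi_contract y1 y2 K : cts y1 -> cts y2 -> 0 <= K ->
  (forall t, `|y1 t - y2 t| <= K * w t) ->
  forall t, `|Psi y1 t - Psi y2 t| <= K / 2 * w t.
Proof.
move=> c1 c2 K0 hy t.
have cF1 := cF c1; have cF2 := cF c2; have cX1 := cX c1; have cX2 := cX c2.
rewrite /Psi opprD addrACA subrr add0r -intgB//.
have hX s : `|X y1 s - X y2 s| <= K / lam * w s.
  by rewrite /X -intgB//; apply: intg_le_w => //; cont.
apply: le_trans (@intg_le_w _ (K * (lam / 2)) t _ _ _) _.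
- by cont.
- by rewrite mulr_ge0// divr_ge0// ltW.
- move=> s s0.
  rewrite (_ : _ - _ = h * (y1 s - y2 s) + (G (X y1 (s - 1) - X y1 s) - G (X y2 (s - 1) - X y2 s))); last by ring.
  apply: le_trans (ler_normD _ _) _.
  have a1 : `|h * (y1 s - y2 s)| <= h * (K * w s).
    by apply: norm_mul_le (hy s); rewrite ger0_norm.
  have a2 : `|G (X y1 (s - 1) - X y1 s) - G (X y2 (s - 1) - X y2 s)| <= l * (2 * (K * w s)).
    apply: le_trans (lipG _ _) _; rewrite ler_wpM2l//.
    rewrite (_ : _ - _ = (X y1 (s - 1) - X y2 (s - 1)) - (X y1 s - X y2 s)); last by ring.
    apply: le_trans (ler_normB _ _) _.
    have Kl : K / lam * w s <= K * w s.
      rewrite ler_wpM2r ?(ltW (w0 _))// ler_pdivrMr// ler_peMr//.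
    have := hX s; have := hX (s - 1).
    have : K / lam * w (s - 1) <= K / lam * w s.
      by rewrite ler_wpM2l ?divr_ge0 ?(ltW lam0)// w_mono//; lra.
    lra.
  have := mulr_ge0 K0 (ltW (w0 s)); rewrite /lam /growth_rate; lra.
- by rewrite (_ : _ / lam = K / 2)//; field; rewrite gt_eqF.
Qed.

Let Yn := fix Yn n : R -> R := if n is m.+1 then Psi (Yn m) else (fun=> dl).

Let cYn n : cts (Yn n).
Proof. by elim: n => [|n ih]; [exact: cts_cst|exact: cPsi]. Qed.

Let Yn_step n t : `|Yn n.+1 t - Yn n t| <= `|dl| / 2 * w t / 2 ^+ n.
Proof.
elim: n t => [|n ih] t.
  rewrite expr0 divr1 /= /Psi addrAC subrr add0r.
  have cc := @cts_cst R dl.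
  apply: le_trans (@intg_le_w _ (`|dl| * (lam / 2)) t _ _ _) _.
  - exact: (cF cc).
  - by rewrite mulr_ge0// divr_ge0// ltW.
  - move=> s s0; apply: le_trans (ler_normD _ _) _.
    have a2 : `|G (X (fun=> dl) (s - 1) - X (fun=> dl) s)| <= l * `|dl|.
      have := lipG (X (fun=> dl) (s - 1) - X (fun=> dl) s) 0; rewrite G0 !subr0 => hG.
      apply: le_trans hG _; rewrite ler_wpM2l//.
      rewrite /X !intg_cst !subr0 -mulrBr normrM ler_piMr//.
      have [s1|s1] := leP s 1.
        by rewrite (@pospart_le0 R (s - 1)) ?sub0r ?normrN ?ger0_norm ?pospart_ge0//; lra.
      by rewrite !pospart_ge0; [rewrite addrAC subrr add0r normrN1|lra|lra].
    have a1 : `|h * dl| = h * `|dl| by rewrite normrM ger0_norm.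
    rewrite a1; have w1 : 1 <= w s.
      by rewrite /w -[leLHS]expR0 ler_expR mulr_ge0// ltW.
    have : `|dl| * (lam / 2) <= `|dl| * (lam / 2) * w s.
      by rewrite ler_peMr// mulr_ge0// divr_ge0// ltW.
    have := normr_ge0 dl; have := mulr_ge0 l0 (normr_ge0 dl).
    rewrite /lam /growth_rate; lra.
  - by rewrite (_ : _ / lam = `|dl| / 2)//; field; rewrite gt_eqF.
have p2 : 0 < 2 ^+ n :> R by rewrite exprn_gt0.
have K0 : 0 <= `|dl| / 2 / 2 ^+ n by apply: divr_ge0; [exact: divr_ge0|exact: ltW].
have ih' s : `|Yn n.+1 s - Yn n s| <= `|dl| / 2 / 2 ^+ n * w s.
  by apply: le_trans (ih s) _; rewrite mulrAC.
apply: le_trans (Psi_contract (@cYn _) (@cYn _) K0 ih' t) _.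
by rewrite exprS le_eqVlt; apply/orP; left; apply/eqP; field; rewrite gt_eqF.
Qed.

(** The Picard iterates of the constant dl converge geometrically in the weighted
    norm, locally uniformly in t. *)
Lemma fixpoint_exists : exists y, [/\ cts y, forall t, y t = Psi y t &
  forall t, `|y t| <= 2 * `|dl| * w t].
Proof.
have p2 n : 0 < 2 ^+ n :> R by rewrite exprn_gt0.
have lims t : exists z, forall n, `|z - Yn n t| <= `|dl| * w t / 2 ^+ n.
  have [z hz] := geometric_limit (fun n => Yn_step n t).
  exists z => n; apply: le_trans (hz n) _.
  by rewrite (_ : 2 * _ / _ = `|dl| * w t / 2 ^+ n)//; field; rewrite gt_eqF.
have [y hy] := choice lims.
have small (A eps : R) : 0 <= A -> 0 < eps -> exists n, A / 2 ^+ n < eps.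
  move=> A0 eps0; exists (Num.bound (A / eps)).
  have := archi_boundP (divr_ge0 A0 (ltW eps0)); set n := Num.bound _ => hn.
  rewrite ltr_pdivrMr// mulrC -ltr_pdivrMr//; apply: lt_trans hn _.
  by rewrite -natrX ltr_nat ltn_expl.
have cy : cts y.
  move=> t; apply/cvgrPdist_lt => eps eps0.
  have [n hn] := @small (`|dl| * w (t + 1)) (eps / 3) (mulr_ge0 (normr_ge0 _) (ltW (w0 _))) ltac:(lra).
  have /cvgrPdist_lt/(_ (eps / 3) ltac:(lra)) hc := @cYn n t.
  near=> s.
  have st : `|t - s| < 1 by near: s; exists 1 => //=.
  have b1 z : z <= t + 1 -> `|y z - Yn n z| < eps / 3.
    move=> zt; apply: le_lt_trans (hy z n) _; apply: le_lt_trans hn.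
    by rewrite ler_pM2r ?invr_gt0// ler_wpM2l// w_mono.
  have h1 := b1 t ltac:(lra).
  have h2 : `|y s - Yn n s| < eps / 3.
    by apply: b1; move: st; rewrite ltr_norml => /andP[]; lra.
  have h3 : `|Yn n t - Yn n s| < eps / 3 by near: s.
  rewrite (_ : y t - y s = (y t - Yn n t) + (Yn n t - Yn n s) - (y s - Yn n s)); last by ring.
  apply: le_lt_trans (ler_normB _ _) _.
  by have := ler_normD (y t - Yn n t) (Yn n t - Yn n s); lra.
exists y; split => //.
- move=> t; apply/eqP; rewrite -subr_eq0 -normr_le0; apply/ler_addgt0Pr => eps eps0.
  rewrite add0r.
  have A0 : 0 <= `|dl| * w t by rewrite mulr_ge0// ltW.
  have [n hn] := small _ _ A0 eps0.
  have K0 : 0 <= `|dl| / 2 ^+ n by rewrite divr_ge0// ltW.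
  have hyn s : `|y s - Yn n s| <= `|dl| / 2 ^+ n * w s by rewrite mulrAC; exact: hy.
  have h1 := Psi_contract cy (@cYn n) K0 hyn t.
  have h2 := hy t n.+1; rewrite /= -/(Psi (Yn n) t) in h2.
  have e1 : `|dl| * w t / 2 ^+ n.+1 = `|dl| * w t / 2 ^+ n / 2.
    by rewrite exprS; field; rewrite gt_eqF.
  have e2 : `|dl| / 2 ^+ n / 2 * w t = `|dl| * w t / 2 ^+ n / 2 by field; rewrite gt_eqF.
  rewrite e1 in h2; rewrite e2 in h1.
  have := ler_distD (Psi (Yn n) t) (y t) (Psi y t).
  rewrite [`|Psi (Yn n) t - _|]distrC; lra.
- move=> t; have := hy t 0%N; rewrite expr0 divr1 /= => h1.
  have w1 : 1 <= w t by rewrite /w -[leLHS]expR0 ler_expR mulr_ge0// ltW.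
  have : `|dl| <= `|dl| * w t by rewrite ler_peMr.
  have := ler_normD (y t - dl) dl; rewrite subrK; lra.
Unshelve. all: by end_near.
Qed.

(** A fixed point y of Psi and its primitive X y solve the equation. *)
Lemma delay_solution_exists : exists x y : R -> R, [/\ cts x, cts y,
  forall t, t <= 0 -> x t = 0 /\ y t = dl,
  forall t, 0 < t -> der x t (y t) /\ der y t (h * y t + G (x (t - 1) - x t)) &
  forall t, 0 <= t -> `|y t| <= 2 * `|dl| * expR (growth_rate * t)].
Proof.
have [y [cy yE yb]] := fixpoint_exists.
have cFy := cF cy; have cXy := cX cy.
exists (X y), y; split => //.
- move=> t t0; split; first by rewrite /X pospart_le0// intgxx.
  by rewrite yE /Psi pospart_le0// intgxx addr0.
- move=> t t0.
  have near_pos : \forall s \near t, 0 < s by exact: lt_nbhsr.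
  split.
    have h1 : is_derive t (1:R) (fun s => intg y 0 s) (y t) by exact: is_derive_intg.
    apply: near_eq_is_derive h1.
    by near=> s; rewrite /X pospart_ge0// ltW//; near: s.
  have h1 : der (fun s => dl + intg (fun s => h * y s + G (X y (s - 1) - X y s)) 0 s) t (h * y t + G (X y (t - 1) - X y t)).
    by derv; ring.
  apply: near_eq_is_derive h1.
  by near=> s; rewrite [RHS]yE /Psi pospart_ge0// ltW//; near: s.
- by move=> t t0; have := yb t; rewrite /w pospart_ge0.
Unshelve. all: by end_near.
Qed.
End Existence.

(** * Variation of constants and exponential growth *)

Section VariationOfConstants.
Context {R : realType}.
Variables (h b : R) (X Y x y k : R -> R).
Hypotheses (cX : cts X) (cY : cts Y) (cx : cts x) (cy : cts y) (ck : cts k).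
Hypothesis past : forall t : R, t <= 0 -> X t = 0.
Hypothesis Y_0 : Y 0 = 1.
Hypothesis past' : forall t : R, t <= 0 -> x t = 0.
Hypothesis dX : forall t : R, 0 < t -> der X t (Y t).
Hypothesis dY : forall t : R, 0 < t -> der Y t (h * Y t + b * (X (t - 1) - X t)).
Hypothesis dx : forall t : R, 0 < t -> der x t (y t).
Hypothesis dy : forall t : R, 0 < t ->
  der y t (h * y t + b * (x (t - 1) - x t) + k t).

(** The derivative of P is Y (T - s) k s minus a term Q whose integral vanishes
    because x and X vanish in the past. *)
Lemma variation_of_constants T : 0 <= T ->
  y T = Y T * y 0 + intg (fun s => Y (T - s) * k s) 0 T.
Proof.
move=> T0.
pose P s := Y (T - s) * y s - b * (X (T - s) * x s).
pose Q s := b * (X (T - s - 1) * y s - Y (T - s) * x (s - 1)).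
have cP : cts P by rewrite /P; cont.
have cQ : cts Q by rewrite /Q; cont.
have dP s : 0 < s < T -> der P s (Y (T - s) * k s - Q s).
  move=> /andP[s0 sT]; rewrite /P /Q.
  have d1 := dx s0; have d2 := dy s0.
  have d3 : der X (T - s) (Y (T - s)) by apply: dX; lra.
  have d4 : der Y (T - s) (h * Y (T - s) + b * (X (T - s - 1) - X (T - s))).
    by apply: dY; lra.
  by derv; ring.
have intQ : intg Q 0 T = 0.
  have [T1|T1] := leP T 1.
    apply: intg_eq0 => // s /andP[s0 sT].
    by rewrite /Q past ?past'; [ring|lra|lra].
  have cA : cts (fun s => X (T - s - 1) * y s) by cont.
  have cB : cts (fun s => Y (T - s) * x (s - 1)) by cont.
  rewrite /Q intgZ; last by cont.
  rewrite intgB//.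
  have -> : intg (fun s => X (T - s - 1) * y s) 0 T =
            intg (fun s => X (T - s - 1) * y s) 0 (T - 1).
    rewrite -(intg_chasles _ (T - 1)) (@intg_eq0 _ _ (T - 1) T)// ?addr0//; first by lra.
    by move=> s /andP[s1 _]; rewrite past ?mul0r//; lra.
  have -> : intg (fun s => Y (T - s) * x (s - 1)) 0 T =
            intg (fun s => Y (T - s - 1) * x s) 0 (T - 1).
    rewrite -(intg_chasles _ 1) (@intg_eq0 _ _ 0 1)// ?add0r; last first.
      by move=> s /andP[_ s1]; rewrite past' ?mulr0//; lra.
    pose q s := Y (T - s - 1) * x s.
    have cq : cts q by rewrite /q; cont.
    have -> : (fun s => Y (T - s) * x (s - 1)) = (fun s => q (s + -1)).
      by apply/funext => s; rewrite /q; congr (Y _ * _); ring.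
    by rewrite intg_shift// subrr.
  rewrite -intgB; [|by cont..].
  rewrite (@intg_FTC_within _ _ (fun s => X (T - s - 1) * x s)).
  - rewrite (past' (lexx 0)) (_ : T - (T - 1) - 1 = 0); last by ring.
    by rewrite (past (lexx 0)) mul0r mulr0 subrr mulr0.
  - by cont.
  - by lra.
  - move=> s /andP[s0 sT]; have d1 := dx s0.
    have d3 : der X (T - s - 1) (Y (T - s - 1)) by apply: dX; lra.
    by derv; ring.
  - by apply: continuous_subspaceT; cont.
have cYk : cts (fun s => Y (T - s) * k s) by cont.
have := @intg_FTC_within _ _ P 0 T _ T0 dP (continuous_subspaceT cP).
move=> /(_ ltac:(by cont)); rewrite intgB// intQ subr0 => ->.
rewrite /P subrr subr0 Y_0 (past (lexx 0)) (past' (lexx 0)); ring.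
Qed.

End VariationOfConstants.

Section Instability.
Context {R : realType}.
Variables (h b mu nu : R).
Hypotheses (mu0 : 0 < mu) (nu0 : 0 <= nu).
(* mu + i nu is a zero of z^2 - h z + b (1 - e^-z) *)
Hypothesis root_re :
  mu ^+ 2 - nu ^+ 2 - h * mu + b * (1 - expR (- mu) * cos nu) = 0.
Hypothesis root_im : 2 * mu * nu - h * nu + b * expR (- mu) * sin nu = 0.

Definition exp_bounded (Y : R -> R) (k : R) :=
  exists2 C, 0 < C & forall t, 0 <= t -> `|Y t| <= C * expR (k * t).

Section Fundamental.
Variables X Y : R -> R.
Hypotheses (cX : cts X) (cY : cts Y).
Hypothesis past : forall t : R, t <= 0 -> X t = 0 /\ Y t = 1.
Hypothesis dXY : forall t : R, 0 < t ->
  der X t (Y t) /\ der Y t (h * Y t + b * (X (t - 1) - X t)).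

(* the real part of the eigensolution e ^ (z t) and of its primitive, z = mu + i nu *)
Let xe (t : R) := expR (mu * t) * (mu * cos (nu * t) + nu * sin (nu * t)) / (mu ^+ 2 + nu ^+ 2).
Let ye (t : R) := expR (mu * t) * cos (nu * t).
Let N0 : 0 < mu ^+ 2 + nu ^+ 2.
Proof. by rewrite ltr_pwDl ?sqr_ge0// exprn_gt0. Qed.

Let dxe t : der xe t (ye t).
Proof. by rewrite /xe /ye; derv; field; rewrite gt_eqF. Qed.

Let dye t : der ye t (h * ye t + b * (xe (t - 1) - xe t)).
Proof.
rewrite /xe /ye; derv.
rewrite (_ : mu * (t - 1) = mu * t + - mu); last by ring.
rewrite (_ : nu * (t - 1) = nu * t - nu); last by ring.
rewrite expRD cosB sinB.
set E := expR (mu * t); set c := cos (nu * t); set s := sin (nu * t).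
set e := expR (- mu); set cn := cos nu; set sn := sin nu.
have re := root_re; have im := root_im; rewrite -/e -/cn -/sn in re im.
apply/eqP; rewrite -subr_eq0; apply/eqP.
rewrite (_ : _ - _ = E / (mu ^+ 2 + nu ^+ 2) *
  (c * (mu * (mu ^+ 2 - nu ^+ 2 - h * mu + b * (1 - e * cn)) + nu * (2 * mu * nu - h * nu + b * e * sn)) +
   s * (nu * (mu ^+ 2 - nu ^+ 2 - h * mu + b * (1 - e * cn)) - mu * (2 * mu * nu - h * nu + b * e * sn)))).
  by rewrite re im; ring.
by field; rewrite gt_eqF.
Qed.

Let cxe : cts xe. Proof. exact: der_cts dxe. Qed.
Let cye : cts ye. Proof. exact: der_cts dye. Qed.
Let cpos := @cts_pospart R.
(* the eigensolution has a nonzero past, which acts on it as a forcing for t <= 1 *)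
Let ke t := b * (xe (t - 1) - xe (pospart (t - 1))).
Let cke : cts ke. Proof. by rewrite /ke; cont. Qed.

Let ye_duhamel T : 0 <= T -> ye T = Y T + intg (fun s => Y (T - s) * ke s) 0 T.
Proof.
move=> T0; pose xt t := xe (pospart t) - xe 0; pose yt t := ye (pospart t).
have := @variation_of_constants R h b X Y xt yt ke cX cY.
have near_pos (t : R) : 0 < t -> \forall s \near t, pospart s = s.
  move=> t0; near=> s; rewrite pospart_ge0// ltW//.
  by near: s; exact: lt_nbhsr.
have cxt : cts xt by rewrite /xt; cont.
have cyt : cts yt by rewrite /yt; cont.
move=> /(_ cxt cyt cke) hv.
rewrite [LHS](_ : _ = yt T); last by rewrite /yt pospart_ge0.
have yt0 : yt 0 = 1 by rewrite /yt pospart_le0// /ye !mulr0 expR0 cos0 mulr1.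
rewrite -[X in X + _]mulr1 -[in X in X + _]yt0; apply: hv; last exact: T0.
- by move=> t /past[].
- by have [] := past (lexx 0).
- by move=> t t0; rewrite /xt pospart_le0// subrr.
- by move=> t /dXY[].
- by move=> t /dXY[].
- move=> t t0; have h1 : der (fun s => xe s - xe 0) t (ye t) by derv; ring.
  rewrite /yt (pospart_ge0 (ltW t0)).
  apply: near_eq_is_derive h1; near=> s; rewrite /xt; congr (xe _ - _).
  by apply/esym; near: s; exact: near_pos.
- move=> t t0; have h1 := dye t.
  rewrite (_ : _ + ke t = h * ye t + b * (xe (t - 1) - xe t)).
    apply: near_eq_is_derive h1; near=> s; rewrite /yt; congr ye.
    by apply/esym; near: s; exact: near_pos.
  by rewrite /yt /xt /ke (pospart_ge0 (ltW t0)); ring.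
Unshelve. all: by end_near.
Qed.

(** By Duhamel's formula a bound on the fundamental solution Y passes to the
    eigensolution, which has size e ^ (mu t) at arbitrarily large times. *)
Lemma exp_bounded_ge_root k : exp_bounded Y k -> mu <= k.
Proof.
move=> [C C0 hC]; rewrite leNgt; apply/negP => kmu.
have [c _ hc] := @EVT_max R (fun t => `|ke t|) 0 1 ler01 (continuous_subspaceT (continuous_norm_fun cke)).
pose A := C + C * expR `|k| * `|ke c|.
have hye T : 1 <= T -> `|ye T| <= A * expR (k * T).
  move=> T1; have T0 : 0 <= T by lra.
  rewrite ye_duhamel//; apply: le_trans (ler_normD _ _) _; rewrite mulrDl.
  apply: lerD; first exact: hC.
  have cYk : cts (fun s => Y (T - s) * ke s) by cont.
  rewrite -(intg_chasles _ 1) (@intg_eq0 _ _ 1 T)// ?addr0; last first.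
    by move=> s /andP[s1 _]; rewrite /ke pospart_ge0 ?subrr ?mulr0//; lra.
  apply: le_trans (_ : intg (fun=> C * expR `|k| * expR (k * T) * `|ke c|) 0 1 <= _).
    apply: norm_intg_le => //; first exact: cts_cst.
    move=> s s01; apply: norm_mul_le; last by apply: hc; rewrite in_itv.
    apply: le_trans (hC _ _) _; first lra.
    rewrite -mulrA -expRD ler_pM2l// ler_expR mulrBr.
    have : - (k * s) <= `|k|; last lra.
    apply: le_trans (ler_norm _) _; rewrite normrN normrM ler_piMr// ger0_norm; lra.
  by rewrite intg_cst subr0 mulr1 mulrAC.
have A0 : 0 < A.
  rewrite /A ltr_pwDl// !mulr_ge0// ltW// expR_gt0.
(* along a sequence of times ye is exactly e^(mu t) *)
have [T [T1 TA cosT]] : exists T, [/\ 1 <= T, A <= (mu - k) * T & cos (nu * T) = 1].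
  have mk : 0 < mu - k by rewrite subr_gt0.
  have m0 : 0 <= 1 + A / (mu - k) by rewrite addr_ge0// divr_ge0// ltW.
  move: nu0; rewrite le_eqVlt => /predU1P[nuE|nupos].
    exists (1 + A / (mu - k)); split.
    - by rewrite lerDl divr_ge0// ltW.
    - rewrite mulrDr mulr1 [_ * (A / _)]mulrC divfK ?gt_eqF//; lra.
    - by rewrite -nuE mul0r cos0.
  pose n := Num.bound ((1 + A / (mu - k)) * nu).
  have hn : (1 + A / (mu - k)) * nu < n%:R by apply: archi_boundP; rewrite mulr_ge0// ltW.
  have cosn j : cos ((pi *+ 2) *+ j) = 1 :> R.
    elim: j => [|j ih]; first by rewrite mulr0n cos0.
    by rewrite mulrS addrC cosD2pi.
  have pi2 := pi_ge2 R.
  have hT : 1 + A / (mu - k) <= (pi *+ 2) *+ n / nu.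
    rewrite ler_pdivlMr//; apply: le_trans (ltW hn) _.
    rewrite -[leRHS]mulr_natr ler_peMl ?ler0n// mulr2n; lra.
  exists ((pi *+ 2) *+ n / nu); split.
  - by apply: le_trans hT; rewrite lerDl divr_ge0// ltW.
  - rewrite mulrC -ler_pdivrMr//; apply: le_trans hT; lra.
  - by rewrite mulrC divfK ?gt_eqF.
have := hye T T1; rewrite /ye cosT mulr1 gtr0_norm ?expR_gt0// => hT.
have : expR ((mu - k) * T) <= A.
  rewrite mulrBl expRD -(@ler_pM2r _ (expR (k * T))) ?expR_gt0//.
  by rewrite -mulrA -expRD addNr expR0 mulr1.
by have := expR_ge1Dx ((mu - k) * T); lra.
Qed.

(** Rates of Y are bounded below by mu > 0, so the geometric sequence starting at
    a known rate leaves the set of rates. The ratio 3/5 only has to exceed 1/2: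
    the quadratic remainder then grows faster than Y. *)
Lemma critical_rate lam : exp_bounded Y lam ->
  exists k, [/\ 0 < k, exp_bounded Y k & ~ exp_bounded Y (3 / 5 * k)].
Proof.
move=> hlam.
pose S n := exp_bounded Y (lam * (3 / 5) ^+ n).
have [n Sn] : exists n, ~ S n.
  have lam0 : 0 < lam by apply: lt_le_trans (exp_bounded_ge_root hlam).
  have [n hn] : exists n, lam * (3 / 5) ^+ n < mu.
    exists (2 * Num.bound (lam / mu))%N.
    have := archi_boundP (divr_ge0 (ltW lam0) (ltW mu0)); set m := Num.bound _ => hm.
    rewrite exprM.
    apply: le_lt_trans (_ : lam * 2^-1 ^+ m < _).
      rewrite ler_pM2l// lerXn2r ?nnegrE//; rewrite ?exprn_ge0//; lra.
    rewrite exprVn ltr_pdivrMr ?exprn_gt0// mulrC -ltr_pdivrMr//.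
    by apply: lt_trans hm _; rewrite -natrX ltr_nat ltn_expl.
  by exists n => /exp_bounded_ge_root; lra.
elim: n Sn => [|n ih] Sn.
  by case: Sn; rewrite /S expr0 mulr1.
have [Sn'|/ih//] := pselect (S n).
exists (lam * (3 / 5) ^+ n); split => //.
- exact: lt_le_trans (exp_bounded_ge_root Sn').
- by rewrite mulrCA -exprS.
Qed.
End Fundamental.
End Instability.

(** * Nonlinear instability from an unstable root *)

Section NonlinearInstability.
Context {R : realType}.
Variables (h b mu nu : R).
Hypotheses (h0 : 0 <= h) (mu0 : 0 < mu) (nu0 : 0 <= nu).
Hypothesis root_re :
  mu ^+ 2 - nu ^+ 2 - h * mu + b * (1 - expR (- mu) * cos nu) = 0.
Hypothesis root_im : 2 * mu * nu - h * nu + b * expR (- mu) * sin nu = 0.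
Variables (r : R -> R) (M rho : R).
Hypotheses (cr : cts r) (M0 : 0 <= M) (rho0 : 0 < rho).
Hypothesis hr : forall s, `|s| <= rho -> `|r s| <= M * s ^+ 2.

(** Let Y be the fundamental solution of the linear equation, bounded by
    C e ^ (k t) but by no multiple of e ^ (s t), where k / 2 < s < k. At a
    record time tau of |Y t| e ^ (- s t), choose the initial velocity dl so that
    the linear solution dl * Y reaches the size eta at tau. Up to tau it is at
    most eta e ^ (s (t - tau)), so the remainder is of the order of
    eta ^ 2 e ^ (2 s (t - tau)), and as 2 s > k Duhamel's formula turns it into
    a correction of the order of eta ^ 2 at time tau. *)
Lemma instability_core : exists2 eta, 0 < eta & forall d0, 0 < d0 ->
  exists2 dl, 0 < dl < d0 & forall x y : R -> R, cts x -> cts y ->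
    (forall t, t <= 0 -> x t = 0 /\ y t = dl) ->
    (forall t, 0 < t -> der x t (y t) /\
       der y t (h * y t + b * (x (t - 1) - x t) + r (x (t - 1) - x t))) ->
    exists2 t, 0 <= t & eta <= `|y t|.
Proof.
have lipb s t : `|b * s - b * t| <= `|b| * `|s - t| by rewrite -mulrBr normrM.
have [X [Y [cX cY past dXY hY]]] :=
  @delay_solution_exists R h `|b| 1 (fun s => b * s) h0 (normr_ge0 b) (mulr0 b) lipb.
have bnd : exp_bounded Y (growth_rate h `|b|).
  by exists 2 => // t t0; have := hY t t0; rewrite normr1 mulr1.
have [k [k0 [C C0 hC] hs]] := critical_rate mu0 nu0 root_re root_im cX cY past dXY bnd.
pose s := 3 / 5 * k.
have s0 : 0 < s by rewrite /s mulr_gt0.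
have sk : 0 < 2 * s - k by rewrite /s; lra.
have {}hs : ~ exp_bounded Y s by [].
clearbody s.
pose A := 8 * M * C + 1.
have A0 : 0 < A by rewrite /A ltr_wpDl// mulr_ge0 ?mulr_ge0// ltW.
pose eta := Num.min (rho / 2) ((2 * s - k) / A).
have eta0 : 0 < eta by rewrite /eta lt_min !divr_gt0.
have eta1' : eta <= rho / 2 by rewrite /eta ge_min lexx.
have eta1 : 2 * eta <= rho by lra.
have eta2 : 8 * M * C * eta <= 2 * s - k.
  have : eta * A <= 2 * s - k by rewrite -ler_pdivlMr// /eta ge_min lexx orbT.
  by rewrite /A; lra.
exists (eta / 2); first by rewrite divr_gt0.
move=> d0 d00.
pose B := eta / d0.
have B0 : 0 < B by rewrite /B divr_gt0.
(* the record is made large enough for dl to be smaller than d0 *)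
have [T [T0 hT]] : exists T, 0 <= T /\ B * expR (s * T) < `|Y T|.
  apply: contrapT => hno; apply: hs; exists B => // t t0.
  by rewrite leNgt; apply/negP => ht; apply: hno; exists t.
have cm : cts (fun t => `|Y t| * expR (- (s * t))) by cont.
have [tau tauT hmax] := @EVT_max R _ 0 T T0 (continuous_subspaceT cm).
move: tauT; rewrite in_itv/= => /andP[tau0 tauT].
have Ytau : B < `|Y tau|.
  have h1 := hmax T; rewrite in_itv/= T0 lexx in h1; have {}h1 := h1 isT.
  have h2 : B < `|Y T| * expR (- (s * T)).
    by rewrite expRN ltr_pdivlMr ?expR_gt0.
  apply: lt_le_trans h2 _; apply: le_trans h1 _; rewrite ler_piMr//.
  by rewrite -[leRHS]expR0 ler_expR oppr_le0 mulr_ge0// ltW.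
have Yt0 : 0 < `|Y tau| by exact: lt_trans Ytau.
have record t : 0 <= t <= tau -> `|Y t| <= `|Y tau| * expR (s * (t - tau)).
  move=> /andP[t0 tt]; have := hmax t.
  rewrite in_itv/= t0 (le_trans tt)// => /(_ isT) h1.
  have := ler_wpM2r (expR_ge0 (s * t)) h1.
  rewrite -!mulrA -!expRD addNr expR0 mulr1.
  by rewrite (_ : - (s * tau) + s * t = s * (t - tau)); last by ring.
pose dl := eta / `|Y tau|.
have dl0 : 0 < dl by rewrite /dl divr_gt0.
exists dl.
  by rewrite dl0/= /dl ltr_pdivrMr// mulrC -ltr_pdivrMr.
move=> x y cx cy pastxy dxy.
have ck : cts (fun t => r (x (t - 1) - x t)) by cont.
have duh t : 0 <= t -> y t = Y t * dl + intg (fun z => Y (t - z) * r (x (z - 1) - x z)) 0 t.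
  move=> t0; have [_ <-] := pastxy 0 (lexx _).
  apply: (@variation_of_constants R h b X Y x y (fun t => r (x (t - 1) - x t))) => //.
  - by move=> z /past[].
  - by have [] := past 0 (lexx _).
  - by move=> z /pastxy[].
  - by move=> z /dXY[].
  - by move=> z /dXY[].
  - by move=> z /dxy[].
  - by move=> z /dxy[].
(* the solution follows the linear one up to time tau *)
have step t : 0 <= t <= tau ->
    (forall z, 0 <= z <= t -> `|y z| * expR (s * (tau - z)) <= 2 * eta) ->
    `|intg (fun z => Y (t - z) * r (x (z - 1) - x z)) 0 t| <= eta / 2 * expR (s * (t - tau)).
  move=> /andP[t0 tt] hz.
  have hy z : 0 <= z <= t -> `|y z| <= 2 * eta * expR (s * (z - tau)).
    move=> zt; rewrite -ler_pdivrMr ?expR_gt0// -expRN.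
    by rewrite (_ : - (s * (z - tau)) = s * (tau - z)); [exact: hz|ring].
  have hD z : 0 <= z <= t -> `|x (z - 1) - x z| <= 2 * eta * expR (s * (z - tau)).
    move=> /andP[z0 zt]; pose m := Num.max 0 (z - 1).
    have m0 : 0 <= m by rewrite /m le_max lexx.
    have mz : m <= z by rewrite /m ge_max z0; lra.
    have xm : x (z - 1) = x m.
      rewrite /m; have [h1|h1] := leP 0 (z - 1); first by [].
      by rewrite (pastxy _ (ltW h1)).1 (pastxy 0 (lexx _)).1.
    rewrite xm distrC -(@intg_FTC_within _ y x m z)//; last 2 first.
    - by move=> w /andP[mw _]; have [] := dxy w (le_lt_trans m0 mw).
    - exact: continuous_subspaceT.
    apply: le_trans (_ : intg (fun=> 2 * eta * expR (s * (z - tau))) m z <= _).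
      apply: norm_intg_le => //; first exact: cts_cst.
      move=> w /andP[mw wz]; apply: le_trans (hy w _) _.
        by rewrite (le_trans m0)// (le_trans wz).
      rewrite ler_pM2l ?mulr_gt0// ler_expR ler_pM2l//; lra.
    have zm : z - 1 <= m by rewrite /m le_max lexx orbT.
    rewrite intg_cst ler_piMr//; last by lra.
    by rewrite mulr_ge0 ?expR_ge0// mulr_ge0// ltW.
  have hrD z : 0 <= z <= t -> `|r (x (z - 1) - x z)| <= 4 * M * eta ^+ 2 * expR (2 * s * (z - tau)).
    move=> zt; have h1 := hD z zt.
    have ez : expR (s * (z - tau)) <= 1.
      rewrite -[leRHS]expR0 ler_expR pmulr_rle0//; lra.
    have h2 : `|x (z - 1) - x z| <= rho.
      apply: le_trans h1 _; apply: le_trans eta1.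
      by rewrite ler_piMr// mulr_ge0// ltW.
    apply: le_trans (hr h2) _.
    have h3 : (x (z - 1) - x z) ^+ 2 <= (2 * eta * expR (s * (z - tau))) ^+ 2.
      rewrite -[(x _ - _) ^+ 2]real_normK ?num_real// ler_pXn2r ?nnegrE//.
      by rewrite !mulr_ge0 ?(ltW eta0)// ltW// expR_gt0.
    apply: le_trans (ler_wpM2l M0 h3) _.
    rewrite (_ : expR (2 * s * (z - tau)) = expR (s * (z - tau)) ^+ 2); last first.
      by rewrite expr2 -expRD; congr expR; ring.
    by rewrite le_eqVlt; apply/orP; left; apply/eqP; ring.
  pose K := 4 * M * C * eta ^+ 2 * expR (k * t - 2 * s * tau).
  have K0 : 0 <= K.
    by rewrite /K !mulr_ge0 ?sqr_ge0// ltW// expR_gt0.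
  apply: le_trans (_ : intg (fun z => K * expR ((2 * s - k) * z)) 0 t <= _).
    apply: norm_intg_le; [by cont|by cont|by []|].
    move=> z /andP[z0 zt].
    have h1 : `|Y (t - z)| <= C * expR (k * (t - z)) by apply: hC; lra.
    apply: le_trans (norm_mul_le h1 (hrD z _)) _; first by rewrite z0.
    rewrite /K -[leRHS]mulrA -expRD.
    rewrite (_ : k * t - 2 * s * tau + (2 * s - k) * z = k * (t - z) + 2 * s * (z - tau)); last by ring.
    by rewrite expRD le_eqVlt; apply/orP; left; apply/eqP; ring.
  rewrite intgZ; last by cont.
  rewrite (@intg_FTC _ _ (fun z => expR ((2 * s - k) * z) / (2 * s - k))); last 2 first.
  - by cont.
  - by move=> z; derv; field; rewrite gt_eqF.
  apply: le_trans (_ : K * (expR ((2 * s - k) * t) / (2 * s - k)) <= _).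
    rewrite ler_wpM2l// lerBlDr lerDl divr_ge0 ?ltW// expR_gt0//.
  rewrite mulrA ler_pdivrMr// /K -mulrA -expRD.
  rewrite (_ : k * t - 2 * s * tau + (2 * s - k) * t = s * (t - tau) + s * (t - tau)); last by ring.
  rewrite expRD.
  set e := expR (s * (t - tau)).
  have e0 : 0 < e by exact: expR_gt0.
  have e1 : e <= 1.
    rewrite /e -[leRHS]expR0 ler_expR pmulr_rle0//; lra.
  apply: le_trans (_ : 4 * M * C * eta ^+ 2 * e <= _).
    rewrite ler_wpM2l//; first by rewrite !mulr_ge0 ?sqr_ge0// ltW.
    by rewrite ler_piMr// ltW.
  have := ler_wpM2r (ltW (mulr_gt0 eta0 e0)) eta2.
  rewrite expr2; lra.
have lin t : 0 <= t <= tau -> `|Y t * dl| <= eta * expR (s * (t - tau)).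
  move=> ht; rewrite normrM (gtr0_norm dl0) /dl mulrC -mulrA ler_pM2l//.
  by rewrite mulrC ler_pdivrMr// mulrC; exact: record.
have follow : forall t, 0 <= t <= tau -> `|y t| * expR (s * (tau - t)) <= 2 * eta.
  apply: (@bootstrap R (fun t => `|y t| * expR (s * (tau - t)))).
  - by cont.
  - rewrite (pastxy 0 (lexx _)).2 subr0 gtr0_norm//.
    have := record 0; rewrite lexx tau0 => /(_ isT).
    rewrite (past 0 (lexx _)).2 normr1 sub0r mulrN expRN ler_pdivlMr ?expR_gt0// mul1r => h1.
    have := ler_wpM2l (ltW dl0) h1; rewrite {2}/dl divfK ?gt_eqF//; lra.
  - move=> t /andP[t0 tt] hz.
    have ht : 0 <= t <= tau by rewrite t0.
    rewrite -ltr_pdivlMr ?expR_gt0// -expRN.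
    rewrite (_ : - (s * (tau - t)) = s * (t - tau)); last by ring.
    rewrite duh//; apply: le_lt_trans (ler_normD _ _) _.
    have h1 := lin t ht; have h2 := step t ht hz.
    have := mulr_gt0 eta0 (expR_gt0 (s * (t - tau))); lra.
exists tau => //.
have tt : 0 <= tau <= tau by rewrite tau0 lexx.
have := step tau tt follow; rewrite subrr mulr0 expR0 mulr1 => h1.
rewrite duh//.
have h2 : `|Y tau * dl| = eta.
  by rewrite normrM (gtr0_norm dl0) /dl mulrC divfK// gt_eqF.
set I := intg _ _ _ in h1 *.
have := ler_normB (Y tau * dl + I) I; rewrite addrK h2; lra.
Qed.
End NonlinearInstability.

(** * Unstable roots of the characteristic equation *)

Section UnstableRoot.
Context {R : realType}.

Lemma sinc_decreasing (x y : R) : 0 < x -> x < y -> y <= pi -> x * sin y < y * sin x.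
Proof.
move=> x0 xy ypi; rewrite -subr_gt0.
have := @der_gt0_lt R (fun t => t * sin x - x * sin t) (fun t => sin x - x * cos t) x y xy.
rewrite subrr; apply; first by move=> t; derv; ring.
move=> t /andP[xt ty].
have h1 : 0 < sin x - x * cos x.
  by apply: sin_sub_mulcos_gt0; rewrite x0/= ltW// (lt_le_trans xy).
have h2 : cos t < cos x.
  by rewrite ltr_cos ?in_itv/=; [|lra|lra].
have : x * cos t < x * cos x by rewrite ltr_pM2l.
lra.
Qed.

Definition sinc (t : R) := if t == 0 then 1 else sin t / t.

Lemma sinc_le1 t : `|sinc t| <= 1.
Proof.
rewrite /sinc; case: eqP => [_|/eqP tn0]; first by rewrite normr1.
rewrite normrM normfV ler_pdivrMr ?normr_gt0// mul1r.
have [t0|t0] := leP 0 t.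
  rewrite ler_norml (ger0_norm t0) sin_le_id// andbT.
  have [tpi|tpi] := leP t pi.
    by apply: le_trans (sin_ge0_pi _); rewrite ?oppr_le0 ?t0.
  by have := sin_geN1 t; have := pi_ge2 R; lra.
have t0' : 0 <= - t by lra.
rewrite -normrN -sinN ler_norml (ltr0_norm t0) sin_le_id// andbT.
have [tpi|tpi] := leP (- t) pi.
  by apply: le_trans (sin_ge0_pi _); rewrite ?t0' ?tpi//; lra.
by have := sin_geN1 (- t); have := pi_ge2 R; lra.
Qed.

Lemma cts_sinc : cts sinc.
Proof.
move=> t; have [->|tn0] := eqVneq t 0; last first.
  have h1 : der (fun s => sin s / s) t (cos t / t - sin t / t ^+ 2).
    by derv => //; field.
  have h2 : der sinc t (cos t / t - sin t / t ^+ 2).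
    apply: near_eq_is_derive h1; near=> s; rewrite /sinc.
    case: eqP => // s0; exfalso; move: s0; apply/eqP.
    have : `|t - s| < `|t| by near: s; exists `|t| => //=; rewrite normr_gt0.
    by apply: contraTneq => ->; rewrite subr0 ltxx.
  exact: is_derive_continuous h2.
apply/cvgrPdist_lt => eps eps0.
near=> s; rewrite /sinc eqxx.
case: eqP => [_|/eqP sn0]; first by rewrite subrr normr0.
have pos (z : R) : 0 < z -> `|1 - sin z / z| <= z ^+ 2 / 6.
  move=> z0; have h1 := sin_ge_cubic (ltW z0); have h2 := sin_le_id (ltW z0).
  rewrite ger0_norm; last by rewrite subr_ge0 ler_pdivrMr// mul1r.
  rewrite lerBlDl -lerBlDr ler_pdivlMr// mulrBl mul1r.
  by rewrite (_ : z ^+ 2 / 6 * z = z ^+ 3 / 6); [lra|ring].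
have h1 : `|1 - sin s / s| <= s ^+ 2 / 6.
  have [s0|s0|s0] := ltgtP s 0; last by move: sn0; rewrite s0 eqxx.
    have := pos (- s) ltac:(lra); rewrite sinN invrN mulrNN sqrrN//.
  exact: pos.
apply: le_lt_trans h1 _.
have s1 : `|0 - s| < Num.min 1 eps.
  by near: s; exists (Num.min 1 eps) => //=; rewrite lt_min ltr01.
rewrite sub0r normrN lt_min in s1; case/andP: s1 => s1 s2.
rewrite -[s ^+ 2]real_normK ?num_real//.
have : `|s| ^+ 2 <= `|s| by rewrite expr2 ler_piMr// ltW.
have := normr_ge0 s; lra.
Unshelve. all: by end_near.
Qed.

(* The imaginary part of the characteristic function at mu + i nu vanishes if
   branch_fun mu = b sinc nu. As branch_fun decreases on [m, +oo[, this defines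
   mu as a function branch of nu, as long as b sinc nu does not exceed
   branch_fun m; beyond, mu is set to m to keep the branch continuous. A root
   is then a zero of branch_re along the branch. *)
Section Branch.
Variables (h b m : R).
Hypotheses (h0 : 0 < h) (b0 : 0 < b) (m0 : 0 <= m) (hm : h / 2 - 1 <= m) (mh : m <= h / 2).

Definition branch_fun (z : R) := (h - 2 * z) * expR z.
Let rr := branch_fun.
Let crr : cts rr. Proof. by rewrite /rr /branch_fun; cont. Qed.

Let rr_decr x y : m <= x -> x < y -> rr y < rr x.
Proof.
move=> mx xy; rewrite -ltrN2.
apply: (@der_gt0_lt R (fun z => - rr z) (fun z => (2 + 2 * z - h) * expR z)) => //.
  by move=> t; rewrite /rr /branch_fun; derv; ring.
by move=> t /andP[xt _]; rewrite mulr_gt0 ?expR_gt0//; have := hm; lra.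
Qed.

Let r0 := rr m.
Let r00 : 0 <= r0.
Proof. by rewrite /r0 /rr /branch_fun mulr_ge0 ?(ltW (expR_gt0 _))//; have := mh; lra. Qed.
(* cap s is the minimum of s and r0 *)
Let cap (s : R) := (s + r0 - `|s - r0|) / 2.
Let ccap : cts cap. Proof. by rewrite /cap; cont. Qed.
Let cap_le s : s <= r0 -> cap s = s.
Proof. by move=> sr; rewrite /cap ler0_norm; lra. Qed.
Let cap_ge s : r0 <= s -> cap s = r0.
Proof. by move=> sr; rewrite /cap ger0_norm; lra. Qed.
Let cap_r0 s : cap s <= r0.
Proof. by have [h1|/ltW h1] := leP s r0; [rewrite cap_le|rewrite (cap_ge h1)]. Qed.

Let branch_ex s : exists z, m <= z /\ rr z = cap s.
Proof.
pose N := m + h / 2 + `|s|.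
have mN : m <= N by rewrite /N; have := h0; have := normr_ge0 s; lra.
have crrN : {within `[m, N], continuous rr} by exact: continuous_subspaceT.
have [|z] := @IVT R rr m N (cap s) mN crrN.
  apply/andP; split; last by rewrite le_max cap_r0.
  rewrite ge_min; apply/orP; right.
  have : rr N <= - `|s|.
    rewrite /rr /branch_fun (_ : h - 2 * N = - (2 * m + 2 * `|s|)); last by rewrite /N; field.
    rewrite mulNr lerN2; apply: le_trans (_ : 2 * m + 2 * `|s| <= _).
      by have := normr_ge0 s; have := m0; lra.
    rewrite ler_peMr//; first by have := normr_ge0 s; have := m0; lra.
    by rewrite -[leLHS]expR0 ler_expR (le_trans m0).
  move=> h1; apply: le_trans h1 _; have [sr|sr] := leP s r0.
    by rewrite cap_le//; have := ler_norm (- s); rewrite normrN; lra.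
  by rewrite cap_ge; [apply: le_trans r00; rewrite oppr_le0|exact: ltW].
by rewrite in_itv/= => /andP[mz _] e; exists z.
Qed.

Let rho s := sval (cid (branch_ex s)).
Let rho_ge s : m <= rho s.
Proof. by rewrite /rho; case: cid => z []. Qed.
Let rhoE s : rr (rho s) = cap s.
Proof. by rewrite /rho; case: cid => z []. Qed.

Let rho_lt s z : m <= z -> rr z < cap s -> rho s < z.
Proof.
move=> mz; rewrite -rhoE => h1; have [//|lt|e] := ltgtP (rho s) z.
  by have := lt_trans h1 (rr_decr mz lt); rewrite ltxx.
by move: h1; rewrite e ltxx.
Qed.
Let rho_gt s z : cap s < rr z -> z < rho s.
Proof.
rewrite -rhoE => h1; have [lt|//|e] := ltgtP (rho s) z.
  by have := lt_trans h1 (rr_decr (rho_ge s) lt); rewrite ltxx.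
by move: h1; rewrite e ltxx.
Qed.

Let crho : cts rho.
Proof.
move=> s; apply/cvgrPdist_lt => eps eps0.
have up : rr (rho s + eps) < cap s by rewrite -rhoE rr_decr// ltrDl.
have /cvgrPdist_lt/(_ (cap s - rr (rho s + eps)) ltac:(by rewrite subr_gt0)) c1 := @ccap s.
have low : \forall t \near s, rho s - eps < rho t.
  have [ms|ms] := ltP (rho s - eps) m.
    by near=> t; exact: lt_le_trans (rho_ge t).
  have dn : cap s < rr (rho s - eps) by rewrite -rhoE rr_decr//; lra.
  have /cvgrPdist_lt/(_ (rr (rho s - eps) - cap s) ltac:(by rewrite subr_gt0)) c2 := @ccap s.
  near=> t; apply: rho_gt.
  have : `|cap s - cap t| < rr (rho s - eps) - cap s by near: t.
  by rewrite distrC; have := ler_norm (cap t - cap s); lra.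
near=> t; rewrite ltr_norml; apply/andP; split.
  have : rho t < rho s + eps; last lra.
  apply: rho_lt; first by have := rho_ge s; lra.
  have : `|cap s - cap t| < cap s - rr (rho s + eps) by near: t.
  by have := ler_norm (cap s - cap t); lra.
have : rho s - eps < rho t by near: t.
lra.
Unshelve. all: by end_near.
Qed.

Definition branch (t : R) : R := rho (b * sinc t).
Definition branch_re (t : R) : R :=
  branch t ^+ 2 - h * branch t - t ^+ 2 + b * (1 - expR (- branch t) * cos t).

Lemma branch_ge t : m <= branch t. Proof. exact: rho_ge. Qed.

Lemma branchE t : b * sinc t <= r0 -> branch_fun (branch t) = b * sinc t.
Proof. by move=> h1; rewrite /branch -/rr rhoE cap_le. Qed.

Lemma branch_cap t : r0 <= b * sinc t -> branch t = m.
Proof.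
move=> h1; apply/eqP; rewrite eq_le rho_ge andbT leNgt; apply/negP => lt.
by have := rr_decr (lexx m) lt; rewrite rhoE cap_ge// ltxx.
Qed.

Lemma branch_uniq t z : m <= z -> branch_fun z = b * sinc t -> branch t = z.
Proof.
move=> mz e; have le0 : b * sinc t <= r0.
  rewrite -e; move: mz; rewrite le_eqVlt => /predU1P[<-//|mz].
  by rewrite ltW// rr_decr.
have e' := branchE le0; have bg := branch_ge t.
have [lt|lt|//] := ltgtP (branch t) z.
  by have := rr_decr bg lt; rewrite /rr e' e ltxx.
by have := rr_decr mz lt; rewrite /rr e' e ltxx.
Qed.

Lemma cts_branch : cts branch.
Proof. by have cs := cts_sinc; have cr : cts rho := crho; rewrite /branch; cont. Qed.

Lemma cts_branch_re : cts branch_re.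
Proof. by have cb := cts_branch; rewrite /branch_re; cont. Qed.

Lemma branch_root_im t : 0 < t -> b * sinc t <= r0 ->
  2 * branch t * t - h * t + b * expR (- branch t) * sin t = 0.
Proof.
move=> t0 /branchE; rewrite /branch_fun /sinc gt_eqF// => e.
have e1 : (h - 2 * branch t) = b * (sin t / t) * expR (- branch t).
  by rewrite -e -mulrA -expRD subrr expR0 mulr1.
have -> : 2 * branch t * t - h * t = - (h - 2 * branch t) * t by ring.
by rewrite e1; field; rewrite gt_eqF.
Qed.
End Branch.

(** For h > 2 either there is a real root, or branch_re is positive at nu = 0;
    it is negative for large nu, and at its first zero the
    branch is a root: where it is capped, branch_re increases. *)
Lemma unstable_root_large (h b : R) : 2 < h -> 0 < b ->
  exists mu nu, [/\ 0 < mu, 0 <= nu,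
    mu ^+ 2 - nu ^+ 2 - h * mu + b * (1 - expR (- mu) * cos nu) = 0 &
    2 * mu * nu - h * nu + b * expR (- mu) * sin nu = 0].
Proof.
move=> h2 b0.
pose Del (z : R) := z ^+ 2 - h * z + b * (1 - expR (- z)).
have cDel : cts Del by rewrite /Del; cont.
have [[z [z0 Dz]]|noroot] := pselect (exists z, 0 < z /\ Del z <= 0).
  have zh : z <= z + h by lra.
  have Dzh : 0 <= Del (z + h).
    rewrite /Del addr_ge0//.
      by rewrite expr2 -mulrBl addrK mulr_ge0//; lra.
    rewrite mulr_ge0 ?(ltW b0)// subr_ge0 -[leRHS]expR0 ler_expR; lra.
  have [|c] := @IVT R Del z (z + h) 0 zh (continuous_subspaceT cDel).
    by rewrite ge_min le_max Dz Dzh orbT.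
  rewrite in_itv/= => /andP[zc _] Dc.
  exists c, 0; split => //; first exact: lt_le_trans zc.
    by rewrite expr0n/= cos0 mulr1 subr0.
  by rewrite sin0 !mulr0 subrr addr0.
have {}noroot z : 0 < z -> 0 < Del z.
  by move=> z0; rewrite ltNge; apply/negP => Dz; apply: noroot; exists z.
pose m := h / 2 - 1.
have h0 : 0 < h by lra.
have m0 : 0 < m by rewrite /m; lra.
have hm : h / 2 - 1 <= m by [].
have mh : m <= h / 2 by rewrite /m; lra.
pose br := @branch h b m h0 (ltW m0) mh.
pose re := @branch_re h b m h0 (ltW m0) mh.
have br_ge t : m <= br t by exact: branch_ge.
have cre : cts re by exact: cts_branch_re.
have cbr : cts br by exact: cts_branch.
have re0 : 0 < re 0.
  rewrite /re /branch_re -/br cos0 mulr1 expr0n subr0; apply: noroot.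
  exact: lt_le_trans (br_ge 0).
pose N := (h / 2 + b) + 2 * b + 1.
have N0 : 0 <= N by rewrite /N; lra.
have reN : 0 <= - re N.
  have br_le : br N <= h / 2 + b.
    rewrite leNgt; apply/negP => lt.
    have bf : branch_fun h (br N) < - b.
      rewrite /branch_fun -ltrN2 opprK -mulNr opprB.
      apply: lt_le_trans (_ : 2 * br N - h <= _); first lra.
      by rewrite ler_peMr -?[leLHS]expR0 ?ler_expR//; lra.
    have := sinc_le1 N; rewrite ler_norml => /andP[s1 _].
    have : - b <= b * sinc N by rewrite -[leLHS]mulr1 mulNr -mulrN ler_pM2l.
    have [le|gt] := leP (b * sinc N) (branch_fun h m).
      by rewrite -(branchE h0 (ltW m0) mh le) -/br; lra.
    by have := branch_cap h0 (ltW m0) hm mh (ltW gt); rewrite -/br; lra.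
  rewrite /re /branch_re -/br oppr_ge0.
  have bm := br_ge N.
  have e0 : expR (- br N) <= 1 by rewrite -[leRHS]expR0 ler_expR; lra.
  have e1 : - 1 <= expR (- br N) * cos N.
    have : `|expR (- br N) * cos N| <= 1 * 1.
      by apply: norm_mul_le; [rewrite gtr0_norm ?expR_gt0|exact: cos_max].
    by rewrite mulr1 ler_norml => /andP[].
  have e2 : b * (1 - expR (- br N) * cos N) <= b * 2 by rewrite ler_pM2l//; lra.
  have e3 : br N ^+ 2 <= (h / 2 + b) ^+ 2.
    by rewrite ler_pXn2r// ?nnegrE; lra.
  have e4 : 0 <= h * br N by rewrite mulr_ge0//; lra.
  have e5 : (h / 2 + b) ^+ 2 + b * 2 <= N ^+ 2.
    have p1 : 0 <= (h / 2 + b) * (2 * b + 1) by rewrite mulr_ge0//; lra.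
    have p2 := sqr_ge0 (2 * b).
    rewrite /N (_ : (_ + 1) ^+ 2 = (h / 2 + b) ^+ 2 + 2 * ((h / 2 + b) * (2 * b + 1)) + ((2 * b) ^+ 2 + 4 * b + 1)); last by ring.
    lra.
  lra.
have cre' : cts (fun t => - re t) by cont.
have [||c [c0 cN rec lt]] := @first_crossing R _ 0 N cre' N0 => //; first by rewrite oppr_lt0.
have {}rec : re c = 0 by lra.
have {}lt t : 0 <= t < c -> 0 < re t by move=> /lt; rewrite oppr_lt0.
have [le|gt] := leP (b * sinc c) (branch_fun h m).
  exists (br c), c; split.
  - exact: lt_le_trans (br_ge c).
  - exact: ltW.
  - by rewrite -rec /re /branch_re -/br; ring.
  - exact: branch_root_im.
exfalso.
have csn : cts (fun t => b * sinc t) by have cs := cts_sinc; cont.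
have /cvgrPdist_lt/(_ (b * sinc c - branch_fun h m) ltac:(by rewrite subr_gt0)) := csn c.
rewrite -filter_from_ballE => -[d /= d0 hd].
pose t := Num.max (c / 2) (c - d / 2).
have t0 : 0 < t by rewrite /t lt_max divr_gt0.
have tc : t < c by rewrite /t gt_max; apply/andP; split; lra.
have td : c - d < t.
  have : c - d / 2 <= t by rewrite /t le_max lexx orbT.
  lra.
have capped s : t <= s <= c -> branch_fun h m < b * sinc s.
  move=> /andP[ts sc]; have := hd s.
  rewrite /ball/= ger0_norm ?subr_ge0// => /(_ ltac:(lra)).
  by have := ler_norm (b * sinc c - b * sinc s); lra.
have reE s : t <= s <= c -> re s = m ^+ 2 - h * m - s ^+ 2 + b * (1 - expR (- m) * cos s).
  move=> /capped hs; rewrite /re /branch_re.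
  by rewrite (branch_cap h0 (ltW m0) hm mh (ltW hs)).
have := lt t; rewrite tc (ltW t0) => /(_ isT).
suff : re t < re c by rewrite rec; lra.
rewrite !reE ?lexx ?(ltW tc)//.
apply: (@der_gt0_lt R (fun s => m ^+ 2 - h * m - s ^+ 2 + b * (1 - expR (- m) * cos s))
   (fun s => b * expR (- m) * sin s - 2 * s)) => //.
  by move=> s; derv; ring.
move=> s /andP[ts sc]; have s0 : 0 < s by exact: lt_trans ts.
have := capped s; rewrite (ltW ts) (ltW sc) => /(_ isT).
rewrite /sinc gt_eqF// /branch_fun (_ : h - 2 * m = 2); last by rewrite /m; field.
rewrite mulrA ltr_pdivlMr// => hs.
have : 2 * s * (expR m * expR (- m)) < b * sin s * expR (- m).
  by rewrite mulrA ltr_pM2r ?expR_gt0// mulrAC.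
by rewrite -expRD subrr expR0; lra.
Qed.
End UnstableRoot.

Section UnstableRootSmall.
Context {R : realType}.
Implicit Types h b a t : R.

(** The branch with m = 0 starts on the imaginary axis at the first solution n of
    b sin n = h n. Being above the critical curve means that branch_re is
    positive there; the branch then runs in the open right half-plane up to a
    point N where branch_re is negative. *)
Lemma unstable_root_small h b : 0 < h -> h <= 2 -> h < b ->
  (h < 2 -> exists a, [/\ 0 < a < pi, h = critical_h a & critical_b a < b]) ->
  exists mu nu, [/\ 0 < mu, 0 <= nu,
    mu ^+ 2 - nu ^+ 2 - h * mu + b * (1 - expR (- mu) * cos nu) = 0 &
    2 * mu * nu - h * nu + b * expR (- mu) * sin nu = 0].
Proof.
move=> h0 h2 hb above.
have b0 : 0 < b by lra.
have pi0 := pi_gt0 R; have pi2 := pi_ge2 R.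
have m0 : 0 <= 0 :> R by [].
have hm : h / 2 - 1 <= 0 by lra.
have mh : 0 <= h / 2 by lra.
have bf0 : branch_fun h 0 = h by rewrite /branch_fun mulr0 subr0 expR0 mulr1.
pose br := @branch R h b 0 h0 m0 mh.
pose re := @branch_re R h b 0 h0 m0 mh.
have cre : cts re by exact: cts_branch_re.
have cs := @cts_sinc R.
have csn : cts (fun t => b * sinc t) by cont.
have br_cap t : b * sinc t = h -> br t = 0.
  by move=> e; apply: branch_cap => //; rewrite bf0 e.
have re_cap t : b * sinc t = h -> re t = - t ^+ 2 + b * (1 - cos t).
  move=> /br_cap e; rewrite /re /branch_re -/br e oppr0 expR0; ring.
have cs1 : cts (fun t => h - b * sinc t) by cont.
have [|||n [n0' npi en _]] := @first_crossing R _ 0 pi cs1.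
- exact: ltW.
- by rewrite /sinc eqxx; lra.
- by rewrite /sinc gt_eqF// sinpi mul0r mulr0 subr0 ltW.
have {}en : b * sinc n = h by lra.
have npi' : n < pi.
  rewrite lt_neqAle npi andbT; apply/eqP => e.
  by move: en; rewrite e /sinc gt_eqF// sinpi mul0r mulr0; lra.
have sn0 : 0 < sin n by apply: sin_gt0_pi; rewrite n0' npi'.
have en' : b * sin n = h * n.
  by rewrite -en /sinc gt_eqF//; field; rewrite gt_eqF.
have ren : 0 < re n.
  rewrite re_cap//.
  have cn0 : 0 < 1 - cos n by apply: onemcos_gt0; rewrite n0'.
  have : critical_h n < h.
    move: h2; rewrite le_eqVlt => /predU1P[->|/above[a [/andP[a0 api] ha ba]]].
      by apply: critical_h_lt2; rewrite n0'.
    have ca0 : 0 < 1 - cos a by apply: onemcos_gt0; rewrite a0 ltW.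
    have sa0 : 0 < sin a by apply: sin_gt0_pi; rewrite a0 api.
    rewrite [ltRHS]ha; apply: critical_h_decreasing => //.
    rewrite ltNge; apply/negP => na.
    have : n * sin a <= a * sin n.
      move: na; rewrite le_eqVlt => /predU1P[->//|na].
      by apply/ltW/sinc_decreasing => //; exact: ltW.
    move=> h3; have h4 := ler_wpM2l (ltW b0) h3.
    have h5 : a ^+ 2 < b * (1 - cos a) by rewrite -ltr_pdivrMr.
    have h6 : h * (1 - cos a) = a * sin a by rewrite ha /critical_h divfK// gt_eqF.
    have h7 : b * (n * sin a) <= a * (h * n) by rewrite -en'; lra.
    have h8 : b * sin a <= a * h.
      by rewrite -(ler_pM2l n0'); lra.
    have h9 : b * sin a * (1 - cos a) <= a * h * (1 - cos a) by rewrite ler_pM2r.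
    have h10 : sin a * a ^+ 2 < sin a * (b * (1 - cos a)) by rewrite ltr_pM2l.
    have h11 : a * (h * (1 - cos a)) = a * (a * sin a) by rewrite h6.
    lra.
  rewrite /critical_h ltr_pdivrMr// => h3.
  have : n ^+ 2 * sin n < b * (1 - cos n) * sin n; last by rewrite ltr_pM2r//; lra.
  have h4 : n * (n * sin n) < n * (h * (1 - cos n)) by rewrite ltr_pM2l.
  have h5 : b * sin n * (1 - cos n) = h * n * (1 - cos n) by rewrite en'.
  lra.
have unbroken t : n < t -> t <= 2 * pi -> b * sinc t < h.
  move=> nt t2; have t0 : 0 < t by lra.
  rewrite /sinc gt_eqF// mulrA ltr_pdivrMr//.
  have [tpi|tpi] := leP t pi.
    have h3 := sinc_decreasing n0' nt tpi.
    have h4 : b * (n * sin t) < b * (t * sin n) by rewrite ltr_pM2l.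
    have h5 : t * (b * sin n) = t * (h * n) by rewrite en'.
    by rewrite -(ltr_pM2l n0'); lra.
  have h3 : 0 <= sin (t - pi) by apply: sin_ge0_pi; lra.
  rewrite sinB sinpi cospi mulr0 subr0 mulrN1 in h3.
  have h4 : 0 <= b * - sin t by rewrite mulr_ge0// ltW.
  have := mulr_gt0 h0 t0; lra.
(* N is 2 pi, where branch_re is negative unless b h is large; otherwise it is the
   next solution of b sin t = h t *)
have [N [nN reN unN]] : exists N, [/\ n < N, re N < 0 & forall t, n < t < N -> b * sinc t < h].
  have [bh|bh] := leP (b * h) (8 * pi ^+ 2).
    exists (2 * pi); split; [by lra| |by move=> t /andP[nt tn]; apply: unbroken => //; exact: ltW].
    have e : br (2 * pi) = h / 2.
      apply: branch_uniq => //.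
      have s0 : sin (2 * pi) = 0 :> R.
        by rewrite mulr_natl mulr2n sinD sinpi mul0r mulr0 addr0.
      by rewrite /sinc gt_eqF ?mulr_gt0// s0 /branch_fun mul0r mulr0 (_ : h - _ = 0) ?mul0r//; field.
    have c1 : cos (2 * pi) = 1 :> R.
      by rewrite mulr_natl mulr2n cosD sinpi cospi; ring.
    rewrite /re /branch_re -/br e c1 mulr1.
    have ex : 1 - h / 2 <= expR (- (h / 2)) by exact: expR_ge1Dx.
    have h3 : b * (1 - expR (- (h / 2))) <= b * (h / 2) by rewrite ler_pM2l//; lra.
    have := exprn_gt0 2 h0; lra.
  have p2 : 2 * pi <= pi ^+ 2 :> R by rewrite expr2 ler_pM2r.
  have b8 : 8 * pi < b.
    rewrite -(ltr_pM2r h0); apply: le_lt_trans bh.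
    have : h * pi <= 2 * pi by rewrite ler_pM2r.
    lra.
  have csb : cts (fun t => b * sin t - h * t) by cont.
  have s2 : sin (2 * pi) = 0 :> R.
    by rewrite mulr_natl mulr2n sinD sinpi mul0r mulr0 addr0.
  have s52 : sin (5 / 2 * pi) = 1 :> R.
    rewrite (_ : 5 / 2 * pi = 2 * pi + pi / 2); last by lra.
    rewrite sinD s2 mul0r add0r sin_pihalf mulr1.
    by rewrite mulr_natl mulr2n cosD sinpi cospi; ring.
  have h25 : h * pi <= 2 * pi by rewrite ler_pM2r.
  have := mulr_gt0 h0 pi0 => hpi.
  have [|||N [N2 N52 eN ltN]] := @first_crossing R _ (2 * pi) (5 / 2 * pi) csb.
  - by lra.
  - by rewrite s2; lra.
  - by rewrite s52; lra.
  have N0 : 0 < N by lra.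
  have eN' : b * sinc N = h.
    by rewrite /sinc gt_eqF// mulrA (_ : b * sin N = h * N) ?mulfK ?gt_eqF//; lra.
  exists N; split; first by lra.
    rewrite re_cap//.
    have c0 : 0 <= cos N.
      have -> : cos N = cos (N - 2 * pi).
        rewrite cosB s2 mulr0 addr0 (_ : cos (2 * pi) = 1) ?mulr1//.
        by rewrite mulr_natl mulr2n cosD sinpi cospi; ring.
      apply: cos_ge0_pihalf; lra.
    have c1 := cos_le1 N.
    have h3 : 1 - cos N <= sin N ^+ 2.
      rewrite sin2cos2; have : cos N ^+ 2 <= cos N by rewrite expr2 ler_piMr.
      lra.
    have h4 : b * (1 - cos N) <= b * sin N ^+ 2 by rewrite ler_pM2l.
    have h5 : b * (b * sin N ^+ 2) = h ^+ 2 * N ^+ 2.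
      by rewrite (_ : b * (b * _) = (b * sin N) ^+ 2); [rewrite (_ : b * sin N = h * N); [ring|lra]|ring].
    have h6 : h ^+ 2 * N ^+ 2 < b * N ^+ 2.
      rewrite ltr_pM2r ?exprn_gt0//.
      have : h ^+ 2 <= 2 * 2 by rewrite expr2 ler_pM// ltW.
      lra.
    have : b * (b * sin N ^+ 2) < b * N ^+ 2 by rewrite h5.
    by rewrite ltr_pM2l//; lra.
  move=> t /andP[nt tN]; have [t2|t2] := leP t (2 * pi); first exact: unbroken.
  have t0 : 0 < t by lra.
  rewrite /sinc gt_eqF// mulrA ltr_pdivrMr//.
  by have := ltN t; rewrite (ltW t2) tN => /(_ isT); lra.
have crn : cts (fun t => - re t) by cont.
have [|||c [nc cN rec _]] := @first_crossing R _ n N crn; [exact: ltW|by lra|by lra|].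
have {}rec : re c = 0 by lra.
have cN' : c < N by rewrite lt_neqAle cN andbT; apply/eqP => e; move: reN; rewrite -e; lra.
have un := unN c; rewrite nc cN' in un; have {}un := un isT.
have le : b * sinc c <= branch_fun h 0 by rewrite bf0 ltW.
have c0' : 0 < c by exact: lt_trans nc.
exists (br c), c; split.
- have := branch_ge b h0 m0 mh c; rewrite -/br le_eqVlt => /predU1P[e|//].
  by have := branchE h0 m0 mh le; rewrite -/br -e bf0; lra.
- exact: ltW.
- by rewrite -rec /re /branch_re -/br; ring.
- exact: branch_root_im.
Qed.

End UnstableRootSmall.

(** * The region S *)

Section RegionTopology.
Context {R : realType}.
Implicit Types (p : R * R) (a h : R).

Let J := @G0 R `|` @G1 R `|` @C1 R.

Lemma open_pos (f : R * R -> R) : continuous f -> open [set p | 0 < f p].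
Proof.
move=> cf; apply: (@open_comp _ _ f [set x | 0 < x]); last exact: open_gt.
by move=> p _; exact: cf.
Qed.

Let cfst : continuous (fun p => p.1). Proof. by move=> p; exact: cvg_fst. Qed.
Let csnd : continuous (fun p => p.2). Proof. by move=> p; exact: cvg_snd. Qed.

Let open_aff (u v w : R) : open [set p | 0 < u * p.1 + v * p.2 + w].
Proof.
apply: open_pos => p; apply: cvgD; last exact: cvg_cst.
by apply: cvgD; apply: cvgM; [exact: cvg_cst|exact: cfst|exact: cvg_cst|exact: csnd].
Qed.

(** The points (- h, b) with h < b < critical_b a and h = critical_h a. With the
    parameter a quantified away, the set is open by its very form. *)
Definition under_curve : set (R * R) :=
  [set p | 0 < - p.1 /\ - p.1 < p.2] `&`
  \bigcup_(a in [set a | 0 < a < pi]) [set p | - p.1 < critical_h a /\ p.2 < critical_b a].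

(* an open set, disjoint from under_curve, that contains all points outside
   under_curve and J *)
Let outside : set (R * R) :=
  [set p | 0 < p.1] `|` [set p | p.1 < - 2] `|` [set p | p.2 < - p.1] `|`
  [set p | pi ^+ 2 / 2 < p.2] `|`
  \bigcup_(a in [set a | 0 < a < pi]) [set p | critical_h a < - p.1 /\ critical_b a < p.2].

Lemma open_under_curve : open under_curve.
Proof.
apply: openI.
  rewrite (_ : [set p | _] = [set p | 0 < -1 * p.1 + 0 * p.2 + 0] `&` [set p | 0 < 1 * p.1 + 1 * p.2 + 0]).
    by apply: openI; exact: open_aff.
  by apply/seteqP; split => p /= [h1 h2]; split; lra.
apply: bigcup_open => a _.
rewrite (_ : [set p | _] = [set p | 0 < 1 * p.1 + 0 * p.2 + critical_h a] `&`
    [set p | 0 < 0 * p.1 + -1 * p.2 + critical_b a]).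
  by apply: openI; exact: open_aff.
by apply/seteqP; split => p /= [h1 h2]; split; lra.
Qed.

Let open_outside : open outside.
Proof.
apply: openU; last first.
  apply: bigcup_open => a _.
  rewrite (_ : [set p | _] = [set p | 0 < -1 * p.1 + 0 * p.2 + - critical_h a] `&`
      [set p | 0 < 0 * p.1 + 1 * p.2 + - critical_b a]).
    by apply: openI; exact: open_aff.
  by apply/seteqP; split => p /= [h1 h2]; split; lra.
rewrite /outside; do 3?[apply: openU].
- by rewrite (_ : [set p | _] = [set p | 0 < 1 * p.1 + 0 * p.2 + 0]); [exact: open_aff|apply/seteqP; split => p /=; lra].
- by rewrite (_ : [set p | _] = [set p | 0 < -1 * p.1 + 0 * p.2 + -2]); [exact: open_aff|apply/seteqP; split => p /=; lra].
- by rewrite (_ : [set p | _] = [set p | 0 < -1 * p.1 + -1 * p.2 + 0]); [exact: open_aff|apply/seteqP; split => p /=; lra].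
- by rewrite (_ : [set p | _] = [set p | 0 < 0 * p.1 + 1 * p.2 + - (pi ^+ 2 / 2)]); [exact: open_aff|apply/seteqP; split => p /=; lra].
Qed.

Let cts_at (f : R -> R) a (k y : R) : der f a k ->
  (y < f a -> exists2 d, 0 < d & forall t, `|a - t| < d -> y < f t) /\
  (f a < y -> exists2 d, 0 < d & forall t, `|a - t| < d -> f t < y).
Proof.
move=> /is_derive_continuous/cvgrPdist_lt cf; split => hy.
  have := cf (f a - y) ltac:(by rewrite subr_gt0).
  rewrite -filter_from_ballE => -[d /= d0 hd]; exists d => // t /hd /=.
  by have := ler_norm (f a - f t); lra.
have := cf (y - f a) ltac:(by rewrite subr_gt0).
rewrite -filter_from_ballE => -[d /= d0 hd]; exists d => // t /hd /=.
by rewrite distrC; have := ler_norm (f t - f a); lra.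
Qed.

Lemma under_curveE h a (b : R) : 0 < a < pi -> h = critical_h a ->
  under_curve (- h, b) <-> h < b < critical_b a.
Proof.
move=> api ha; have h0 := critical_h_gt0 api; have /andP[a0 ap] := api.
split.
  rewrite /under_curve /= opprK => -[[_ hb] [x /= xpi [hx bx]]].
  rewrite hb /=; apply: lt_trans bx _; have /andP[x0 xp] := xpi.
  apply: critical_b_increasing => //; last exact: ltW.
  by rewrite opprK ha in hx; apply: critical_h_lt_inv.
move=> /andP[hb ba]; split; rewrite /= ?opprK; first by rewrite ha; split => //; rewrite -ha.
have ap' : 0 < a <= pi by rewrite a0 ltW.
have [+ _] := @cts_at critical_b a _ b (der_critical_b ap').
move=> /(_ ba)[d d0 hd].
pose x := Num.max (a / 2) (a - d / 2).
have x0 : a / 2 <= x by rewrite le_max lexx.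
have xd : a - d / 2 <= x by rewrite le_max lexx orbT.
have xa : x < a by rewrite gt_max; apply/andP; split; lra.
exists x => /=; first by lra.
split; last by apply: hd; rewrite ger0_norm; lra.
by rewrite opprK ha; apply: critical_h_decreasing; lra.
Qed.

Let cover p : ~ J p -> under_curve p \/ outside p.
Proof.
case: p => [h' b] nJ.
have [h e] : exists h, h' = - h by exists (- h'); rewrite opprK.
subst h'.
have pi0 := pi_gt0 R.
have [h0|h0|h0] := ltgtP h 0.
- by right; do 4 left; rewrite /= ; lra.
- have [h2|h2|h2] := ltgtP h 2.
  + have [a api ha] := @critical_h_surj R h ltac:(lra).
    have [hb|hb|hb] := ltgtP h b.
    * have [ba|ba|ba] := ltgtP b (critical_b a).
      - by left; apply/(under_curveE _ api (esym ha)); rewrite hb.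
      - right; right; have /andP[a0 ap] := api.
        have ap' : 0 < a <= pi by rewrite a0 ltW.
        have [_ +] := @cts_at critical_b a _ b (der_critical_b ap').
        move=> /(_ ba)[d d0 hd].
        pose x := Num.min ((a + pi) / 2) (a + d / 2).
        have x0 : x <= (a + pi) / 2 by rewrite ge_min lexx.
        have xd : x <= a + d / 2 by rewrite ge_min lexx orbT.
        have xa : a < x by rewrite lt_min; apply/andP; split; lra.
        exists x => /=; first by lra.
        split; last by apply: hd; rewrite ler0_norm; lra.
        by rewrite opprK -ha; apply: critical_h_decreasing; lra.
      - by exfalso; apply: nJ; right; apply/C1E; exists a => //; rewrite ha -ba.
    * by right; left; left; right; rewrite /= opprK.
    * by exfalso; apply: nJ; left; right; split; [split|split]; rewrite /= -?hb; lra.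
  + by right; do 3 left; right; rewrite /=; lra.
  + have [hb|hb|hb] := ltgtP h b.
    * right; right; have [a api [_ ha]] := @critical_near0 R (b - h) ltac:(lra).
      exists a => //=; rewrite opprK h2 critical_h_lt2//; split => //; lra.
    * by right; left; left; right; rewrite /= opprK.
    * by exfalso; apply: nJ; left; right; split; [split|split]; rewrite /= -?hb; lra.
- have [b0|b0] := ltP b 0; first by right; left; left; right; rewrite /= opprK h0.
  have [bp|bp] := ltP (pi ^+ 2 / 2) b; first by right; left; right.
  by exfalso; apply: nJ; left; left; rewrite h0 oppr0; split.
Qed.

Let disjoint_outside p : under_curve p -> outside p -> False.
Proof.
move=> [/= [p1 p2] [a /= api [ha ba]]].
have /andP[a0 ap] := api.
have ab := @critical_b_le R a; have := @critical_h_lt2 R a api => a2.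
move=> [[[[/=|/=]|/=]|/=]|[x /= xpi [hx bx]]]; [lra|lra|lra| |].
  by have := ab ltac:(lra); lra.
have /andP[x0 xp] := xpi.
have ax : a < x by apply: critical_h_lt_inv => //; lra.
have := critical_b_increasing a0 ax (ltW xp); lra.
Qed.

Lemma under_curve_notJ p : under_curve p -> ~ J p.
Proof.
case=> [/= [p1 p2] [a /= api [ha ba]]] [[[_ []]|[_ [_]]]|/C1E[x xpi e]]; [lra|lra|].
move: ha ba; rewrite e /= opprK => /(critical_h_lt_inv _ _) => /(_ xpi api) ax bx.
have /andP[a0 ap] := api; have /andP[x0 xp] := xpi.
have := critical_b_increasing a0 ax (ltW xp); lra.
Qed.

Lemma bounded_under_curve (A : set (R * R)) : A `<=` under_curve -> bounded_set A.
Proof.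
move=> AU; exists (2 + pi ^+ 2 / 2); split; first exact: num_real.
move=> M hM p /AU[/= [p1 p2] [a /= api [ha ba]]].
have a2 := critical_h_lt2 api.
have ab := @critical_b_le R a ltac:(lra).
have pp := exprn_ge0 2 (ltW (pi_gt0 R)).
rewrite prod_normE/= ge_max; apply/andP; split.
  by rewrite ltr0_norm; lra.
by rewrite gtr0_norm; lra.
Qed.

(** Off the Jordan curve, under_curve is open and closed, so connected sets that
    meet it stay inside, and it is bounded. *)
Lemma under_curve_region : under_curve `<=` @regionS R.
Proof.
move=> p up; split; first exact: under_curve_notJ.
apply: bounded_under_curve => q [A [Ap AJ cA] Aq].
have e : A `&` under_curve = A.
  apply: cA; first by exists p.
    by exists under_curve => //; exact: open_under_curve.
  exists (~` outside); first exact: open_closedC.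
  apply/seteqP; split => z [Az uz]; split => //.
    by move=> /(disjoint_outside uz).
  by case: (cover (AJ z Az)).
by move: Aq; rewrite -e => -[].
Qed.

(** Unless (- h, b) is below the curve, the vertical ray above it avoids the
    Jordan curve and makes its component unbounded. *)
Lemma region_below_curve h b : 0 < h -> h < b -> regionS (- h, b) ->
  exists a, [/\ 0 < a < pi, h = critical_h a & b < critical_b a].
Proof.
move=> h0 hb [nJ bnd].
suff [a api [ha hb']] : exists2 a, 0 < a < pi & h = critical_h a /\ b <= critical_b a.
  exists a; split => //; rewrite lt_neqAle hb' andbT; apply/eqP => e.
  by apply: nJ; right; apply/C1E; exists a => //; rewrite ha e.
apply: contrapT => no.
pose ray : set (R * R) := (fun s => (- h, s)) @` `[b, +oo[.
have ray_sub : ray `<=` ~` J.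
  move=> _ [s bs <-]; rewrite /= in_itv/= andbT in bs.
  move=> [[[_ [/=]]|[_ [_ /=]]]|/C1E[a api [e1 e2]]]; [lra|lra|].
  by apply: no; exists a => //; split; [lra|rewrite -e2].
have cray : connected ray.
  apply: connected_continuous_connected.
    by apply/connected_intervalP; exact: interval_is_interval.
  apply: continuous_subspaceT => s.
  apply/cvgrPdist_lt => e e0; near=> t.
  rewrite prod_normE/= subrr normr0 gt_max e0/=.
  by near: t; exists e.

have rayp : ray (- h, b) by exists b => //=; rewrite in_itv/= lexx.
have sub := connected_component_max rayp ray_sub cray.
have [M [_ hM]] := bnd.
pose s := Num.max b (M + 2 + `|M|).
have := hM (M + 1 + `|M|) ltac:(by have := normr_ge0 M; lra) (- h, s).
have rs : ray (- h, s) by exists s => //=; rewrite in_itv/= andbT le_max lexx.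
move=> /(_ (sub _ rs)); rewrite /= prod_normE/= ge_max => /andP[_].
have : M + 2 + `|M| <= s by rewrite le_max lexx orbT.
have := ler_norm s; lra.
Unshelve. all: by end_near.
Qed.

(** Points on the critical curve are limits of points of the region from below. *)
Lemma exterior_above_curve h b : 0 < h -> h < b -> ~ closure (@regionS R) (- h, b) ->
  h < 2 -> exists a, [/\ 0 < a < pi, h = critical_h a & critical_b a < b].
Proof.
move=> h0 hb ncl h2.
have [a api ha] := @critical_h_surj R h ltac:(lra).
exists a; split => //; rewrite ltNge; apply/negP => ba; apply: ncl.
move=> B [[U1 U2] /= [h1 h2'] UB].
have [d /= d0 hd] : exists2 d, 0 < d & forall s, `|b - s| < d -> U2 s.
  by move: h2'; rewrite -filter_from_ballE => -[d d0 hd]; exists d => //.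
pose s := Num.max ((h + b) / 2) (b - d / 2).
have s1 : (h + b) / 2 <= s by rewrite le_max lexx.
have s2 : b - d / 2 <= s by rewrite le_max lexx orbT.
have s3 : s < b by rewrite gt_max; apply/andP; split; lra.
exists (- h, s); split.
  apply: under_curve_region; apply/(under_curveE _ api (esym ha)); lra.
apply: UB; split => /=; first exact: nbhs_singleton h1.
by apply: hd; rewrite gtr0_norm; lra.
Qed.
End RegionTopology.

(** * The optimal velocity function near the first branch *)

Section OptimalVelocity.
Context {R : realType}.
Variables (V : R -> R) (Vmax dS : R).
Hypothesis ovf : optimal_velocity V Vmax dS.

Lemma ovf_der (t : R) : der V t (derive1 V t).
Proof. by rewrite derive1E; apply: DeriveDef => //; exact: (ovf_derivable ovf). Qed.

Lemma ovf_derive_left (t : R) : t < dS -> derive1 V t = 0.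
Proof.
move=> tdS; have d0 : der (fun=> 0 : R) t 0 by exact: der_cst.
have dV : der V t 0.
  apply: near_eq_is_derive d0; near=> s.
  have : `|t - s| < dS - t by near: s; exists (dS - t) => //=; rewrite subr_gt0.
  rewrite distrC => ts; rewrite (ovf_eq0 ovf)//.
  by have := ler_norm (s - t); lra.
by rewrite derive1E; exact: derive_val.
Unshelve. all: by end_near.
Qed.

Lemma ovf_lipschitz : exists2 L : R, 0 <= L & forall s t : R, `|V s - V t| <= L * `|s - t|.
Proof.
have [bi [bi0 _ decr]] := ovf_inflection ovf.
(* beyond N the slope decreases, before dS it vanishes *)
pose N := Num.max dS bi + 1.
have dN : dS <= N by have : dS <= Num.max dS bi := ltac:(by rewrite le_max lexx); rewrite /N; lra.
have bN : bi < N by have : bi <= Num.max dS bi := ltac:(by rewrite le_max lexx orbT); rewrite /N; lra.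
have cV : cts (derive1 V) by exact: (ovf_C1 ovf).
have [m mN hm] := @EVT_max R _ dS N dN (continuous_subspaceT cV).
pose L := Num.max 0 (derive1 V m).
have L0 : 0 <= L by rewrite le_max lexx.
have Lm : derive1 V m <= L by rewrite le_max lexx orbT.
have slope t : derive1 V t <= L.
  have [tdS|tdS] := ltP t dS; first by rewrite ovf_derive_left.
  have [tN|tN] := leP t N.
    by apply: le_trans Lm; apply: hm; rewrite in_itv/= tdS.
  apply: le_trans (_ : derive1 V N <= L).
    by apply/ltW/decr => //; rewrite inE/= in_itv/= andbT// (lt_trans bN).
  by apply: le_trans Lm; apply: hm; rewrite in_itv/= dN lexx.
exists L => // s t; wlog st : s t / t <= s => [hw|].
  have [/hw//|/ltW st] := leP t s; by rewrite distrC [`|s - t|]distrC; exact: hw.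
rewrite !ger0_norm ?subr_ge0 ?(ovf_homo ovf)//.
have := @der_ge0_le R (fun z => L * z - V z) (fun z => L - derive1 V z) t s st.
have dV z : der (fun z => L * z - V z) z (L - derive1 V z).
  by have := ovf_der z => dVz; derv; ring.
by move=> /(_ dV) /(_ (fun z _ => ltac:(by rewrite subr_ge0 slope))); lra.
Qed.

(** Left of the inflection point, V' (c) exceeds the mean slope of V on [dS, c],
    which is at least 1 / h. Right of it, V' (c) exceeds the mean slope on
    [c, cs], which is larger than 1 / h since the chord V cs = cs / hs lies
    above cs / h. *)
Lemma first_branch_slope (cs hs h c : R) : critical_pair V cs hs -> hs < h ->
  first_branch V dS cs h c -> 1 < h * derive1 V c.
Proof.
move=> [cs0 hs0 Vcs V'cs] hsh [dc ccs Vc].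
have h0 : 0 < h by exact: lt_trans hsh.
have dS0 := ovf_dS_ge0 ovf.
have [bi [bi0 incr decr]] := ovf_inflection ovf.
have mvt s t : s < t -> exists x, [/\ s < x, x < t & V t - V s = derive1 V x * (t - s)].
  by move=> st; apply: der_MVT => // x _; exact: ovf_der.
have [cbi|cbi] := leP c bi.
  have [x [dx xc e]] := mvt dS c dc.
  rewrite (ovf_eq0 ovf (lexx _)) subr0 in e.
  have h1 : 1 <= h * derive1 V x.
    have cd : 0 < c - dS by lra.
    by rewrite -(ler_pM2r cd) mul1r -mulrA -e Vc; lra.
  apply: le_lt_trans h1 _; rewrite ltr_pM2l//.
  pose z := (x + c) / 2.
  have xz : x < z by rewrite /z; lra.
  have zc : z < c by rewrite /z; lra.
  have V'xz : derive1 V x < derive1 V z.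
    by apply: incr => //; rewrite inE/= in_itv/=; apply/andP; split; lra.
  apply: lt_le_trans V'xz _; rewrite leNgt; apply/negP => V'c.
  have gap : 0 < derive1 V z - derive1 V c by rewrite subr_gt0.
  have /cvgrPdist_lt/(_ _ gap) := @ovf_C1 _ _ _ _ ovf c.
  rewrite -filter_from_ballE => -[d /= d0 hd].
  pose w := Num.max ((z + c) / 2) (c - d / 2).
  have w1 : (z + c) / 2 <= w by rewrite le_max lexx.
  have w2 : c - d / 2 <= w by rewrite le_max lexx orbT.
  have w3 : w < c by rewrite gt_max; apply/andP; split; lra.
  have := hd w; rewrite /ball/= gtr0_norm ?subr_gt0// => /(_ ltac:(lra)).
  have : derive1 V z < derive1 V w.
    by apply: incr; rewrite ?inE/= ?in_itv/=; [apply/andP; split; lra|apply/andP; split; lra|lra].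
  by rewrite distrC; have := ler_norm (derive1 V w - derive1 V c); lra.
have [x [cx xcs e]] := mvt c cs ccs.
have h1 : 1 < h * derive1 V x.
  have cd : 0 < cs - c by lra.
  have Vcs0 : 0 < V cs by rewrite -(pmulr_rgt0 _ hs0) Vcs.
  have h2 : hs * V cs < h * V cs by rewrite ltr_pM2r.
  by rewrite -(ltr_pM2r cd) mul1r -mulrA -e mulrBr; lra.
apply: lt_trans h1 _; rewrite ltr_pM2l//.
by apply: decr; rewrite ?inE/= ?in_itv/= ?andbT//; exact: lt_trans cx.
Qed.

Lemma ovf_quadratic_remainder (c : R) : dS < c -> exists2 M : R, 0 <= M & exists2 rho : R, 0 < rho &
  forall s, `|s| <= rho -> `|V (c + s) - V c - derive1 V c * s| <= M * s ^+ 2.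
Proof.
move=> dc; have := ovf_derivable2 ovf dc; set V' := derive1 V => dV'.
pose l := 'D_1 V' c; pose M := `|l| + 1.
have M0 : 0 <= M by rewrite addr_ge0.
have [d d0 hd] : exists2 d : R, 0 < d & forall t, `|t| < d -> `|V' (c + t) - V' c| <= M * `|t|.
  have /cvgrPdist_lt/(_ 1 ltr01) : h^-1 *: (V' (h *: 1 + c) - V' c) @[h --> 0^'] --> l by exact: dV'.
  rewrite /dnbhs /within/= -filter_from_ballE => -[d /= d0 hd]; exists d => // t td.
  have [->|t0] := eqVneq t 0; first by rewrite addr0 subrr !normr0 mulr0.
  have := hd t; rewrite /ball/= sub0r normrN => /(_ td t0).
  rewrite scaler1 [t + c]addrC; set q := V' (c + t) - V' c => hq.
  have -> : q = t * (t^-1 *: q) by rewrite /GRing.scale/= mulrA mulfV// mul1r.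
  rewrite normrM mulrC ler_wpM2r//; move: hq; set u := _ *: _ => hq.
  by have := ler_normB l (l - u); rewrite opprB addrC subrK /M; lra.
exists M => //; exists (d / 2); first by rewrite divr_gt0.
move=> s sd.
pose F t := V (c + t) - V c - V' c * t.
have dF t : der F t (V' (c + t) - V' c).
  have dVt := ovf_der (c + t); rewrite /F; derv; rewrite -/V'; ring.
have F0 : F 0 = 0 by rewrite /F addr0 subrr mulr0 subrr.
have dF' a b' t (_ : a <= t <= b') := dF t.
rewrite -/(F s); suff [x [xs ->]] : exists x, `|x| <= `|s| /\ F s = (V' (c + x) - V' c) * s.
  have xd : `|x| < d by lra.
  rewrite normrM -[s ^+ 2]real_normK ?num_real// expr2 mulrA ler_wpM2r//.
  by apply: le_trans (hd x xd) _; rewrite ler_wpM2l.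
have [s0|s0|->] := ltgtP s 0.
- have [x [sx x0]] := der_MVT s0 (dF' _ _); rewrite F0 => e.
  by exists x; rewrite !ltr0_norm//; split; lra.
- have [x [x0 xs]] := der_MVT s0 (dF' _ _); rewrite F0 => e.
  by exists x; rewrite !gtr0_norm//; split; lra.
- by exists 0; rewrite F0 mulr0.
Qed.
End OptimalVelocity.

(** * Deviations from the wavefront *)

Section PairCalculus.
Context {R : realType}.
Implicit Types (w : R -> R * R) (x y : R -> R).

Lemma cvg_fst_comp (T : Type) (F : set_system T) (q : T -> R * R) (l : R * R) :
  q z @[z --> F] --> l -> (q z).1 @[z --> F] --> l.1.
Proof. by move=> ql; apply: cvg_comp ql _; exact: cvg_fst. Qed.

Lemma cvg_snd_comp (T : Type) (F : set_system T) (q : T -> R * R) (l : R * R) :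
  q z @[z --> F] --> l -> (q z).2 @[z --> F] --> l.2.
Proof. by move=> ql; apply: cvg_comp ql _; exact: cvg_snd. Qed.

Let quot (T : normedModType R) (f : R -> T) t := fun h : R => h^-1 *: (f (h *: 1 + t) - f t).

Lemma der_fst_snd w t : derivable w t 1 ->
  der (fun s => (w s).1) t (derive1 w t).1 /\ der (fun s => (w s).2) t (derive1 w t).2.
Proof.
move=> dw; have cw : quot w t h @[h --> 0^'] --> derive1 w t by rewrite derive1E.
have c1 : quot (fun s => (w s).1) t h @[h --> 0^'] --> (derive1 w t).1.
  have := cvg_fst_comp cw; exact.
have c2 : quot (fun s => (w s).2) t h @[h --> 0^'] --> (derive1 w t).2.
  have := cvg_snd_comp cw; exact.
by split; apply: DeriveDef; [apply/cvg_ex; eexists; exact: c1|exact: cvg_lim c1|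
  apply/cvg_ex; eexists; exact: c2|exact: cvg_lim c2].
Qed.

Lemma der_pair x y t (k l : R) : der x t k -> der y t l ->
  derivable (fun s => (x s, y s)) t 1 /\ derive1 (fun s => (x s, y s)) t = (k, l).
Proof.
move=> dx dy.
have cx : quot x t h @[h --> 0^'] --> k.
  by rewrite -(@derive_val _ _ _ _ _ _ _ dx); exact: (@ex_derive _ _ _ _ _ _ _ dx).
have cy : quot y t h @[h --> 0^'] --> l.
  by rewrite -(@derive_val _ _ _ _ _ _ _ dy); exact: (@ex_derive _ _ _ _ _ _ _ dy).
have cxy : quot (fun s => (x s, y s)) t h @[h --> 0^'] --> (k, l).
  exact: cvg_pair cx cy.
split; first by apply/cvg_ex; exists (k, l).
by rewrite derive1E; exact: cvg_lim cxy.
Qed.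

(** A solution is extended to the left of -1 by its value at -1. *)
Lemma continuous_clamp (T : topologicalType) (w : R -> T) :
  {within `[- 1, +oo[, continuous w} -> continuous (fun t : R => w (Num.max (- 1) t)).
Proof.
move=> /subspace_continuousP cw t.
have cm : continuous (fun s : R => Num.max (-1) s).
  have -> : (fun s : R => Num.max (-1) s) = (fun s => (s - 1 + `|s + 1|) / 2).
    apply/funext => s; have [h|h] := leP (-1) s; first by rewrite ger0_norm; lra.
    by rewrite ltr0_norm; lra.
  by have : cts (fun s : R => (s - 1 + `|s + 1|) / 2) by cont.
have mA (s : R) : `[- 1, +oo[%classic (Num.max (-1) s).
  have h : -1 <= Num.max (-1) s by rewrite le_max lexx.
  by rewrite /= in_itv; apply/andP; split.
move=> P /(cw _ (mA t)) /= h1.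
have h2 := cm t _ h1.
exact: (@filterS _ (nbhs t) _ _ _ (fun s hs => hs (mA s)) h2).
Qed.
End PairCalculus.

Section SupNorm.
Context {R : realType}.
Implicit Types (psi : R -> R * R) (v : R * R).

Lemma eucl_norm_ge v : `|v.1| <= eucl_norm v /\ `|v.2| <= eucl_norm v.
Proof.
by split; rewrite -sqrtr_sqr ler_sqrt ?addr_ge0 ?sqr_ge0// ?lerDl ?lerDr sqr_ge0.
Qed.

Lemma eucl_norm_le v : eucl_norm v <= `|v.1| + `|v.2|.
Proof.
rewrite -[leRHS]ger0_norm ?addr_ge0// -sqrtr_sqr ler_sqrt ?sqr_ge0//.
rewrite sqrrD !real_normK ?num_real// -addrA lerD2l addrC lerDl.
by rewrite mulrn_wge0// mulr_ge0.
Qed.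

Lemma normC_ge psi (x y : R -> R) : cts x -> cts y ->
  (forall s, -1 <= s <= 0 -> psi s = (x s, y s)) ->
  forall s, -1 <= s <= 0 -> eucl_norm (psi s) <= normC psi.
Proof.
move=> c1 c2 e s hs; apply: sup_upper_bound; last by exists s => //=; rewrite in_itv.
split; first by exists (eucl_norm (psi 0)), 0 => //=; rewrite in_itv/= lexx lerN10.
have cn : cts (fun s => `|x s| + `|y s|) by cont.
have [m _ hm] := @EVT_max R _ (-1) 0 (lerN10 _) (continuous_subspaceT cn).
exists (`|x m| + `|y m|) => _ [z /= zi <-].
apply: le_trans (eucl_norm_le _) _.
by rewrite e; [exact: hm|move: zi; rewrite in_itv].
Qed.

Lemma normC_le psi (B : R) : (forall s, -1 <= s <= 0 -> eucl_norm (psi s) <= B) -> normC psi <= B.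
Proof.
move=> hB; apply: ge_sup; first by exists (eucl_norm (psi 0)), 0 => //=; rewrite in_itv/= lexx lerN10.
by move=> _ [s /= si <-]; apply: hB; move: si; rewrite in_itv.
Qed.
End SupNorm.

Section Deviation.
Context {R : realType}.
Variables (V : R -> R) (h c d : R).
Hypothesis hVc : h * V c = c.
Let b := h ^+ 2 * derive1 V c.

(** The change of the acceleration when the headway c is increased by s. *)
Definition gap_force (s : R) := h ^+ 2 * (V (c + s) - V c).
Definition gap_remainder (s : R) := gap_force s - h ^+ 2 * derive1 V c * s.

Let deviation_rhs (x y : R -> R) t :=
  h * y t + b * (x (t - 1) - x t) + gap_remainder (x (t - 1) - x t).

Let deviation_rhsE (x y : R -> R) t :
  deviation_rhs x y t =
  h ^+ 2 * V ((x (t - 1) - c * (t - 1) + d) - (x t - c * t + d)) + h * (y t - c).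
Proof.
rewrite /deviation_rhs /gap_remainder /gap_force -/b.
have -> : x (t - 1) - c * (t - 1) + d - (x t - c * t + d) = c + (x (t - 1) - x t) by ring.
have : h * (h * V c) = h * c by rewrite hVc.
by rewrite mulrBr mulrA -expr2; lra.
Qed.

Lemma solution_deviation (phi w : R -> R * R) : solution V h phi w ->
  exists x y : R -> R, [/\ cts x, cts y,
    forall t, -1 <= t -> w t = (x t - c * t + d, y t - c) &
    forall t, 0 < t -> der x t (y t) /\
      der y t (h * y t + b * (x (t - 1) - x t) + gap_remainder (x (t - 1) - x t))].
Proof.
case=> cw _ dw _ ew.
have cwm := continuous_clamp cw.
pose wm (t : R) := w (Num.max (-1) t).
have wmE t : -1 <= t -> wm t = w t.
  by move=> t1; rewrite /wm; congr w; apply/max_idPr.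
pose w1 (t : R) := (wm t).1; pose w2 (t : R) := (wm t).2.
have cw1 : cts w1.
  by move=> t; exact: (cvg_fst_comp (cwm t)).
have cw2 : cts w2.
  by move=> t; exact: (cvg_snd_comp (cwm t)).
pose x t := w1 t + c * t - d; pose y t := w2 t + c.
have wE t : -1 <= t -> w t = (x t - c * t + d, y t - c).
  move=> t1; rewrite /x /y /w1 /w2 wmE// addrK; case: (w t) => p q /=; congr pair; ring.
exists x, y; split => //; [by rewrite /x; cont|by rewrite /y; cont|].
move=> t t0.
have near_w : \forall s \near t, w s = wm s.
  near=> s; rewrite wmE//.
  have : `|t - s| < t by near: s; exists t.
  by have := ler_norm (t - s); lra.
have [d1 d2] := der_fst_snd (dw t t0); rewrite (ew t t0) /rhs /segment addr0 in d1 d2.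
have dx : der w1 t (w t).2.
  by apply: near_eq_is_derive d1; near=> s; congr (_.1); near: s.
have dy : der w2 t (h ^+ 2 * V ((w (t - 1)).1 - (w t).1) + h * (w t).2).
  by apply: near_eq_is_derive d2; near=> s; congr (_.2); near: s.
rewrite -/(deviation_rhs x y t) deviation_rhsE.
have t1 : -1 <= t - 1 by lra.
have t2 : -1 <= t by lra.
rewrite !wE//= in dx dy.
split; first by rewrite /x; derv; ring.
by rewrite {1}/y; derv; ring.
Unshelve. all: by end_near.
Qed.

Lemma deviation_solution (x y : R -> R) : cts x -> cts y ->
  (forall t, 0 < t -> der x t (y t) /\
    der y t (h * y t + b * (x (t - 1) - x t) + gap_remainder (x (t - 1) - x t))) ->
  continuous V ->
  solution V h (fun t => (x t - c * t + d, y t - c)) (fun t => (x t - c * t + d, y t - c)).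
Proof.
move=> cx cy dxy cV; set w := fun t => _.
have dw t : 0 < t -> derivable w t 1 /\ derive1 w t = rhs V h (segment w t).
  move=> /dxy[dx dy]; rewrite /rhs /segment /= addr0 /=.
  rewrite -/(deviation_rhs x y t) deviation_rhsE in dy.
  apply: der_pair; first by derv; ring.
  by derv; ring.
have cpair (f g : R -> R) : cts f -> cts g -> continuous (fun t => (f t, g t)).
  by move=> cf cg t; exact: cvg_pair (cf t) (cg t).
have cw : continuous w by apply: cpair; cont.
split.
- exact: continuous_subspaceT.
- by [].
- by move=> t /dw[].
- move=> t t0; have cV' : cts V by exact: cV.
  have cr : continuous (fun t => rhs V h (segment w t)).
    by rewrite /rhs /segment /w /=; apply: cpair; cont.
  suff : derive1 w s @[s --> t] --> rhs V h (segment w t) by rewrite -(dw t t0).2.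
  apply: cvg_trans (cr t).
  apply: near_eq_cvg; near=> s; rewrite (dw s _).2//.
  have : `|t - s| < t by near: s; exists t.
  by have := ler_norm (t - s); lra.
- by move=> t /dw[].
Unshelve. all: by end_near.
Qed.
End Deviation.

(** * Stability and instability of the wavefront *)

Section Wavefront.
Context {R : realType}.

Lemma unstable_root (h b : R) : 0 < h -> h < b ->
  (h < 2 -> exists a, [/\ 0 < a < pi, h = critical_h a & critical_b a < b]) ->
  exists mu nu, [/\ 0 < mu, 0 <= nu,
    mu ^+ 2 - nu ^+ 2 - h * mu + b * (1 - expR (- mu) * cos nu) = 0 &
    2 * mu * nu - h * nu + b * expR (- mu) * sin nu = 0].
Proof.
move=> h0 hb above; have [h2|h2] := leP h 2.
  exact: unstable_root_small.
by apply: unstable_root_large => //; lra.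
Qed.

Variables (V : R -> R) (Vmax dS : R).
Hypothesis ovf : optimal_velocity V Vmax dS.
Variables (cs hs h c d : R).
Hypotheses (pair : critical_pair V cs hs) (hsh : hs < h) (branch1 : first_branch V dS cs h c).
Let b := h ^+ 2 * derive1 V c.
Let G := gap_force V h c.
Let r := gap_remainder V h c.

Let h0 : 0 < h. Proof. by have [_ hs0 _ _] := pair; exact: lt_trans hsh. Qed.
Let hVc : h * V c = c. Proof. by have [] := branch1. Qed.
Let hb : h < b.
Proof.
have := first_branch_slope ovf pair hsh branch1.
by rewrite /b expr2 -mulrA -(ltr_pM2l h0) mulr1.
Qed.
Let cV : continuous V.
Proof. exact: (der_cts (ovf_der ovf)). Qed.
Let cr : cts r.
Proof.
have cV' : cts V := cV.
by rewrite /r /gap_remainder /gap_force; cont.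
Qed.
Let remainder : exists2 M : R, 0 <= M & exists2 rho : R, 0 < rho &
  forall s, `|s| <= rho -> `|r s| <= M * s ^+ 2.
Proof.
have [dc _ _] := branch1; have [M M0 [rho rho0 hr]] := ovf_quadratic_remainder ovf dc.
exists (h ^+ 2 * M); first by rewrite mulr_ge0// sqr_ge0.
exists rho => // s /hr hs'.
have -> : r s = h ^+ 2 * (V (c + s) - V c - derive1 V c * s).
  by rewrite /r /gap_remainder /gap_force; ring.
by rewrite normrM (ger0_norm (sqr_ge0 h)) -mulrA ler_wpM2l// sqr_ge0.
Qed.

(** Below the critical curve [indicator_coercive] supplies what [stability_core]
    needs; the rest compares the norms. *)
Lemma wavefront_stable : regionS (- h, b) -> stable V h (wavefront c d).
Proof.
move=> /(region_below_curve h0 hb)[a [api ha ba]] eps eps0.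
have [e e0 [ebh coercive]] := indicator_coercive api ha hb ba.
have [M M0 [rho rho0 hr]] := remainder.
have [K K0 [d0 d00 bound]] :=
  stability_core h0 hb (multiplier_gain_gt0 api) e0 ebh coercive cr M0 rho0 hr.
have K1 : 0 < 4 * (K + 1) by lra.
pose delta := Num.min d0 (eps / (4 * (K + 1))).
have delta0 : 0 < delta by rewrite lt_min d00 divr_gt0.
have deltad : delta <= d0 by rewrite ge_min lexx.
have deltae : delta * (4 * (K + 1)) <= eps by rewrite -ler_pdivlMr// ge_min lexx orbT.
exists delta => // phi _ small w sol t t0.
have [x [y [cx cy wE dxy]]] := solution_deviation d hVc sol.
have small_xy s : -1 <= s <= 0 -> `|x s| <= delta /\ `|y s| <= delta.
  move=> s1; have cNx : cts (fun s => - x s) by cont.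
  have cNy : cts (fun s => - y s) by cont.
  have e1 z : -1 <= z <= 0 -> (segment (wavefront c d) 0 - phi) z = (- x z, - y z).
    move=> z1; have -> : (segment (wavefront c d) 0 - phi) z = wavefront c d (0 + z) - phi z by [].
    have <- : w z = phi z by apply: (sol_init sol); rewrite inE/= in_itv.
    rewrite add0r wE; last by case/andP: z1.
    by rewrite /wavefront; apply/pair_equal_spec; split; rewrite /=; ring.
  have := normC_ge cNx cNy e1 s1; rewrite (e1 s s1) => h1.
  have [/= h2 h3] := eucl_norm_ge (- x s, - y s).
  by rewrite !normrN in h2 h3; split; lra.
have x_init s : -1 <= s <= 0 -> `|x s| <= delta by move=> /small_xy[].
have y_init : `|y 0| <= delta by apply: (small_xy 0 _).2; rewrite lexx lerN10.
have xy_small s : -1 <= s -> `|x s| <= (K + 1) * delta /\ `|y s| <= (K + 1) * delta.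
  have := mulr_gt0 K0 delta0 => Kd s1.
  have [s0|s0] := leP 0 s.
    by have [] := bound x y delta delta0 deltad cx cy x_init y_init dxy s s0; split; lra.
  have [] := small_xy s; first by rewrite s1 ltW.
  by split; lra.
apply: le_lt_trans (_ : 2 * (K + 1) * delta < eps); last by lra.
apply: normC_le => s /andP[s1 s0].
have t1 : -1 <= t + s by lra.
have -> : (segment (wavefront c d) t - segment w t) s = wavefront c d (t + s) - w (t + s) by [].
rewrite wE//; apply: le_trans (eucl_norm_le _) _.
rewrite /wavefront/=.
rewrite (_ : - c * (t + s) + d - (x (t + s) - c * (t + s) + d) = - x (t + s)); last by ring.
rewrite (_ : - c - (y (t + s) - c) = - y (t + s)); last by ring.
by rewrite !normrN; have [] := xy_small _ t1; lra.
Qed.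

(** Arbitrarily close to the wavefront, [instability_core] provides solutions that
    escape from a fixed neighbourhood. *)
Lemma wavefront_unstable : ~ closure (@regionS R) (- h, b) -> unstable V h (wavefront c d).
Proof.
move=> /(exterior_above_curve h0 hb) above stab.
have [mu [nu [mu0 nu0 re im]]] := unstable_root h0 hb above.
have [M M0 [rho rho0 hr]] := remainder.
have [eta eta0 escape] := instability_core (ltW h0) mu0 nu0 re im cr M0 rho0 hr.
have [delta delta0 close] := stab eta eta0.
have [dl /andP[dl0 dldelta] {}escape] := escape delta delta0.
have [L L0 lipV] := ovf_lipschitz ovf.
have lipG s t : `|G s - G t| <= h ^+ 2 * L * `|s - t|.
  rewrite /G /gap_force -mulrBr normrM (ger0_norm (sqr_ge0 h)) -mulrA ler_wpM2l ?sqr_ge0//.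
  have := lipV (c + s) (c + t); rewrite (_ : c + s - (c + t) = s - t); last by ring.
  by rewrite (_ : V (c + s) - V c - (V (c + t) - V c) = V (c + s) - V (c + t)); last by ring.
have G0 : G 0 = 0 by rewrite /G /gap_force addr0 subrr mulr0.
have l0 : 0 <= h ^+ 2 * L by rewrite mulr_ge0// sqr_ge0.
have [x [y [cx cy past dxy _]]] := delay_solution_exists dl (ltW h0) l0 G0 lipG.
have dxy' t : 0 < t -> der x t (y t) /\
    der y t (h * y t + b * (x (t - 1) - x t) + r (x (t - 1) - x t)).
  move=> /dxy[dx dy]; split => //; move: dy.
  by rewrite (_ : h * y t + G _ = h * y t + b * (x (t - 1) - x t) + r (x (t - 1) - x t))//
     /r /gap_remainder -/G /b; ring.
have sol := deviation_solution d hVc cx cy dxy' cV.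
set w := fun t => _ in sol.
have [t t0 large] := escape x y cx cy past dxy'.
have diff t' s : (segment (wavefront c d) t' - segment w t') s = (- x (t' + s), - y (t' + s)).
  have -> : (segment (wavefront c d) t' - segment w t') s = wavefront c d (t' + s) - w (t' + s) by [].
  by rewrite /wavefront; apply/pair_equal_spec; split; rewrite /w/=; ring.
have w0 : segment w 0 = w by apply/funext => s; rewrite /segment add0r.
have phase : phase_space w.
  rewrite /phase_space /=; apply: continuous_subspaceT => s.
  have c1 : cts (fun s => x s - c * s + d) by cont.
  have c2 : cts (fun s => y s - c) by cont.
  exact: cvg_pair (c1 s) (c2 s).
have small : normC (segment (wavefront c d) 0 - w) < delta.
  rewrite -{1}w0; apply: le_lt_trans dldelta; apply: normC_le => s /andP[_ s0].
  rewrite diff add0r; have [-> ->] := past s s0.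
  by apply: le_trans (eucl_norm_le _) _; rewrite /= oppr0 normr0 add0r normrN gtr0_norm.
have := close w phase small w sol t t0; rewrite ltNge => /negP; apply.
have cx' : cts (fun s => - x (t + s)) by cont.
have cy' : cts (fun s => - y (t + s)) by cont.
have := @normC_ge R _ _ _ cx' cy' (fun s _ => diff t s) 0.
rewrite lexx lerN10 => /(_ isT); rewrite diff addr0.
have [_ /=] := eucl_norm_ge (- x t, - y t); rewrite normrN; lra.
Qed.
End Wavefront.

Theorem theorem5p5 (R : realType) (V : R -> R) (Vmax dS : R)
    (V_ovf : optimal_velocity V Vmax dS)
    (cs hs : R) (cs_hs : critical_pair V cs hs)
    (h : R) (hs_h : hs < h) (h_hhat : (h%:E < hhat V dS)%E)
    (c1 : R) (c1_branch : first_branch V dS cs h c1) (d : R) :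
  (regionS (- h, h ^+ 2 * derive1 V c1) ->
     stable V h (wavefront c1 d)) /\
  ((@quadrant R `\` closure (@regionS R)) (- h, h ^+ 2 * derive1 V c1) ->
     unstable V h (wavefront c1 d)).
Proof.
split; first exact: wavefront_stable V_ovf _ _ _ _ _ cs_hs hs_h c1_branch.
by case=> _; exact: wavefront_unstable V_ovf _ _ _ _ _ cs_hs hs_h c1_branch.
Qed.
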